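(* Let $P(x_1,x_2)=\sum_{k_1,k_2\ge 0} b_{k_1,k_2}x_1^{k_1}x_2^{k_2}$ be a complex polynomial, and let $x_1,x_2\in\mathbb{C}$ with $|x_1|=|x_2|=1$ and $x_1^{k_1}x_2^{k_2}\ne1$ for all $(k_1,k_2)\in\mathbb{Z}^2\setminus\{(0,0)\}$. Assume that $g_\Theta\in\mathcal{F}(r,\vartheta,K)$ for some $r>0$, $\vartheta>0$, $K\in\mathbb{C}$. Then, as $N\to\infty$, $$\mathbb{E}_\Theta[W^N(P)(x_1,x_2)]=\sum_{\substack{k_1,k_2\\ b_{k_1,k_2}\ne0}}E_2(k_1,k_2)\,N^{\vartheta(b_{k_1,k_2}-1)}\,x_1^{Nk_1}x_2^{Nk_2}\left(\frac{\Gamma(\vartheta)}{\Gamma(\vartheta b_{k_1,k_2})}+O\left(\frac1N\right)\right),$$ where $$E_2(k_1,k_2)=e^{K(b_{k_1,k_2}-1)}\prod_{(m_1,m_2)\ne(k_1,k_2)}\bigl(G_\Theta(r x_1^{m_1-k_1}x_2^{m_2-k_2})\bigr)^{b_{m_1,m_2}}.$$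
   Context: $\mathfrak{S}_N$ is the symmetric group on $N$ objects; for $\sigma\in\mathfrak{S}_N$, $C_k(\sigma)$ is the number of cycles of $\sigma$ of length $k$. Let $\Theta=(\theta_k)_{k\ge1}$ be a sequence of strictly positive reals. The generalized Ewens measure on $\mathfrak{S}_N$ is $\mathbb{P}_\Theta[\sigma]=\frac{1}{h_N N!}\prod_{k=1}^N\theta_k^{C_k(\sigma)}$, with $h_N$ the normalization constant ($h_0:=1$); $\mathbb{E}_\Theta$ is its expectation. Put $g_\Theta(t)=\sum_{k\ge1}\frac{\theta_k}{k}t^k$ and $G_\Theta(t)=\exp(g_\Theta(t))$; for $b\in\mathbb{C}$, $G_\Theta(t)^b:=\exp(b\,g_\Theta(t))$. For a polynomial $P(x_1,x_2)$ and $\sigma\in\mathfrak{S}_N$ with cycle lengths $\lambda_1,\dots,\lambda_\ell$ (counted with multiplicity), $W^N(P)(x_1,x_2)=W^N(P)(x_1,x_2)(\sigma):=\prod_{m=1}^{\ell}P(x_1^{\lambda_m},x_2^{\lambda_m})$. For $R>r>0$ and $0<\phi<\pi/2$ let $\Delta_0(r,R,\phi)=\{z\in\mathbb{C}: |z|<R,\ z\ne r,\ |\arg(z-r)|>\phi\}$. A function $g$ is in $\mathcal{F}(r,\vartheta,K)$ if there exist $R>r$ and $0<\phi<\pi/2$ such that $g$ is holomorphic in $\Delta_0(r,R,\phi)$ (for a power series: it continues holomorphically there) and $g(t)=\vartheta\log\left(\frac{1}{1-t/r}\right)+K+O(t-r)$ as $t\to r$ with $t\in\Delta_0(r,R,\phi)$.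 The values of $g_\Theta$, $G_\Theta$ at points of the circle $|t|=r$, $t\ne r$, are those of this continuation. Here $1/\Gamma$ is the entire reciprocal Gamma function. The constants in $O(\cdot)$ may depend on $P,x_1,x_2,\Theta$. *)

(* Defs.v *)
From Stdlib Require Import Reals ZArith.
From mathcomp Require Import ssreflect ssrfun ssrbool eqtype ssrnat seq.
From mathcomp Require Import choice fintype finset bigop fingroup perm.
From Coquelicot Require Import Coquelicot.

Set Implicit Arguments.
Unset Strict Implicit.
Unset Printing Implicit Defensive.

Open Scope R_scope.

Reserved Notation "\csum_ ( i < n ) F"
  (at level 41, F at level 41, i, n at level 50,
   format "'[' \csum_ ( i  <  n ) '/  '  F ']'").
Reserved Notation "\csum_ ( i < n | P ) F"
  (at level 41, F at level 41, i, n at level 50,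
   format "'[' \csum_ ( i  <  n  |  P ) '/  '  F ']'").
Reserved Notation "\csum_ ( i : t ) F"
  (at level 41, F at level 41, i at level 50,
   format "'[' \csum_ ( i  :  t ) '/  '  F ']'").
Reserved Notation "\cprod_ ( i < n ) F"
  (at level 36, F at level 36, i, n at level 50,
   format "'[' \cprod_ ( i  <  n ) '/  '  F ']'").
Reserved Notation "\cprod_ ( i < n | P ) F"
  (at level 36, F at level 36, i, n at level 50,
   format "'[' \cprod_ ( i  <  n  |  P ) '/  '  F ']'").
Reserved Notation "\cprod_ ( i 'in' A ) F"
  (at level 36, F at level 36, i, A at level 50,
   format "'[' \cprod_ ( i  'in'  A ) '/  '  F ']'").

Notation "\csum_ ( i < n ) F" := (\big[Cplus/RtoC 0]_(i < n) F%C) : C_scope.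
Notation "\csum_ ( i < n | P ) F" :=
  (\big[Cplus/RtoC 0]_(i < n | P%B) F%C) : C_scope.
Notation "\csum_ ( i : t ) F" := (\big[Cplus/RtoC 0]_(i : t) F%C) : C_scope.
Notation "\cprod_ ( i < n ) F" := (\big[Cmult/RtoC 1]_(i < n) F%C) : C_scope.
Notation "\cprod_ ( i < n | P ) F" :=
  (\big[Cmult/RtoC 1]_(i < n | P%B) F%C) : C_scope.
Notation "\cprod_ ( i 'in' A ) F" :=
  (\big[Cmult/RtoC 1]_(i in A) F%C) : C_scope.

Definition Cexp (z : C) : C := (exp (Re z) * cos (Im z), exp (Re z) * sin (Im z)).

(* Values in (-PI, PI]; Carg 0 is irrelevant. *)
Definition Carg (z : C) : R :=
  (if Rle_dec 0 (Im z) then 1 else -1) * acos (Re z / Cmod z).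

Definition Clog (z : C) : C := (ln (Cmod z), Carg z).

Definition Rcpow (x : R) (s : C) : C := Cexp (s * RtoC (ln x)).

Definition Czpow (z : C) (k : Z) : C :=
  match k with
  | Z0 => RtoC 1
  | Zpos p => Cpow z (Pos.to_nat p)
  | Zneg p => Cinv (Cpow z (Pos.to_nat p))
  end.

(* The entire function 1/Gamma, by the Euler-Gauss limit
     1/Gamma(z) = lim_n z (z+1) ... (z+n) / (n! n^z),
   which is valid for every complex z (it is 0 at z = 0, -1, -2, ...). *)

Definition rGamma_seq (z : C) (n : nat) : C :=
  ((\cprod_(j < n.+1) (z + RtoC (INR j)))
     / (RtoC (INR n`!) * Rcpow (INR n) z))%C.

Definition rGamma (z : C) : C :=
  (real (Lim_seq (fun n => Re (rGamma_seq z n))),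
   real (Lim_seq (fun n => Im (rGamma_seq z n)))).

Definition CGamma (z : C) : C := Cinv (rGamma z).

Record bipoly := Bipoly {
  bcoef : nat -> nat -> C;
  bsize : nat;
  bcoefP : forall k1 k2 : nat,
    bcoef k1 k2 <> RtoC 0 -> (k1 < bsize)%N /\ (k2 < bsize)%N
}.

Definition beval (P : bipoly) (x1 x2 : C) : C :=
  (\csum_(k1 < bsize P) \csum_(k2 < bsize P)
     (bcoef P k1 k2 * x1 ^ k1 * x2 ^ k2))%C.

Definition cycle_count (N : nat) (s : 'S_N) (k : nat) : nat :=
  #|[set c in porbits s | #|c| == k]|.

Definition ewens_weight (theta : nat -> R) (N : nat) (s : 'S_N) : R :=
  \big[Rmult/1]_(1 <= k < N.+1) (theta k ^ cycle_count s k).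

Definition ewens_h (theta : nat -> R) (N : nat) : R :=
  / INR N`! * \big[Rplus/0]_(s : 'S_N) ewens_weight theta s.

Definition ewens_prob (theta : nat -> R) (N : nat) (s : 'S_N) : R :=
  / (ewens_h theta N * INR N`!) * ewens_weight theta s.

Definition ewens_expect (theta : nat -> R) (N : nat) (f : 'S_N -> C) : C :=
  (\csum_(s : 'S_N) (RtoC (ewens_prob theta s) * f s))%C.

Definition W (N : nat) (P : bipoly) (x1 x2 : C) (s : 'S_N) : C :=
  (\cprod_(c in porbits s) beval P (x1 ^ #|c|) (x2 ^ #|c|))%C.

Definition Delta0 (r R0 phi : R) (z : C) : Prop :=
  [/\ Cmod z < R0, z <> RtoC r & phi < Rabs (Carg (z - RtoC r))].

Definition holomorphic_on (D : C -> Prop) (g : C -> C) : Prop :=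
  forall z, D z -> @ex_derive C_AbsRing C_NormedModule g z.

Definition class_F (r vtheta : R) (K : C) (g : C -> C) : Prop :=
  exists R0 phi : R,
    [/\ r < R0,
        0 < phi < PI / 2,
        holomorphic_on (Delta0 r R0 phi) g
      & exists M delta : R, 0 < delta /\
          forall t : C, Delta0 r R0 phi t -> Cmod (t - RtoC r) < delta ->
            Cmod (g t - (RtoC vtheta * Clog (1 / (1 - t / RtoC r)) + K))
              <= M * Cmod (t - RtoC r)].

Definition g_coef (theta : nat -> R) (k : nat) : C :=
  if k is 0 then RtoC 0 else RtoC (theta k / INR k).

(* Agreement near 0 is enough: on a domain Delta0, which is connected and
   contains the disc of radius r, the continuation [g] is then unique. *)
Definition continues (a : nat -> C) (g : C -> C) : Prop :=
  exists2 rho : R, 0 < rho &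
    forall t : C, Cmod t < rho ->
      @is_pseries C_AbsRing C_NormedModule a t (g t).

Definition G_pow (g : C -> C) (b t : C) : C := Cexp (b * g t).

(* The product over the finite box is the full one: a zero coefficient
   contributes the factor exp 0 = 1. *)
Definition E2 (g : C -> C) (r : R) (K : C) (P : bipoly) (x1 x2 : C)
    (k1 k2 : nat) : C :=
  (Cexp (K * (bcoef P k1 k2 - 1)) *
   \cprod_(m1 < bsize P)
   \cprod_(m2 < bsize P | (m1 != k1 :> nat) || (m2 != k2 :> nat))
     G_pow g (bcoef P m1 m2)
       (RtoC r * Czpow x1 (Z.of_nat m1 - Z.of_nat k1)
               * Czpow x2 (Z.of_nat m2 - Z.of_nat k2)))%C.

Definition bigO_invN (e : nat -> C) : Prop :=
  exists M : R, eventually (fun N => Cmod (e N) <= M / INR N).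

(* Main.v *)
Require Import Defs.
From Stdlib Require Import Reals ZArith Lra Lia Classical ClassicalChoice.
From HB Require Import structures.
From mathcomp Require Import ssreflect ssrfun ssrbool eqtype ssrnat seq.
From mathcomp Require Import choice fintype finset bigop fingroup perm.
From Coquelicot Require Import Coquelicot.

(** The weight of a permutation and [W] are products over its cycles, so the
    expectation is a quotient [p N / h N] of two cycle index sums. Deleting the
    points of a marked cycle one by one ([cyc_sum_rec]) shows that [h N] and [p
    N] are the Taylor coefficients of [exp (g t)] and of [exp (sum_k b_k g (x1 ^
    k1 x2 ^ k2 t))], the sum being over the monomials [k] of [P] with
    coefficients [b_k] ([cycle_index_exp_coef], [taylor_exp]). On the circle
    [|t| = r] the point [r] is the only singular point of [g], so the second
    function has one singular point there for each monomial. Independence of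
    [x1] and [x2] makes these points distinct, so at each of them a single
    summand is singular, and the function behaves like an amplitude times [(1 -
    t / t_k) ^ (- vtheta b_k)]. The amplitude collects [exp (b_k K)] and the
    values of the other factors, as in [E2].

    Coefficients are extracted by singularity analysis ([singularity_analysis]).
    Each singular point has a local model, a power of [1 - t / t_k] times a
    polynomial that vanishes to high order at the other singular points. The
    coefficients of a power are binomial coefficients, and these are governed by
    the Euler-Gauss limit that defines [1 / Gamma] ([bin_coef_asym]). Once all
    models are subtracted, the growth at each singular point is one order below
    that of the largest singular term, and [transfer] turns this into a bound
    for the coefficients: it estimates Cauchy's integral on a contour that
    passes at distance [1 / n] from each singular point and runs outside of the
    disc elsewhere. The integral formula for this contour comes from Goursat's
    theorem for the image of a square ([goursat_square], [coef_bound]).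

    Dividing by [h N], the case of one singular point, yields all main terms
    with a total error [O (N ^ (vtheta (beta - 1) - 1))], where [beta] is the
    largest real part of a coefficient ([ratio_asym]). This gives the errors [O
    (1 / N)] asked for in the separate terms: the total error is charged to one
    index where [beta] is attained, and the errors of the others are taken to be
    [0]. *)

Set Implicit Arguments.
Unset Strict Implicit.
Unset Printing Implicit Defensive.

Open Scope R_scope.

(** * The cycle index as the exponential of a power series *)

HB.instance Definition _ :=
  Monoid.isComLaw.Build C (RtoC 0) Cplus Cplus_assoc Cplus_comm Cplus_0_l.
HB.instance Definition _ :=
  Monoid.isComLaw.Build C (RtoC 1) Cmult Cmult_assoc Cmult_comm Cmult_1_l.
HB.instance Definition _ :=
  Monoid.isMulLaw.Build C (RtoC 0) Cmult Cmult_0_l Cmult_0_r.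
HB.instance Definition _ :=
  Monoid.isAddLaw.Build C Cmult Cplus Cmult_plus_distr_r Cmult_plus_distr_l.

Lemma csum_mull (I : Type) (s : seq I) (Q : pred I) (F : I -> C) (a : C) :
  (a * \big[Cplus/RtoC 0]_(i <- s | Q i) F i =
   \big[Cplus/RtoC 0]_(i <- s | Q i) (a * F i))%C.
Proof. exact: big_distrr. Qed.

Section CycleIndex.
Import GroupScope.

Lemma porbit_step (T : finType) (s : {perm T}) w y :
  w \in porbit s y -> s w \in porbit s y.
Proof. by rewrite -!eq_porbit_mem (porbit_perm s 1). Qed.

Lemma porbit_sub_stable (T : finType) (s : {perm T}) (B : {set T}) y :
  (forall w, w \in B -> s w \in B) -> y \in B -> porbit s y \subset B.
Proof.
move=> stB yB; apply/subsetP => _ /porbitP [i ->].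
elim: i => [|i IH]; first by rewrite expg0 perm1.
by rewrite expgSr permM; apply: stB.
Qed.

Lemma porbit_fix (T : finType) (s : {perm T}) x : s x = x -> porbit s x = [set x].
Proof.
move=> sx; apply/eqP; rewrite eqEsubset sub1set porbit_id andbT.
by apply: porbit_sub_stable => [w|]; rewrite !inE // => /eqP ->; rewrite sx.
Qed.

(** The product follows [s], but detours through the fixed point [x] just before
    it returns to [y]: [x] is spliced into the cycle of [y]. *)
Lemma porbit_mul_tperm_fix (T : finType) (s : {perm T}) x y :
  s x = x -> porbit (s * tperm x y) x = x |: porbit s y.
Proof.
move=> sx; set u := s * _.
have ux : u x = y by rewrite permM sx tpermL.
apply/eqP; rewrite eqEsubset; apply/andP; split.
  apply: porbit_sub_stable; last by rewrite !inE eqxx.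
  move=> w; rewrite !inE => /orP [/eqP -> | ws].
    by rewrite ux porbit_id orbT.
  rewrite permM; case: tpermP => [_|_|_ _]; rewrite ?porbit_id ?orbT ?eqxx //.
  by rewrite porbit_step ?orbT.
have xB : x \in porbit u x by apply: porbit_id.
have yB : y \in porbit u x by rewrite -ux porbit_step.
rewrite subUset sub1set xB /=.
apply: porbit_sub_stable => // w wB.
have -> : s w = tperm x y (u w) by rewrite permM tpermK.
have uwB : u w \in porbit u x by rewrite porbit_step.
by case: tpermP.
Qed.

Lemma porbit_mul_tperm_far (T : finType) (s : {perm T}) x y z :
  s x = x -> z \notin x |: porbit s y -> porbit (s * tperm x y) z = porbit s z.
Proof.
move=> sx zN.
have agree i : ((s * tperm x y) ^+ i) z = (s ^+ i) z /\ (s ^+ i) z \notin x |: porbit s y.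
  elim: i => [|i [IH1 IH2]]; first by rewrite !expg0 perm1.
  rewrite !expgSr permM IH1 !permM.
  have N : s ((s ^+ i) z) \notin x |: porbit s y.
    apply: contra IH2; rewrite !inE => /orP [/eqP e | e].
      by rewrite (_ : (s ^+ i) z = x) ?eqxx //; apply: (@perm_inj _ s); rewrite e sx.
    apply/orP; right; move: e.
    by rewrite -!eq_porbit_mem (porbit_perm s 1).
  split=> //; apply: tpermD; apply: contraNneq N => <-; rewrite !inE ?eqxx //.
  by rewrite porbit_id orbT.
apply/porbit_setP => w; apply/porbitP/porbitP => -[i ->]; exists i;
  by case: (agree i).
Qed.

Lemma porbits_mul_tperm_fix (T : finType) (s : {perm T}) x y :
  s x = x ->
  porbits (s * tperm x y) :\ porbit (s * tperm x y) x
  = (porbits s :\ [set x]) :\ porbit s y.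
Proof.
move=> sx; have px := porbit_fix sx.
have pux := porbit_mul_tperm_fix y sx.
have far z : (porbit s z != porbit s y) && (porbit s z != porbit s x)
             = (z \notin x |: porbit s y).
  by rewrite !eq_porbit_mem px !inE negb_or andbC.
apply/setP => c; rewrite -px !inE; apply/andP/and3P.
  case=> /[swap] /imsetP [z _ ->]; rewrite eq_porbit_mem pux => zN.
  rewrite (porbit_mul_tperm_far sx zN); move: (zN); rewrite -far => /andP [-> ->].
  by split=> //; apply: imset_f.
case=> cy cx /imsetP [z _ cz]; move: cy cx; rewrite cz => cy cx.
have zN : z \notin x |: porbit s y by rewrite -far cy cx.
rewrite -(porbit_mul_tperm_far sx zN) eq_porbit_mem pux zN.
by split=> //; apply: imset_f.
Qed.

Lemma porbit_lift0 n (s : 'S_n) (k : 'I_n) :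
  porbit (lift_perm ord0 ord0 s) (lift ord0 k) = [set lift ord0 i | i in porbit s k].
Proof.
have it i : (lift_perm ord0 ord0 s ^+ i) (lift ord0 k) = lift ord0 ((s ^+ i) k).
  elim: i => [|i IH]; first by rewrite !expg0 !perm1.
  by rewrite !expgSr !permM IH lift_perm_lift.
apply/setP => w; apply/porbitP/imsetP.
  by case=> i ->; exists ((s ^+ i) k); rewrite ?mem_porbit.
by case=> z /porbitP [i ->] ->; exists i; rewrite it.
Qed.

Lemma porbits_lift0 n (s : 'S_n) :
  porbits (lift_perm ord0 ord0 s) :\ [set ord0]
  = [set [set lift ord0 i | i in c] | c : {set 'I_n} in porbits s].
Proof.
have p0 := porbit_fix (lift_perm_id ord0 ord0 s).
apply/setP => c; rewrite -p0 !inE; apply/andP/imsetP.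
  case=> /[swap] /imsetP [z _ ->]; case: (unliftP ord0 z) => [k ->|->]; last by rewrite eqxx.
  by move=> _; exists (porbit s k); rewrite ?porbit_lift0 //; apply: imset_f.
case=> _ /imsetP [k _ ->] ->; rewrite -porbit_lift0; split; last exact: imset_f.
rewrite p0; apply/eqP => /setP /(_ (lift ord0 k)).
by rewrite porbit_id !inE eq_sym (negbTE (neq_lift _ _)).
Qed.

(** Every permutation of [n + 1] points arises exactly once by splicing the
    point [0] into a permutation of the others: in front of [j] in the cycle of
    [j], or as a fixed point when [j] is absent. *)
Definition insert0 n (o : option 'I_n) (s : 'S_n) : 'S_n.+1 :=
  lift_perm ord0 ord0 s *
  tperm ord0 (if o is Some j then lift ord0 j else ord0).

Lemma insert0_bij n :
  bijective (fun os : option 'I_n * 'S_n => insert0 os.1 os.2).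
Proof.
apply: inj_card_bij; last first.
  by rewrite card_Sn card_prod card_option card_Sn card_ord factS.
move=> [o s] [o' s'] /= e.
have E : insert0 o s ord0 = insert0 o' s' ord0 by rewrite e.
have Eo : o = o'.
  move: E; rewrite /insert0 !permM !lift_perm_id !tpermL.
  case: o {e} => [j|]; case: o' => [j'|] //.
  by move=> /lift_inj ->.
move: e; rewrite -Eo /insert0 => /mulIg es; congr (_, _).
apply/permP => k; apply: (@lift_inj _ (ord0 : 'I_n.+1)).
by rewrite -!(lift_perm_lift ord0) es.
Qed.

Lemma card_porbit_insert0 n (j : 'I_n) (s : 'S_n) :
  #|porbit (insert0 (Some j) s) ord0| = #|porbit s j|.+1.
Proof.
rewrite porbit_mul_tperm_fix ?lift_perm_id // porbit_lift0 cardsU1.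
rewrite (card_imset _ (@lift_inj _ _)) (_ : _ \notin _) //.
by apply/imsetP => -[i _ e]; case/eqP: (neq_lift ord0 i).
Qed.

Definition cyc_prod n (a : nat -> C) (s : 'S_n) : C :=
  \big[Cmult/RtoC 1]_(c in porbits s) a #|c|.
Definition cyc_prod_but n (a : nat -> C) (j : 'I_n) (s : 'S_n) : C :=
  \big[Cmult/RtoC 1]_(c in porbits s :\ porbit s j) a #|c|.

Lemma cyc_prod_split n a (j : 'I_n) (s : 'S_n) :
  cyc_prod a s = Cmult (a #|porbit s j|) (cyc_prod_but a j s).
Proof.
rewrite /cyc_prod (bigD1 (porbit s j)) ?imset_f //=; congr (_ * _)%C.
by apply: eq_bigl => c; rewrite !inE andbC.
Qed.

Lemma imset_setD1 (aT rT : finType) (f : aT -> rT) (A : {set aT}) x :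
  injective f -> f @: (A :\ x) = f @: A :\ f x.
Proof.
move=> fI; apply/setP => y; rewrite !inE; apply/imsetP/andP.
  case=> z; rewrite !inE => /andP [zx zA] ->.
  by rewrite (inj_eq fI) zx imset_f.
case=> yx /imsetP [z zA yz]; exists z; rewrite // !inE zA andbT.
by apply: contraNneq yx => <-; rewrite yz.
Qed.

Lemma cyc_prod_but_insert0 n a (o : option 'I_n) (s : 'S_n) :
  cyc_prod_but a ord0 (insert0 o s)
  = if o is Some j then cyc_prod_but a j s else cyc_prod a s.
Proof.
have inj : injective (fun c : {set 'I_n} => [set lift (ord0 : 'I_n.+1) i | i in c]).
  exact: (imset_inj (@lift_inj _ _)).
rewrite /cyc_prod_but porbits_mul_tperm_fix ?lift_perm_id // porbits_lift0.
case: o => [j|].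
  rewrite porbit_lift0 -(imset_setD1 _ _ inj) big_imset; last exact: in2W.
  by apply: eq_bigr => c _; rewrite (card_imset _ (@lift_inj _ _)).
rewrite (_ : _ :\ _ = [set [set lift ord0 i | i in c] | c : {set 'I_n} in porbits s]).
  rewrite big_imset; last exact: in2W.
  by apply: eq_bigr => c _; rewrite (card_imset _ (@lift_inj _ _)).
apply/setP => c; rewrite !inE -porbits_lift0 !inE.
by rewrite (porbit_fix (lift_perm_id ord0 ord0 s)); case: (c != _).
Qed.

Definition cyc_sum n (a : nat -> C) : C := (\csum_(s : 'S_n) cyc_prod a s)%C.
(** The cycle of the marked point [j] has its own weight [f], because the
    recursion shortens the marked cycle while it keeps the others. *)
Definition cyc_sum_at n (f a : nat -> C) (j : 'I_n) : C :=
  (\csum_(s : 'S_n) (f #|porbit s j| * cyc_prod_but a j s))%C.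

Lemma cyc_sum_atE n a (j : 'I_n) : cyc_sum n a = cyc_sum_at a a j.
Proof. by apply: eq_bigr => s _; rewrite (cyc_prod_split _ j). Qed.

Lemma porbit_conj n (s t : 'S_n) j :
  porbit (s ^ t) (t j) = [set t i | i in porbit s j].
Proof.
have it i : ((s ^ t) ^+ i) (t j) = t ((s ^+ i) j).
  by rewrite -conjXg /conjg !permM permK.
apply/setP => w; apply/porbitP/imsetP.
  by case=> i ->; exists ((s ^+ i) j); rewrite ?mem_porbit.
by case=> z /porbitP [i ->] ->; exists i; rewrite it.
Qed.

(** Conjugation by the transposition of [j] and [k] moves the mark. *)
Lemma cyc_sum_at_indep n (f a : nat -> C) (j k : 'I_n) :
  cyc_sum_at f a j = cyc_sum_at f a k.
Proof.
have inj t : injective (fun c : {set 'I_n} => [set (t : 'S_n) i | i in c]).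
  exact: (imset_inj (@perm_inj _ _)).
rewrite {1}/cyc_sum_at (reindex_inj (conjg_inj (tperm k j))) /=.
apply: eq_bigr => s _; set t := tperm k j.
have tk : t k = j by rewrite tpermL.
rewrite -tk porbit_conj (card_imset _ (@perm_inj _ _)); congr (_ * _)%C.
rewrite /cyc_prod_but porbit_conj.
have -> : porbits (s ^ t) = [set [set t i | i in c] | c : {set 'I_n} in porbits s].
  apply/setP => c; apply/imsetP/imsetP.
    case=> z _ ->; exists (porbit s (t^-1 z)); first exact: imset_f.
    by rewrite -porbit_conj permKV.
  by case=> _ /imsetP [z _ ->] ->; exists (t z); rewrite ?porbit_conj.
rewrite -(imset_setD1 _ _ (inj t)) big_imset; last exact: (in2W (inj t)).
by apply: eq_bigr => c _; rewrite (card_imset _ (@perm_inj _ _)).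
Qed.

(** Removing the point [0] either erases a fixed point, or shortens the cycle of
    its successor [j], which inherits the mark; hence the shift of [f]. *)
Lemma cyc_sum_at0_S n (f a : nat -> C) :
  cyc_sum_at f a (ord0 : 'I_n.+1) = (f 1%N * cyc_sum n a +
     \csum_(j : 'I_n) cyc_sum_at (fun k => f k.+1) a j)%C.
Proof.
rewrite {1}/cyc_sum_at (reindex _ (onW_bij _ (insert0_bij n))) /=.
rewrite -(pair_big xpredT xpredT (fun o s => Cmult (f #|porbit (insert0 o s) ord0|) (cyc_prod_but a ord0 (insert0 o s)))) /=.
rewrite (bigD1 None) //=; congr (_ + _)%C.
  rewrite /cyc_sum csum_mull; apply: eq_bigr => s _.
  rewrite cyc_prod_but_insert0 porbit_mul_tperm_fix ?lift_perm_id //.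
  by rewrite (porbit_fix (lift_perm_id ord0 ord0 s)) setUid cards1.
rewrite (reindex_omap Some id) /=; last by case.
apply: eq_big => [j|j _]; first by rewrite eqxx.
by apply: eq_bigr => s _; rewrite cyc_prod_but_insert0 card_porbit_insert0.
Qed.

Lemma INR_factn_gt0 n : 0 < INR n`!.
Proof. by apply: lt_0_INR; apply/ltP; apply: fact_gt0. Qed.

Lemma csum_const n (z : C) : (\csum_(i < n) z)%C = (RtoC (INR n) * z)%C.
Proof.
elim: n => [|n IH]; first by rewrite big_ord0 /= Cmult_0_l.
by rewrite big_ord_recr IH S_INR RtoC_plus Cmult_plus_distr_r Cmult_1_l.
Qed.

(** Deleting the marked point from its cycle, over and over, uses up that cycle.
    The quotient of factorials counts the choices of the successive successors. *)
Lemma cyc_sum_rec n (f a : nat -> C) :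
  cyc_sum_at f a (ord0 : 'I_n.+1) =
  (\csum_(k < n.+1) (f k.+1 * RtoC (INR n`! / INR (n - k)`!) * cyc_sum (n - k) a))%C.
Proof.
have fn0 m : INR m`! <> 0 by have := INR_factn_gt0 m; lra.
elim: n f => [|n IH] f; rewrite cyc_sum_at0_S.
  rewrite big_ord0 big_ord_recl big_ord0 subnn Rdiv_diag //.
  by rewrite Cmult_1_r.
rewrite [RHS]big_ord_recl subn0 Rdiv_diag //.
congr (_ + _)%C; first by rewrite Cmult_1_r.
have -> : (\csum_(j : 'I_n.+1) cyc_sum_at (fun k => f k.+1) a j
           = \csum_(j < n.+1) cyc_sum_at (fun k => f k.+1) a (ord0 : 'I_n.+1))%C.
  by apply: eq_bigr => j _; apply: cyc_sum_at_indep.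
rewrite csum_const IH csum_mull; apply: eq_bigr => k _.
rewrite lift0 subSS factS mult_INR /Rdiv Rmult_assoc (RtoC_mult (INR n.+1)).
by ring.
Qed.

End CycleIndex.

(** The coefficients [p] of [exp A] for [A = sum_k a k z ^ k / k], read off the
    differential equation [p' = A' p].  In this form the relation is purely
    algebraic and involves no convergence. *)
Definition exp_coef (a p : nat -> C) : Prop :=
  p 0%N = RtoC 1 /\
  forall n, (RtoC (INR n.+1) * p n.+1 = \csum_(k < n.+1) (a k.+1 * p (n - k)%N))%C.

(** Polya's formula for the cycle index: [cyc_sum_rec] at [f = a], since the
    product of the weights does not depend on the mark. *)
Lemma cycle_index_exp_coef (a : nat -> C) :
  exp_coef a (fun n => RtoC (/ INR n`!) * cyc_sum n a)%C.
Proof.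
have fn0 m : INR m`! <> 0 by have := INR_factn_gt0 m; lra.
split=> [|n].
  rewrite /cyc_sum (eq_bigr (fun=> RtoC 1)) => [|s _].
    rewrite big_const cardT -cardT card_Sn /=.
    by rewrite Rinv_1; ring.
  rewrite /cyc_prod big1 // => c /imsetP [[]] //.
rewrite (cyc_sum_atE _ ord0) cyc_sum_rec !csum_mull.
apply: eq_bigr => k _.
rewrite factS mult_INR Rinv_mult RtoC_mult /Rdiv (RtoC_mult (INR n`!)).
have e1 : (RtoC (INR n.+1) * RtoC (/ INR n.+1))%C = RtoC 1.
  by rewrite -RtoC_mult Rinv_r //; apply: not_0_INR.
have e2 : (RtoC (INR n`!) * RtoC (/ INR n`!))%C = RtoC 1.
  by rewrite -RtoC_mult Rinv_r.
transitivity ((RtoC (INR n.+1) * RtoC (/ INR n.+1)) * (RtoC (INR n`!) * RtoC (/ INR n`!)) *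
   (a k.+1 * (RtoC (/ INR (n - k)`!) * cyc_sum (n - k) a)))%C; first by ring.
by rewrite e1 e2; ring.
Qed.

(** * Complex differentiability *)

Lemma Cmod_triang_minus (x y z : C) : Cmod (x - z) <= Cmod (x - y) + Cmod (y - z).
Proof. by rewrite (_ : x - z = (x - y) + (y - z))%C; [apply: Cmod_triangle | ring]. Qed.

Lemma Cmod_sub_rev (x y : C) : Cmod (x - y) = Cmod (y - x).
Proof. by rewrite -Cmod_opp (_ : - (x - y) = y - x)%C; [ | ring]. Qed.

Lemma Cmod_ge_sub (x y : C) : Cmod x - Cmod y <= Cmod (x - y).
Proof.
have := Cmod_triangle (x - y) y; rewrite (_ : x - y + y = x)%C; [lra | ring].
Qed.

Lemma Cmod_le_abs (z : C) : Cmod z <= Rabs (Re z) + Rabs (Im z).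
Proof.
rewrite {1}(_ : z = RtoC (Re z) + RtoC (Im z) * Ci)%C.
  apply: Rle_trans (Cmod_triangle _ _) _.
  by rewrite Cmod_mult !Cmod_R Cmod_Ci; lra.
by case: z => a b; rewrite /RtoC /Ci /Cplus /Cmult /=; congr pair; ring.
Qed.

Lemma im_le_Cmod (z : C) : Rabs (Im z) <= Cmod z.
Proof. by apply: Rle_trans (Rmax_Cmod z); apply: Rmax_r. Qed.

Lemma Cmod_ReIm (z : C) : Cmod z = sqrt (Re z ^ 2 + Im z ^ 2).
Proof. by []. Qed.

Definition ccont (f : C -> C) (z : C) : Prop :=
  forall e, 0 < e -> exists d, 0 < d /\
    forall w, Cmod (w - z) < d -> Cmod (f w - f z) < e.

(** Caratheodory's form of complex differentiability: the difference quotient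
    extends continuously.  It turns the rules of calculus into algebra. *)
Definition cder (f : C -> C) (z l : C) : Prop :=
  exists q : C -> C, [/\ ccont q z, q z = l &
    forall w, f w = (f z + q w * (w - z))%C].

Lemma ccont_const (c z : C) : ccont (fun=> c) z.
Proof.
move=> e e0; exists 1; split; first lra.
by move=> w _; rewrite (_ : c - c = 0)%C ?Cmod_0 //; ring.
Qed.

Lemma ccont_id (z : C) : ccont (fun w => w) z.
Proof. by move=> e e0; exists e; split. Qed.

Lemma ccont_plus f g z : ccont f z -> ccont g z -> ccont (fun w => f w + g w)%C z.
Proof.
move=> cf cg e e0.
case: (cf (e/2)) => [|d1 [d1p H1]]; first lra.
case: (cg (e/2)) => [|d2 [d2p H2]]; first lra.
exists (Rmin d1 d2); split; first exact: Rmin_glb_lt.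
move=> w hw.
have := H1 w (Rlt_le_trans _ _ _ hw (Rmin_l _ _)).
have := H2 w (Rlt_le_trans _ _ _ hw (Rmin_r _ _)).
have := Cmod_triangle (f w - f z) (g w - g z).
rewrite (_ : f w - f z + (g w - g z) = f w + g w - (f z + g z))%C; last by ring.
lra.
Qed.

Lemma ccont_mult f g z : ccont f z -> ccont g z -> ccont (fun w => f w * g w)%C z.
Proof.
move=> cf cg e e0.
have f0 := Cmod_ge_0 (f z); have g0 := Cmod_ge_0 (g z).
set A := Cmod (f z) + 1; set B := Cmod (g z) + 1.
have eA : 0 < e / (2 * A) by apply: Rdiv_lt_0_compat; rewrite /A; lra.
have eB : 0 < e / (2 * B) by apply: Rdiv_lt_0_compat; rewrite /B; lra.
case: (cf (Rmin 1 (e/(2*B)))) => [|d1 [d1p H1]]; first by apply: Rmin_glb_lt; lra.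
case: (cg (e/(2 * A))) => [//|d2 [d2p H2]].
exists (Rmin d1 d2); split; first exact: Rmin_glb_lt.
move=> w hw.
have F := H1 w (Rlt_le_trans _ _ _ hw (Rmin_l _ _)).
have G := H2 w (Rlt_le_trans _ _ _ hw (Rmin_r _ _)).
have [F1 F2] := Rmin_Rgt_l _ _ _ F.
rewrite (_ : f w * g w - f z * g z = f w * (g w - g z) + (f w - f z) * g z)%C; last by ring.
apply: Rle_lt_trans (Cmod_triangle _ _) _; rewrite !Cmod_mult.
have fw : Cmod (f w) < A.
  have := Cmod_triangle (f w - f z) (f z).
  rewrite (_ : f w - f z + f z = f w)%C; last by ring.
  rewrite /A; lra.
have I1 : Cmod (f w) * Cmod (g w - g z) <= A * (e / (2 * A)).
  by apply: Rmult_le_compat; try exact: Cmod_ge_0; exact: Rlt_le.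
have I2 : Cmod (f w - f z) * Cmod (g z) <= e / (2 * B) * Cmod (g z).
  by apply: Rmult_le_compat_r; lra.
have E1 : A * (e / (2 * A)) = e / 2 by field; rewrite /A; lra.
have E2 : e / (2 * B) * B = e / 2 by field; rewrite /B; lra.
have : e / (2 * B) * Cmod (g z) < e / (2 * B) * B.
  by apply: Rmult_lt_compat_l => //; rewrite /B; lra.
lra.
Qed.

Lemma ccont_comp f g z : ccont f z -> ccont g (f z) -> ccont (fun w => g (f w)) z.
Proof.
move=> cf cg e e0; case: (cg e e0) => d1 [d1p H1].
case: (cf d1 d1p) => d2 [d2p H2]; exists d2; split=> // w hw.
exact/H1/H2.
Qed.

Lemma ccont_ext f g z : (forall w, f w = g w) -> ccont f z -> ccont g z.
Proof.
move=> fg cf e e0; case: (cf e e0) => d [dp H]; exists d; split=> // w hw.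
by rewrite -!fg; apply: H.
Qed.

Lemma cder_const (c z : C) : cder (fun=> c) z (RtoC 0).
Proof.
by exists (fun=> RtoC 0); split=> // [|w]; [apply: ccont_const | ring].
Qed.

Lemma cder_id (z : C) : cder (fun w => w) z (RtoC 1).
Proof.
by exists (fun=> RtoC 1); split=> // [|w]; [apply: ccont_const | ring].
Qed.

Lemma cder_cont f z l : cder f z l -> ccont f z.
Proof.
case=> q [cq _ E].
apply: (@ccont_ext (fun w => f z + q w * (w + (- z)))%C).
  by move=> w; rewrite [in RHS]E.
apply: ccont_plus; first exact: ccont_const.
apply: ccont_mult => //; apply: ccont_plus; [exact: ccont_id | exact: ccont_const].
Qed.

Lemma cder_plus f g z l m :
  cder f z l -> cder g z m -> cder (fun w => f w + g w)%C z (l + m)%C.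
Proof.
move=> [q [cq <- E]] [p [cp <- E']]; exists (fun w => q w + p w)%C.
split=> //; first exact: ccont_plus.
by move=> w; rewrite [f w]E [g w]E'; ring.
Qed.

Lemma cder_mult f g z l m :
  cder f z l -> cder g z m -> cder (fun w => f w * g w)%C z (l * g z + f z * m)%C.
Proof.
move=> df dg; have cg := cder_cont dg.
case: df dg => [q [cq <- E]] [p [cp <- E']]; exists (fun w => q w * g w + f z * p w)%C.
split=> //.
  by apply: ccont_plus; apply: ccont_mult => //; apply: ccont_const.
by move=> w; rewrite [f w]E [g w]E'; ring.
Qed.

Lemma cder_comp f g z l m :
  cder f z l -> cder g (f z) m -> cder (fun w => g (f w)) z (m * l)%C.
Proof.
move=> df dg; have cf := cder_cont df.
case: df dg => [q [cq <- E]] [p [cp <- E']]; exists (fun w => p (f w) * q w)%C.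
split=> //; first by apply: ccont_mult => //; apply: ccont_comp cf cp.
by move=> w; rewrite E' {2}[f w]E; ring.
Qed.

Lemma cder_scal (a : C) f z l : cder f z l -> cder (fun w => a * f w)%C z (a * l)%C.
Proof.
case=> q [cq <- E]; exists (fun w => a * q w)%C; split=> //.
  by apply: ccont_mult => //; apply: ccont_const.
by move=> w; rewrite [f w]E; ring.
Qed.

Lemma cder_eq f z l m : cder f z l -> l = m -> cder f z m.
Proof. by move=> h <-. Qed.

(** The remainder form of differentiability, which is what estimates provide. *)
Lemma cder_of_remainder f z l :
  (forall e, 0 < e -> exists d, 0 < d /\ forall w, Cmod (w - z) < d ->
     Cmod (f w - f z - l * (w - z)) <= e * Cmod (w - z)) -> cder f z l.
Proof.
move=> H.
exists (fun w => if Ceq_dec w z then l else ((f w - f z) / (w - z))%C); split.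
- move=> e e0; case: (H (e/2)) => [|d [dp Hd]]; first lra.
  exists d; split=> // w hw /=.
  case: (Ceq_dec z z) => [? /=|[]] //; case: (Ceq_dec w z) => [? |nz] /=.
    by rewrite (_ : l - l = 0)%C ?Cmod_0 //; ring.
  have nz' := Cminus_eq_contra _ _ nz.
  have m0 : 0 < Cmod (w - z) by apply/Cmod_gt_0.
  rewrite (_ : (f w - f z) / (w - z) - l = (f w - f z - l * (w - z)) / (w - z))%C.
    rewrite Cmod_div //; apply: (@Rle_lt_trans _ (e / 2)); last lra.
    by apply/Rle_div_l => //; apply: Hd.
  by field.
- rewrite /=; by case: (Ceq_dec z z) => [? /=|[]].
- move=> w /=; case: (Ceq_dec w z) => [e | nz] /=; first by rewrite e; ring.
  by field; apply: Cminus_eq_contra.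
Qed.

Lemma cder_remainder f z l : cder f z l ->
  forall e, 0 < e -> exists d, 0 < d /\ forall w, Cmod (w - z) < d ->
     Cmod (f w - f z - l * (w - z)) <= e * Cmod (w - z).
Proof.
case=> q [cq <- E] e e0; case: (cq e e0) => d [dp H]; exists d; split=> // w hw.
rewrite [f w]E (_ : f z + q w * (w - z) - f z - q z * (w - z) = (q w - q z) * (w - z))%C.
  rewrite Cmod_mult; apply: Rmult_le_compat_r; first exact: Cmod_ge_0.
  exact/Rlt_le/H.
by ring.
Qed.

Lemma cder_near f g z l d : 0 < d ->
  (forall w, Cmod (w - z) < d -> f w = g w) -> cder f z l -> cder g z l.
Proof.
move=> d0 fg df; apply: cder_of_remainder => e e0.
case: (cder_remainder df e0) => d' [dp H]; exists (Rmin d d'); split.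
  exact: Rmin_glb_lt.
move=> w hw.
have [h1 h2] := Rmin_Rgt_l _ _ _ hw.
rewrite -!fg //; first exact: H.
by rewrite (_ : z - z = 0)%C ?Cmod_0 //; ring.
Qed.

Lemma cder_ext f g z l : (forall w, f w = g w) -> cder f z l -> cder g z l.
Proof. by move=> fg; apply: (@cder_near _ _ _ _ 1); [lra|]. Qed.

Lemma cder_ex_derive f z :
  @ex_derive C_AbsRing C_NormedModule f z -> exists l, cder f z l.
Proof.
case=> l [_ H]; exists l; apply: cder_of_remainder => e e0.
case: (H z (fun Q hQ => hQ) (mkposreal e e0)) => d Hd.
exists (pos d); split; first exact: cond_pos.
move=> w hw.
have h : Cmod (f w - f z - (w - z) * l) <= e * Cmod (w - z) := Hd w hw.
by rewrite (Cmult_comm l).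
Qed.

Lemma ccont_inv f z : ccont f z -> f z <> RtoC 0 -> ccont (fun w => / f w)%C z.
Proof.
move=> cf fz e e0; have m0 : 0 < Cmod (f z) by apply/Cmod_gt_0.
set m := Cmod (f z) in m0.
have em : 0 < e * (m * m / 2) by apply: Rmult_lt_0_compat => //; nra.
case: (cf (Rmin (m / 2) (e * (m * m / 2)))) => [|d [dp H]].
  by apply: Rmin_glb_lt => //; lra.
exists d; split=> // w hw; have h := H w hw.
have [h1 h2] := Rmin_Rgt_l _ _ _ h.
have mw : m / 2 < Cmod (f w).
  have := Cmod_ge_sub (f z) (f w); rewrite Cmod_sub_rev -/m; lra.
have fw : f w <> RtoC 0 by apply/Cmod_gt_0; lra.
rewrite (_ : / f w - / f z = - (f w - f z) / (f w * f z))%C; last by field.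
rewrite Cmod_div; last exact: Cmult_neq_0.
rewrite Cmod_opp Cmod_mult -/m; apply/Rlt_div_l.
  by apply: Rmult_lt_0_compat => //; lra.
apply: Rlt_le_trans h2 _; apply: Rmult_le_compat_l; first lra.
rewrite /Rdiv (Rmult_comm (m * m)) -Rmult_assoc; apply: Rmult_le_compat_r; lra.
Qed.

(** * The complex exponential *)

Lemma Cexp_add (z w : C) : Cexp (z + w) = (Cexp z * Cexp w)%C.
Proof.
rewrite /Cexp re_plus im_plus exp_plus cos_plus sin_plus.
by rewrite /Cmult /=; congr pair; ring.
Qed.

Lemma Cexp_0 : Cexp (RtoC 0) = RtoC 1.
Proof. by rewrite /Cexp /= exp_0 cos_0 sin_0 Rmult_1_l Rmult_0_r. Qed.

Lemma Cexp_opp z : (Cexp z * Cexp (- z))%C = RtoC 1.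
Proof. by rewrite -Cexp_add Cplus_opp_r Cexp_0. Qed.

Lemma Cmod_Cexp z : Cmod (Cexp z) = exp (Re z).
Proof.
rewrite Cmod_ReIm /Cexp /=.
have -> : exp (Re z) * cos (Im z) * (exp (Re z) * cos (Im z) * 1) +
   exp (Re z) * sin (Im z) * (exp (Re z) * sin (Im z) * 1)
   = exp (Re z) * exp (Re z) * (sin (Im z) * sin (Im z) + cos (Im z) * cos (Im z)) by ring.
have := sin2_cos2 (Im z); rewrite /Rsqr => ->; rewrite Rmult_1_r.
by apply: sqrt_square; apply/Rlt_le/exp_pos.
Qed.

Lemma Cexp_neq0 z : Cexp z <> RtoC 0.
Proof. by apply/Cmod_gt_0; rewrite Cmod_Cexp; apply: exp_pos. Qed.

Lemma Cexp_inv z : Cexp (- z) = (/ Cexp z)%C.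
Proof.
have n0 := @Cexp_neq0 z.
by rewrite -[LHS]Cmult_1_l -(Cinv_l (Cexp z) n0) -Cmult_assoc Cexp_opp Cmult_1_r.
Qed.

Lemma Cexp_RtoC x : Cexp (RtoC x) = RtoC (exp x).
Proof. by rewrite /Cexp /= cos_0 sin_0 Rmult_1_r Rmult_0_r. Qed.

Lemma Cexp_sum (I : Type) (s : seq I) (Q : pred I) (F : I -> C) :
  Cexp (\big[Cplus/RtoC 0]_(i <- s | Q i) F i) =
  \big[Cmult/RtoC 1]_(i <- s | Q i) Cexp (F i).
Proof. by apply: (big_morph _ Cexp_add Cexp_0). Qed.

Lemma Cexp_pow z n : (Cexp z ^ n)%C = Cexp (RtoC (INR n) * z).
Proof.
elim: n => [|n IH]; first by rewrite /= Cmult_0_l Cexp_0.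
by rewrite Cpow_S IH -Cexp_add S_INR RtoC_plus; congr Cexp; ring.
Qed.

Lemma exp_le_inv x : x < 1 -> exp x <= / (1 - x).
Proof.
move=> x1; have := exp_ineq1_le (- x); rewrite exp_Ropp => h.
rewrite -(Rinv_inv (exp x)); apply: Rinv_le_contravar; lra.
Qed.

Lemma exp_sub_bound x : Rabs x <= 1/2 -> Rabs (exp x - 1 - x) <= 2 * x ^ 2.
Proof.
move=> h; have [h1 h2] := proj1 (Rabs_le_between _ _) h.
have := exp_ineq1_le x => a; rewrite Rabs_pos_eq; last lra.
have b : exp x <= / (1 - x) by apply: exp_le_inv; lra.
suff : / (1 - x) <= 1 + x + 2 * x ^ 2 by lra.
apply: (Rmult_le_reg_l (1 - x)); first lra.
rewrite Rinv_r; last lra.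
nra.
Qed.

Lemma sin_abs_le x : Rabs (sin x) <= Rabs x.
Proof.
have P y : 0 <= y -> Rabs (sin y) <= y.
  move=> y0; case: (Rle_lt_dec y 1) => y1.
    have := PI2_1; rewrite /PI2 => p1.
    rewrite Rabs_pos_eq; last by apply: sin_ge_0; have := PI_RGT_0; lra.
    by case: (Rle_lt_or_eq_dec _ _ y0) => [/sin_lt_x|<-]; rewrite ?sin_0; lra.
  by have := SIN_bound y; move=> h; apply: Rabs_le; lra.
case: (Rle_lt_dec 0 x) => x0; first by rewrite (Rabs_pos_eq x) //; apply: P.
rewrite -Rabs_Ropp -sin_neg (Rabs_left x) //; apply: P; lra.
Qed.

Lemma cos_half x : cos x = 1 - 2 * sin (x / 2) ^ 2.
Proof.
rewrite {1}(_ : x = 2 * (x / 2)); last by field.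
by rewrite cos_2a_sin; ring.
Qed.

Lemma sqr_le_Rabs x y : Rabs x <= Rabs y -> x ^ 2 <= y ^ 2.
Proof. by move=> /Rsqr_le_abs_1; rewrite !Rsqr_pow2. Qed.

Lemma cos_sub_bound x : Rabs (cos x - 1) <= x ^ 2 / 2.
Proof.
have := sin_abs_le (x / 2) => h; rewrite cos_half.
have h2 : sin (x/2) ^ 2 <= (x / 2) ^ 2 by apply: sqr_le_Rabs.
have h3 : 0 <= sin (x/2) ^ 2 by apply: pow2_ge_0.
rewrite Rabs_left1; nra.
Qed.

Lemma sin_sub_bound x : Rabs (sin x - x) <= x ^ 2 * Rabs x.
Proof.
have d t : is_derive (fun y => sin y - y) t (cos t - 1).
  by auto_derive => //; ring.
case: (MVT_gen (fun y => sin y - y) 0 x (fun t => cos t - 1)) => [t ht|t ht|t [ht]].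
- exact: d.
- by apply: derivable_continuous_pt; exists (cos t - 1); apply/is_derive_Reals; apply: d.
rewrite sin_0 !Rminus_0_r => ->; rewrite Rabs_mult.
apply: Rmult_le_compat_r; first exact: Rabs_pos.
apply: Rle_trans (cos_sub_bound t) _.
have : t ^ 2 <= x ^ 2; last by have := pow2_ge_0 x; lra.
apply: sqr_le_Rabs; apply: Rabs_le; move: ht.
by rewrite /Rmin /Rmax /Rabs; case: Rle_dec => ?; case: Rcase_abs; lra.
Qed.

Lemma Cexp_sub_bound h : Cmod h <= 1/2 -> Cmod (Cexp h - 1 - h) <= 12 * Cmod h ^ 2.
Proof.
move=> hh; have h1 := re_le_Cmod h; have h2 := im_le_Cmod h.
have m0 := Cmod_ge_0 h.
set x := Re h in h1; set y := Im h in h2; set m := Cmod h in h1 h2 hh m0 *.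
have x2 : x ^ 2 <= m ^ 2 by apply: pow_maj_Rabs.
have y2 : y ^ 2 <= m ^ 2 by apply: pow_maj_Rabs.
have e1 := exp_sub_bound (Rle_trans _ _ _ h1 hh).
have c1 := cos_sub_bound y; have s1 := sin_sub_bound y.
have ex : Rabs (exp x) <= 2.
  rewrite Rabs_pos_eq; last exact/Rlt_le/exp_pos.
  have [h3 h4] := proj1 (Rabs_le_between _ _) (Rle_trans _ _ _ h1 hh).
  have := @exp_le_inv x ltac:(lra).
  suff : / (1 - x) <= / (1 / 2) by lra.
  by apply: Rinv_le_contravar; lra.
have ex1 : Rabs (exp x - 1) <= 2 * m.
  have -> : exp x - 1 = (exp x - 1 - x) + x by ring.
  apply: Rle_trans (Rabs_triang _ _) _; nra.
apply: Rle_trans (Cmod_le_abs _) _.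
have -> : Re (Cexp h - 1 - h) = (exp x - 1 - x) + exp x * (cos y - 1).
  by rewrite /x /y /Cexp; case: (h) => a b /=; ring.
have -> : Im (Cexp h - 1 - h) = exp x * (sin y - y) + (exp x - 1) * y.
  by rewrite /x /y /Cexp; case: (h) => a b /=; ring.
have t1 := Rabs_triang (exp x - 1 - x) (exp x * (cos y - 1)).
have t2 := Rabs_triang (exp x * (sin y - y)) ((exp x - 1) * y).
rewrite !Rabs_mult in t1 t2.
have b1 : Rabs (exp x) * Rabs (cos y - 1) <= 2 * (m ^ 2 / 2).
  by apply: Rmult_le_compat; try exact: Rabs_pos; lra.
have b2 : Rabs (exp x) * Rabs (sin y - y) <= 2 * (m ^ 2 * 1).
  apply: Rmult_le_compat; try exact: Rabs_pos; first lra.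
  apply: Rle_trans s1 _; apply: Rmult_le_compat; try exact: Rabs_pos; try lra.
  exact: pow2_ge_0.
have b3 : Rabs (exp x - 1) * Rabs y <= 2 * m * m.
  by apply: Rmult_le_compat; try exact: Rabs_pos; lra.
have E : m ^ 2 = m * m by ring.
move: t1 t2 e1 b1 b2 b3 x2; rewrite !E; clearbody x y m; nra.
Qed.

Lemma Cexp_lip h : Cmod h <= 1/2 -> Cmod (Cexp h - 1) <= 7 * Cmod h.
Proof.
move=> hh; have := Cexp_sub_bound hh; have := Cmod_triangle (Cexp h - 1 - h) h.
rewrite (_ : Cexp h - 1 - h + h = Cexp h - 1)%C; last by ring.
have := Cmod_ge_0 h; nra.
Qed.

Lemma cder_Cexp z : cder Cexp z (Cexp z).
Proof.
apply: cder_of_remainder => e e0; set m := Cmod (Cexp z).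
have m0 : 0 < m by rewrite /m Cmod_Cexp; apply: exp_pos.
have d0 : 0 < e / (12 * m) by apply: Rdiv_lt_0_compat; lra.
exists (Rmin (1/2) (e / (12 * m))); split; first by apply: Rmin_glb_lt; lra.
move=> w hw; have [h1 h2] := Rmin_Rgt_l _ _ _ hw.
have -> : (Cexp w - Cexp z - Cexp z * (w - z) = Cexp z * (Cexp (w - z) - 1 - (w - z)))%C.
  by rewrite {1}(_ : w = z + (w - z))%C ?Cexp_add; ring.
rewrite Cmod_mult -/m.
have b := Cexp_sub_bound (Rlt_le _ _ h1).
apply: Rle_trans (Rmult_le_compat_l _ _ _ (Rlt_le _ _ m0) b) _.
have -> : m * (12 * Cmod (w - z) ^ 2) = (12 * m) * Cmod (w - z) * Cmod (w - z) by ring.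
apply: Rmult_le_compat_r; first exact: Cmod_ge_0.
have -> : e = 12 * m * (e / (12 * m)) by field; lra.
by apply: Rmult_le_compat_l; lra.
Qed.

(** * Curves and mean values *)

Lemma is_derive_of_remainder (V : NormedModule R_AbsRing) (f : R -> V) t (l : V) :
  (forall e, 0 < e -> exists d, 0 < d /\ forall s, Rabs (s - t) < d ->
     norm (minus (minus (f s) (f t)) (scal (s - t) l)) <= e * Rabs (s - t)) ->
  is_derive f t l.
Proof.
move=> H; split; first exact: is_linear_scal_l.
move=> x hx e; have -> : x = t.
  by have := is_filter_lim_locally_unique _ _ hx.
case: (H e (cond_pos e)) => d [dp Hd]; exists (mkposreal d dp) => s hs.
exact: Hd.
Qed.

Lemma is_derive_remainder (V : NormedModule R_AbsRing) (f : R -> V) t (l : V) :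
  is_derive f t l ->
  forall e, 0 < e -> exists d, 0 < d /\ forall s, Rabs (s - t) < d ->
     norm (minus (minus (f s) (f t)) (scal (s - t) l)) <= e * Rabs (s - t).
Proof.
case=> _ H e e0; case: (H t (fun Q hQ => hQ) (mkposreal e e0)) => d Hd.
by exists (pos d); split; [exact: cond_pos | move=> s hs; apply: Hd].
Qed.

(** The complex plane as a real normed space, in which curves are differentiated
    and integrated. *)
Notation CR := C_R_CompleteNormedModule.

Lemma CR_norm (z : C) : norm (z : CR) = Cmod z.
Proof. by rewrite Cmod_ReIm -(pow2_abs (Re z)) -(pow2_abs (Im z)). Qed.

Lemma curve_remainder (f : R -> C) t (l : C) :
  is_derive (f : R -> CR) t l <->
  forall e, 0 < e -> exists d, 0 < d /\ forall s, Rabs (s - t) < d ->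
     Cmod (f s - f t - RtoC (s - t) * l) <= e * Rabs (s - t).
Proof.
have E s : norm (minus (minus (f s : CR) (f t)) (scal (s - t) (l : CR)))
           = Cmod (f s - f t - RtoC (s - t) * l).
  by rewrite (scal_R_Cmult (s - t) l) CR_norm.
split=> [/is_derive_remainder H|H].
  by move=> e /H [d [dp Hd]]; exists d; split=> // s /Hd; rewrite -E.
apply: is_derive_of_remainder => e /H [d [dp Hd]]; exists d; split=> // s /Hd.
by rewrite -E.
Qed.

Lemma curve_chain (f : C -> C) (h : R -> C) t l v :
  is_derive (h : R -> CR) t v -> cder f (h t) l ->
  is_derive ((fun s => f (h s)) : R -> CR) t (l * v)%C.
Proof.
move=> /curve_remainder dh df; apply/curve_remainder => e e0.
have l0 := Cmod_ge_0 l; have v0 := Cmod_ge_0 v.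
set A := Cmod v + 1; set B := Cmod l + 1.
have A0 : 0 < A by rewrite /A; lra.
have B0 : 0 < B by rewrite /B; lra.
have eA : 0 < e / 2 / A by apply: Rdiv_lt_0_compat; lra.
have eB : 0 < e / 2 / B by apply: Rdiv_lt_0_compat; lra.
case: (cder_remainder df eA) => d1 [d1p H1].
case: (dh (Rmin 1 (e / 2 / B))) => [|d2 [d2p H2]]; first by apply: Rmin_glb_lt; lra.
exists (Rmin d2 (d1 / A)); split.
  by apply: Rmin_glb_lt => //; apply: Rdiv_lt_0_compat.
move=> s hs; have [hs1 hs2] := Rmin_Rgt_l _ _ _ hs.
have a0 := Rabs_pos (s - t).
have {H2} b := H2 s hs1.
have b1 : Cmod (h s - h t - RtoC (s - t) * v) <= 1 * Rabs (s - t).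
  by apply: Rle_trans b _; apply: Rmult_le_compat_r => //; apply: Rmin_l.
have b2 : Cmod (h s - h t - RtoC (s - t) * v) <= e / 2 / B * Rabs (s - t).
  by apply: Rle_trans b _; apply: Rmult_le_compat_r => //; apply: Rmin_r.
have g : Cmod (h s - h t) <= A * Rabs (s - t).
  have := Cmod_triangle (h s - h t - RtoC (s - t) * v) (RtoC (s - t) * v).
  rewrite Cmod_mult Cmod_R (_ : _ + _ = h s - h t)%C; last by ring.
  rewrite /A; lra.
have hd : Cmod (h s - h t) < d1.
  apply: Rle_lt_trans g _; rewrite Rmult_comm.
  have -> : d1 = d1 / A * A by field; lra.
  exact: Rmult_lt_compat_r.
have -> : (f (h s) - f (h t) - RtoC (s - t) * (l * v) =
  (f (h s) - f (h t) - l * (h s - h t)) + l * (h s - h t - RtoC (s - t) * v))%C by ring.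
apply: Rle_trans (Cmod_triangle _ _) _; rewrite Cmod_mult.
have i1 := H1 _ hd.
have i2 : e / 2 / A * Cmod (h s - h t) <= e / 2 / A * (A * Rabs (s - t)).
  by apply: Rmult_le_compat_l; lra.
have i3 : Cmod l * Cmod (h s - h t - RtoC (s - t) * v) <= B * (e / 2 / B * Rabs (s - t)).
  by apply: Rmult_le_compat => //; rewrite /B; try exact: Cmod_ge_0; lra.
have E1 : e / 2 / A * (A * Rabs (s - t)) = e / 2 * Rabs (s - t) by field; lra.
have E2 : B * (e / 2 / B * Rabs (s - t)) = e / 2 * Rabs (s - t) by field; lra.
lra.
Qed.

Lemma is_derive_Re (f : R -> C) t (l : C) :
  is_derive (f : R -> CR) t l -> is_derive (fun s => Re (f s)) t (Re l).
Proof.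
move=> /curve_remainder H; apply: is_derive_of_remainder => e /H [d [dp Hd]].
exists d; split=> // s /Hd; apply: Rle_trans.
apply: Rle_trans (re_le_Cmod _); apply: Req_le; rewrite /norm /= /abs /=.
congr Rabs; rewrite /minus /scal /= /plus /opp /= /mult /=.
by rewrite /Re /Im; ring.
Qed.

Lemma is_derive_Im (f : R -> C) t (l : C) :
  is_derive (f : R -> CR) t l -> is_derive (fun s => Im (f s)) t (Im l).
Proof.
move=> /curve_remainder H; apply: is_derive_of_remainder => e /H [d [dp Hd]].
exists d; split=> // s /Hd; apply: Rle_trans.
apply: Rle_trans (im_le_Cmod _); apply: Req_le; rewrite /norm /= /abs /=.
congr Rabs; rewrite /minus /scal /= /plus /opp /= /mult /=.
by rewrite /Re /Im; ring.
Qed.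

Lemma curve_affine (z v : C) t : is_derive ((fun s => z + RtoC s * v)%C : R -> CR) t v.
Proof.
apply/curve_remainder => e e0; exists 1; split=> [|s _]; first lra.
rewrite (_ : _ - _ = RtoC 0)%C ?Cmod_0.
  by apply: Rmult_le_pos; [lra | apply: Rabs_pos].
by rewrite RtoC_minus; ring.
Qed.

(** The real mean value inequality along the segment from [0] to [z], for the
    real and the imaginary part; the factor [2] is the price of separating them. *)
Lemma mean_value_at0 (f D : C -> C) c d m :
  0 <= c ->
  (forall w, Cmod w < d -> cder f w (D w) /\ Cmod (D w) <= c * Cmod w ^ m) ->
  forall z, Cmod z < d -> Cmod (f z - f (RtoC 0)) <= 2 * c * Cmod z ^ m.+1.
Proof.
move=> c0 H z hz.
have z0 := Cmod_ge_0 z.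
have dz s : Rabs (s - 0) <= Rabs (1 - 0) ->
    is_derive ((fun s => f (0 + RtoC s * z)%C) : R -> CR) s (D (0 + RtoC s * z) * z)%C
    /\ Cmod (D (0 + RtoC s * z) * z)%C <= c * Cmod z ^ m.+1.
  rewrite !Rminus_0_r Rabs_R1 => hs.
  have ms : Cmod (0 + RtoC s * z)%C <= Cmod z.
    by rewrite Cplus_0_l Cmod_mult Cmod_R; have := Rabs_pos s; nra.
  case: (H (0 + RtoC s * z)%C) => [|h1 h2]; first lra.
  split; first by apply: curve_chain h1; apply: curve_affine.
  rewrite Cmod_mult /= -(Rmult_comm (_ ^ _)) -Rmult_assoc; apply: Rmult_le_compat_r => //.
  apply: Rle_trans h2 _.
  apply: Rmult_le_compat_l => //; apply: pow_incr; split=> //; exact: Cmod_ge_0.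
have B1 := @bounded_variation _ _ _ 0 1 (fun s hs => conj (is_derive_Re (proj1 (dz s hs)))
  (Rle_trans _ _ _ (re_le_Cmod _) (proj2 (dz s hs)))).
have B2 := @bounded_variation _ _ _ 0 1 (fun s hs => conj (is_derive_Im (proj1 (dz s hs)))
  (Rle_trans _ _ _ (im_le_Cmod _) (proj2 (dz s hs)))).
move: B1 B2; rewrite !Cmult_0_l !Cmult_1_l !Cplus_0_l Rminus_0_r Rabs_R1.
move=> B1 B2; apply: Rle_trans (Cmod_le_abs _) _.
rewrite /Cminus re_plus im_plus re_opp im_opp; rewrite /Rminus in B1 B2; lra.
Qed.

(** * Branches of the logarithm *)

Lemma cos_eq1 t : - (2 * PI) < t < 2 * PI -> cos t = 1 -> t = 0.
Proof.
move=> ht; rewrite cos_half => h.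
have s0 : sin (t / 2) = 0.
  have : sin (t / 2) ^ 2 = 0 by lra.
  by rewrite /= Rmult_1_r => /Rmult_integral [].
case: (Rtotal_order t 0) => [t0|[//|t0]].
  have := @sin_gt_0 (- (t / 2)) ltac:(lra) ltac:(lra); rewrite sin_neg; lra.
have := @sin_gt_0 (t / 2) ltac:(lra) ltac:(lra); lra.
Qed.

Lemma Cexp_inj u v : - PI < Im u <= PI -> - PI < Im v <= PI -> Cexp u = Cexp v -> u = v.
Proof.
move=> hu hv e.
have er : Re u = Re v by apply: exp_inv; rewrite -!Cmod_Cexp e.
have : Cexp (u - v) = RtoC 1.
  by rewrite /Cminus Cexp_add e -Cexp_add Cplus_opp_r Cexp_0.
rewrite /Cexp re_plus re_opp er Rplus_opp_r exp_0 !Rmult_1_l im_plus im_opp.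
case=> /cos_eq1 h _; have {}h := h ltac:(lra).
by move: er h; case: (u) => a b; case: (v) => c d /= -> h; congr pair; lra.
Qed.

Lemma ratio_Cmod z : z <> RtoC 0 -> -1 <= Re z / Cmod z <= 1.
Proof.
move=> /Cmod_gt_0 m0; have /Rabs_le_between h := re_le_Cmod z.
split; [apply/Rle_div_r | apply/Rle_div_l]; lra.
Qed.

Lemma cos_Carg z : z <> RtoC 0 -> cos (Carg z) = Re z / Cmod z.
Proof.
move=> z0; rewrite /Carg; case: Rle_dec => ? /=.
  by rewrite Rmult_1_l cos_acos //; apply: ratio_Cmod.
by rewrite -Ropp_mult_distr_l Rmult_1_l cos_neg cos_acos //; apply: ratio_Cmod.
Qed.

Lemma Carg_range z : z <> RtoC 0 -> - PI < Carg z <= PI.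
Proof.
move=> z0; have pi0 := PI_RGT_0; have := acos_bound (Re z / Cmod z).
rewrite /Carg; case: Rle_dec => i /=; first lra.
move=> b; split; last lra.
suff : acos (Re z / Cmod z) <> PI by lra.
move=> e; have := cos_acos _ (ratio_Cmod z0); rewrite e cos_PI => h.
have m0 : 0 < Cmod z by apply/Cmod_gt_0.
have hr : Re z = - Cmod z.
  have e2 : Re z = Re z / Cmod z * Cmod z by field; lra.
  by rewrite e2 -h; ring.
have := Cmod2_alt z; rewrite hr => hh.
have : Im z ^ 2 = 0 by nra.
by rewrite /= Rmult_1_r => /Rmult_integral; lra.
Qed.

Lemma sin_Carg z : z <> RtoC 0 -> sin (Carg z) = Im z / Cmod z.
Proof.
move=> z0; have m0 : 0 < Cmod z by apply/Cmod_gt_0.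
have h : sqrt (1 - (Re z / Cmod z)²) = Rabs (Im z) / Cmod z.
  rewrite -[RHS]Rabs_pos_eq; last by apply: Rdiv_le_0_compat => //; apply: Rabs_pos.
  rewrite -sqrt_Rsqr_abs; congr sqrt; have := Cmod2_alt z.
  rewrite !Rsqr_div' !Rsqr_pow2 pow2_abs => e.
  by rewrite (_ : Re z ^ 2 = Cmod z ^ 2 - Im z ^ 2); [field | ]; lra.
rewrite /Carg; case: Rle_dec => i /=.
  by rewrite Rmult_1_l sin_acos ?h ?Rabs_pos_eq //; apply: ratio_Cmod.
rewrite -Ropp_mult_distr_l Rmult_1_l sin_neg sin_acos ?h; last exact: ratio_Cmod.
rewrite Rabs_left; lra.
Qed.

Lemma Cexp_Clog z : z <> RtoC 0 -> Cexp (Clog z) = z.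
Proof.
move=> z0; have m0 : 0 < Cmod z by apply/Cmod_gt_0.
rewrite /Clog /Cexp /= cos_Carg // sin_Carg // exp_ln //.
by case: z z0 m0 => a b _ m0 /=; congr pair; field; lra.
Qed.

Lemma Clog_Cexp u : - PI < Im u <= PI -> Clog (Cexp u) = u.
Proof.
move=> hu; apply: Cexp_inj => //; first exact/Carg_range/Cexp_neq0.
by rewrite Cexp_Clog //; apply: Cexp_neq0.
Qed.

Lemma ln_abs_bound x : 1/2 <= x -> Rabs (ln x) <= 2 * Rabs (x - 1).
Proof.
move=> hx; have := exp_ineq1_le (ln x); rewrite exp_ln; last lra.
have := exp_ineq1_le (ln (/ x)); rewrite exp_ln; last by apply: Rinv_0_lt_compat; lra.
rewrite ln_Rinv; last lra.
move=> h1 h2; apply: Rabs_le.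
have e : / x - 1 = (1 - x) * / x by field; lra.
have i2 : 0 < / x <= 2.
  split; first by apply: Rinv_0_lt_compat; lra.
  rewrite -(Rinv_inv 2); apply: Rinv_le_contravar; lra.
split; last by have := Rle_abs (x - 1); have := Rabs_pos (x - 1); lra.
case: (Rle_lt_dec x 1) => x1.
  rewrite Rabs_left1; nra.
rewrite Rabs_pos_eq; nra.
Qed.

Lemma atan_abs_le x : Rabs (atan x) <= Rabs x.
Proof.
case: (@MVT_gen atan 0 x (fun t => / (1 + t ^ 2))) => [t _|t _|t [_]].
- by rewrite -Rsqr_pow2; apply: is_derive_atan.
- exact: derivable_continuous_pt (derivable_pt_atan t).
rewrite atan_0 !Rminus_0_r => ->; rewrite Rabs_mult -[X in _ <= X]Rmult_1_l.
apply: Rmult_le_compat_r; first exact: Rabs_pos.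
have t0 := pow2_ge_0 t.
rewrite Rabs_pos_eq; last by apply/Rlt_le/Rinv_0_lt_compat; lra.
rewrite -Rinv_1; apply: Rinv_le_contravar; lra.
Qed.

(** The explicit logarithm [ln |q| + i atan (Im q / Re q)] near [1].  It provides
    the increment of [Clog] between nearby points. *)
Lemma small_log q : Cmod (q - 1) <= 1/2 ->
  exists v, Cexp v = q /\ Cmod v <= 4 * Cmod (q - 1).
Proof.
move=> hq; have hr : Rabs (Re q - 1) <= Cmod (q - 1).
  have -> : Re q - 1 = Re (q - 1) by rewrite re_plus.
  exact: re_le_Cmod.
have hi : Rabs (Im q) <= Cmod (q - 1).
  have -> : Im q = Im (q - 1) by rewrite im_plus im_opp im_RtoC; ring.
  exact: im_le_Cmod.
have hm : Rabs (Cmod q - 1) <= Cmod (q - 1).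
  have h1 := Cmod_ge_sub q 1; have h2 := Cmod_ge_sub 1 q.
  by rewrite Cmod_1 Cmod_sub_rev in h2; rewrite Cmod_1 in h1; apply: Rabs_le; lra.
have [r1 r2] := proj1 (Rabs_le_between _ _) (Rle_trans _ _ _ hr hq).
have [m1 m2] := proj1 (Rabs_le_between _ _) (Rle_trans _ _ _ hm hq).
have md : Cmod q = Re q * sqrt (1 + (Im q / Re q) ^ 2).
  rewrite -{1}(sqrt_pow2 (Re q)); last lra.
  rewrite -sqrt_mult_alt; last exact: pow2_ge_0.
  by rewrite Cmod_ReIm; congr sqrt; field; lra.
exists (ln (Cmod q), atan (Im q / Re q)); split.
  rewrite /Cexp /= exp_ln ?cos_atan ?sin_atan; last lra.
  rewrite md Rsqr_pow2; have s0 : 0 < sqrt (1 + (Im q / Re q) ^ 2).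
    by apply: sqrt_lt_R0; have := pow2_ge_0 (Im q / Re q); lra.
  by rewrite [RHS]surjective_pairing; congr pair; rewrite -/(Re q) -/(Im q); field; lra.
apply: Rle_trans (Cmod_le_abs _) _ => /=.
have l1 := @ln_abs_bound (Cmod q) ltac:(lra).
have a1 := atan_abs_le (Im q / Re q).
have : Rabs (Im q / Re q) <= 2 * Cmod (q - 1).
  rewrite Rabs_div; last lra.
  apply/Rle_div_l; rewrite (Rabs_pos_eq (Re q)); try lra.
  by have := Cmod_ge_0 (q - 1); nra.
lra.
Qed.

(** The complement of the cut of [Clog]. *)
Definition slit (w : C) : Prop := Im w <> 0 \/ 0 < Re w.

Lemma slit_neq0 w : slit w -> w <> RtoC 0.
Proof. by move=> h e; move: h; rewrite e => -[] /=; lra. Qed.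

Lemma slit_Carg w : slit w -> Rabs (Carg w) < PI.
Proof.
move=> h; have w0 := slit_neq0 h; have [a1 a2] := Carg_range w0.
have m0 : 0 < Cmod w by apply/Cmod_gt_0.
apply: Rabs_def1 => //; case: (Rle_lt_or_eq_dec _ _ a2) => // e; exfalso.
have := sin_Carg w0; have := cos_Carg w0; rewrite e cos_PI sin_PI => c s.
have ei : Im w = 0.
  have e2 : Im w = Im w / Cmod w * Cmod w by field; lra.
  by rewrite e2 -s; ring.
have er : Re w = - Cmod w.
  have e2 : Re w = Re w / Cmod w * Cmod w by field; lra.
  by rewrite e2 -c; ring.
case: h; lra.
Qed.

(** Nearby points differ by a factor near [1], whose small logarithm changes the
    argument too little for it to cross the cut. *)
Lemma Clog_cont w0 : slit w0 -> ccont Clog w0.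
Proof.
move=> hs e e0; have n0 := slit_neq0 hs; have m0 : 0 < Cmod w0 by apply/Cmod_gt_0.
have ha := slit_Carg hs; set a := Rabs (Carg w0) in ha.
set d := Rmin (1/2) (Rmin ((PI - a) / 5) (e / 5)).
have d0 : 0 < d by rewrite /d; repeat apply: Rmin_glb_lt; lra.
have [d1 d2 d3] : [/\ d <= 1/2, d <= (PI - a) / 5 & d <= e / 5].
  split; first exact: Rmin_l.
    by apply: Rle_trans (Rmin_r _ _) (Rmin_l _ _).
  by apply: Rle_trans (Rmin_r _ _) (Rmin_r _ _).
exists (d * Cmod w0); split; first exact: Rmult_lt_0_compat.
move=> w hw; set q := (w / w0)%C.
have hq : Cmod (q - 1) < d.
  rewrite (_ : q - 1 = (w - w0) / w0)%C; last by rewrite /q; field.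
  by rewrite Cmod_div //; apply/Rlt_div_l.
case: (@small_log q) => [|v [ev hv]]; first lra.
have hv5 : Cmod v < 5 * d by have := Cmod_ge_0 (q - 1); lra.
have -> : Clog w = (Clog w0 + v)%C.
  rewrite -(@Clog_Cexp (Clog w0 + v)).
    by rewrite Cexp_add Cexp_Clog // ev /q; congr Clog; field.
  have := im_le_Cmod v => hi; have iv : Rabs (Im v) < PI - a by lra.
  have [i1 i2] := Rabs_def2 _ _ iv.
  have [c1 c2] := proj1 (Rabs_le_between (Carg w0) a) (Rle_refl _).
  rewrite im_plus /=; lra.
rewrite (_ : Clog w0 + v - Clog w0 = v)%C; last by ring.
lra.
Qed.

(** The difference quotient of [L] is the reciprocal of that of [E], taken along
    [L]; it is continuous because [L] is. *)
Lemma cder_inverse (L E : C -> C) w0 m d : 0 < d ->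
  (forall w, Cmod (w - w0) < d -> E (L w) = w) ->
  ccont L w0 -> cder E (L w0) m -> m <> RtoC 0 -> cder L w0 (/ m)%C.
Proof.
move=> d0 EL cL [q [cq qm Eq]] mn0.
have cqL := ccont_comp cL cq.
have m0 : 0 < Cmod m by apply/Cmod_gt_0.
case: (cqL (Cmod m) m0) => d1 [d1p H1].
apply: (@cder_near (fun w => L w0 + / q (L w) * (w - w0))%C _ _ _ (Rmin d d1)).
- exact: Rmin_glb_lt.
- move=> w hw.
  have [h1 h2] := Rmin_Rgt_l _ _ _ hw.
  have qn0 : q (L w) <> RtoC 0.
    move=> q0; have := H1 w h2; rewrite q0 qm.
    by rewrite (_ : 0 - m = - m)%C ?Cmod_opp; [lra | ring].
  have := Eq (L w); rewrite !EL //; last by rewrite (_ : w0 - w0 = 0)%C ?Cmod_0 //; ring.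
  by move=> e; rewrite {2}e; field.
- exists (fun w => / q (L w))%C; split.
  + by apply: ccont_inv; rewrite ?qm.
  + by rewrite qm.
  + by move=> w; ring.
Qed.

Lemma cder_Clog w : slit w -> cder Clog w (/ w)%C.
Proof.
move=> hs; have n0 := slit_neq0 hs; have m0 : 0 < Cmod w by apply/Cmod_gt_0.
apply: (@cder_inverse _ Cexp _ _ (Cmod w)) => //.
- move=> v hv; apply: Cexp_Clog => v0; move: hv; rewrite v0.
  by rewrite (_ : 0 - w = - w)%C ?Cmod_opp; [lra | ring].
- exact: Clog_cont.
- by apply: cder_eq (cder_Cexp _) _; rewrite Cexp_Clog.
Qed.

Lemma cder_inv f z l : cder f z l -> f z <> RtoC 0 ->
  cder (fun w => / f w)%C z (- l / (f z * f z))%C.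
Proof.
move=> df fz; have cf := cder_cont df; case: df => q [cq <- E].
have m0 : 0 < Cmod (f z) by apply/Cmod_gt_0.
case: (cf _ m0) => d [dp H].
apply: (@cder_near (fun w => / f z + (- q w / (f w * f z)) * (w - z))%C _ _ _ d) => //.
- move=> w hw; have fw : f w <> RtoC 0.
    move=> f0; have := H w hw; rewrite f0.
    by rewrite (_ : 0 - f z = - f z)%C ?Cmod_opp; [lra | ring].
  have e : (q w * (w - z) = f w - f z)%C by rewrite [f w]E; ring.
  rewrite (_ : - q w / (f w * f z) * (w - z) = - (q w * (w - z)) / (f w * f z))%C.
    by rewrite e; field.
  by field.
- exists (fun w => - q w / (f w * f z))%C; split=> //.
  + apply: ccont_mult.
      apply: (@ccont_ext (fun w => (- RtoC 1) * q w)%C); first by move=> w; ring.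
      by apply: ccont_mult => //; apply: ccont_const.
    apply: ccont_inv; last exact: Cmult_neq_0.
    by apply: ccont_mult => //; apply: ccont_const.
  + by move=> w; ring.
Qed.

(** The branch of [log (1 / (1 - q))] with its cut on the ray [[1, +oo)]. *)
Definition llog (q : C) : C := Clog (1 / (1 - q)).

Lemma slit_inv w : slit w -> slit (1 / w).
Proof.
move=> hs; have n0 := slit_neq0 hs; have m0 : 0 < Cmod w by apply/Cmod_gt_0.
have p0 : 0 < Re w ^ 2 + Im w ^ 2 by rewrite -Cmod2_alt; apply: pow_lt.
have er : Re (1 / w) = Re w / (Re w ^ 2 + Im w ^ 2).
  rewrite /Re /Im in p0 *; case: w p0 {hs n0 m0} => a b /= p0; field; lra.
have ei : Im (1 / w) = - Im w / (Re w ^ 2 + Im w ^ 2).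
  rewrite /Re /Im in p0 *; case: w p0 {hs n0 m0 er} => a b /= p0; field; lra.
rewrite /slit er ei; case: hs => h; [left | right; exact: Rdiv_lt_0_compat].
by apply: Rmult_integral_contrapositive_currified; [lra | apply/Rgt_not_eq/Rinv_0_lt_compat].
Qed.

Lemma Re_llog q : (1 - q)%C <> RtoC 0 -> Re (llog q) = - ln (Cmod (1 - q)).
Proof.
move=> h; rewrite /llog /Clog /= Cmod_div // Cmod_1 /Rdiv Rmult_1_l ln_Rinv //.
by apply/Cmod_gt_0.
Qed.

Lemma cder_llog q : slit (1 - q) -> cder llog q (1 / (1 - q))%C.
Proof.
move=> hs; have n0 := slit_neq0 hs.
have d1 : cder (fun w => 1 - w)%C q (- RtoC 1)%C.
  have := cder_plus (cder_const 1 q) (cder_scal (- RtoC 1) (cder_id q)).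
  move=> h; apply: cder_eq; first by apply: cder_ext h => w; ring.
  by ring.
have d2 : cder (fun w => 1 / (1 - w))%C q (1 / ((1 - q) * (1 - q)))%C.
  apply: cder_eq; first by apply: cder_ext (cder_inv d1 n0) => w; rewrite /Cdiv Cmult_1_l.
  by cbv beta; field.
have := cder_comp d2 (cder_Clog (slit_inv hs)).
by move=> h; apply: cder_eq h _; field.
Qed.

(** * Taylor coefficients as asymptotic expansions *)

Lemma exp_mono x y : x <= y -> exp x <= exp y.
Proof. by case=> [/exp_increasing/Rlt_le|->] //; apply: Rle_refl. Qed.

Lemma csum_split (I : Type) (s : seq I) (Q : pred I) (F G : I -> C) :
  (\big[Cplus/RtoC 0]_(i <- s | Q i) (F i + G i) =
   \big[Cplus/RtoC 0]_(i <- s | Q i) F i + \big[Cplus/RtoC 0]_(i <- s | Q i) G i)%C.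
Proof. exact: big_split. Qed.

Lemma cder_csum (I : Type) (s : seq I) (Q : pred I) (F : I -> C -> C) (D : I -> C) z :
  (forall i, Q i -> cder (F i) z (D i)) ->
  cder (fun w => \big[Cplus/RtoC 0]_(i <- s | Q i) F i w) z
       (\big[Cplus/RtoC 0]_(i <- s | Q i) D i).
Proof.
move=> H; elim: s => [|i s IH].
  apply: cder_eq; last by rewrite big_nil.
  by apply: cder_ext (cder_const (RtoC 0) z) => w; rewrite big_nil.
rewrite big_cons; case: ifP => Qi.
  apply: cder_ext (cder_plus (H i Qi) IH) => w.
  by rewrite big_cons Qi.
by apply: cder_ext IH => w; rewrite big_cons Qi.
Qed.

Lemma cder_pow n z : cder (fun w => w ^ n.+1)%C z (RtoC (INR n.+1) * z ^ n)%C.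
Proof.
elim: n => [|n IH].
  apply: cder_eq; first by apply: cder_ext (cder_id z) => w; rewrite Cpow_1_r.
  by rewrite /= Cmult_1_l.
apply: cder_eq; first by apply: cder_ext (cder_mult (cder_id z) IH) => w; rewrite -Cpow_S.
by rewrite (S_INR n.+1) RtoC_plus !(Cpow_S _ n); ring.
Qed.

Definition bdd_on (S : C -> Prop) (f : C -> C) : Prop :=
  exists c, 0 <= c /\ forall z, S z -> Cmod (f z) <= c.

Lemma bdd_const S (a : C) : bdd_on S (fun=> a).
Proof. by exists (Cmod a); split=> [|z _]; [apply: Cmod_ge_0 | apply: Rle_refl]. Qed.

Lemma bdd_mult S f h : bdd_on S f -> bdd_on S h -> bdd_on S (fun z => f z * h z)%C.
Proof.
move=> [c [c0 H]] [d [d0 H']]; exists (c * d); split; first exact: Rmult_le_pos.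
move=> z Sz; rewrite Cmod_mult; apply: Rmult_le_compat; try exact: Cmod_ge_0.
  exact: H.
exact: H'.
Qed.

Lemma bdd_plus S f h : bdd_on S f -> bdd_on S h -> bdd_on S (fun z => f z + h z)%C.
Proof.
move=> [c [c0 H]] [d [d0 H']]; exists (c + d); split; first lra.
move=> z Sz; have := Cmod_triangle (f z) (h z); have := H z Sz; have := H' z Sz; lra.
Qed.

Lemma bdd_csum S (I : Type) (s : seq I) (Q : pred I) (F : I -> C -> C) :
  (forall i, Q i -> bdd_on S (F i)) ->
  bdd_on S (fun z => \big[Cplus/RtoC 0]_(i <- s | Q i) F i z).
Proof.
move=> H; elim: s => [|i s [c [c0 IH]]].
  by case: (bdd_const S (RtoC 0)) => c [c0 h]; exists c; split=> // z; rewrite big_nil; apply: h.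
case Qi: (Q i).
  case: (bdd_plus (H i Qi) (ex_intro _ c (conj c0 IH))) => d [d0 h].
  by exists d; split=> // z /h; rewrite big_cons Qi.
by exists c; split=> // z /IH; rewrite big_cons Qi.
Qed.

Definition unit_disc (z : C) := Cmod z <= 1.

Lemma bdd_pow n : bdd_on unit_disc (fun z => z ^ n)%C.
Proof.
exists 1; split=> [|z hz]; first lra.
by rewrite Cmod_pow -(pow1 n); apply: pow_incr; split=> //; apply: Cmod_ge_0.
Qed.

(** Taylor coefficients at [0] in the sense of asymptotic expansions.  They pass
    through products and exponentials by elementary estimates, and they are all
    that a contour integral requires of a function near [0]. *)
Definition taylor (f : C -> C) (c : nat -> C) : Prop :=
  forall n, exists M d, [/\ 0 <= M, 0 < d & forall z, Cmod z < d ->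
    Cmod (f z - \csum_(j < n) (c j * z ^ j)) <= M * Cmod z ^ n].

Lemma taylor_ext f h c e : (forall z, f z = h z) -> (forall j, c j = e j) ->
  taylor f c -> taylor h e.
Proof.
move=> fh ce T n; case: (T n) => M [d [M0 d0 H]]; exists M, d; split=> // z /H.
rewrite fh; congr (Cmod (_ - _) <= _).
by apply: eq_bigr => j _; rewrite ce.
Qed.

Lemma taylor_zero : taylor (fun=> RtoC 0) (fun=> RtoC 0).
Proof.
move=> n; exists 0, 1; split; [lra | lra |] => z _.
rewrite big1 => [|j _]; last by rewrite Cmult_0_l.
by rewrite (_ : 0 - 0 = RtoC 0)%C ?Cmod_0; [lra | ring].
Qed.

Lemma taylor_plus f h c e : taylor f c -> taylor h e ->
  taylor (fun z => f z + h z)%C (fun j => c j + e j)%C.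
Proof.
move=> T T' n; case: (T n) => M [d [M0 d0 H]]; case: (T' n) => M' [d' [M0' d0' H']].
exists (M + M'), (Rmin d d'); split; [lra | exact: Rmin_glb_lt |] => z hz.
have h1 := H z (Rlt_le_trans _ _ _ hz (Rmin_l _ _)).
have h2 := H' z (Rlt_le_trans _ _ _ hz (Rmin_r _ _)).
have -> : (\csum_(j < n) ((c j + e j) * z ^ j) =
   \csum_(j < n) (c j * z ^ j) + \csum_(j < n) (e j * z ^ j))%C.
  by rewrite -big_split /=; apply: eq_bigr => j _; rewrite Cmult_plus_distr_r.
have := Cmod_triangle (f z - \csum_(j < n) (c j * z ^ j)) (h z - \csum_(j < n) (e j * z ^ j)).
rewrite (_ : _ - _ + (_ - _) = f z + h z - (\csum_(j < n) (c j * z ^ j) + \csum_(j < n) (e j * z ^ j)))%C.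
  lra.
by ring.
Qed.

Lemma taylor_scal (a : C) f c : taylor f c ->
  taylor (fun z => a * f z)%C (fun j => a * c j)%C.
Proof.
move=> T n; case: (T n) => M [d [M0 d0 H]].
exists (Cmod a * M), d; split=> //; first by apply: Rmult_le_pos => //; apply: Cmod_ge_0.
move=> z hz; have -> : (\csum_(j < n) (a * c j * z ^ j) = a * \csum_(j < n) (c j * z ^ j))%C.
  by rewrite csum_mull; apply: eq_bigr => j _; rewrite Cmult_assoc.
rewrite (_ : _ - _ = a * (f z - \csum_(j < n) (c j * z ^ j)))%C; last by ring.
rewrite Cmod_mult Rmult_assoc; apply: Rmult_le_compat_l; [exact: Cmod_ge_0 | exact: H].
Qed.

Lemma taylor_csum (I : Type) (s : seq I) (F : I -> C -> C) (c : I -> nat -> C) :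
  (forall i, taylor (F i) (c i)) ->
  taylor (fun z => \big[Cplus/RtoC 0]_(i <- s) F i z)
         (fun j => \big[Cplus/RtoC 0]_(i <- s) c i j).
Proof.
move=> H; elim: s => [|i s IH].
  by apply: taylor_ext taylor_zero => z; rewrite big_nil.
by apply: taylor_ext (taylor_plus (H i) IH) => z; rewrite big_cons.
Qed.

Lemma taylor_dilate (a : C) f c : a <> RtoC 0 -> taylor f c ->
  taylor (fun z => f (a * z))%C (fun j => a ^ j * c j)%C.
Proof.
move=> /Cmod_gt_0 a0 T n; case: (T n) => M [d [M0 d0 H]].
exists (M * Cmod a ^ n), (d / Cmod a); split.
- by apply: Rmult_le_pos => //; apply/pow_le/Rlt_le.
- exact: Rdiv_lt_0_compat.
move=> z /(Rlt_div_r _ _ _ a0) hz.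
have := H (a * z)%C; rewrite Cmod_mult Rmult_comm => /(_ hz).
rewrite Rpow_mult_distr -(Rmult_comm (Cmod a ^ n)) Rmult_assoc -(Rmult_assoc M) (Rmult_comm M).
rewrite Rmult_assoc.
have -> // : (\csum_(j < n) (a ^ j * c j * z ^ j) = \csum_(j < n) (c j * (a * z) ^ j))%C.
by apply: eq_bigr => j _; rewrite Cpow_mult_l; ring.
Qed.

Lemma taylor_mul_linear (w : C) f c : taylor f c ->
  taylor (fun z => (1 - w * z) * f z)%C
         (fun j => c j - w * (if j is i.+1 then c i else 0))%C.
Proof.
move=> T n; case: (T n) => M [d [M0 d0 H]].
set K := 1 + Cmod w; have w0 := Cmod_ge_0 w.
set last := (if n is i.+1 then c i else RtoC 0).
exists (K * M + Cmod w * Cmod last), (Rmin d 1); split.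
- apply: Rplus_le_le_0_compat; apply: Rmult_le_pos => //; try exact: Cmod_ge_0.
  by rewrite /K; lra.
- by apply: Rmin_glb_lt; lra.
move=> z hz; have hz1 := Rlt_le_trans _ _ _ hz (Rmin_l _ _).
have hz2 := Rlt_le_trans _ _ _ hz (Rmin_r _ _); have z0 := Cmod_ge_0 z.
have E : (\csum_(j < n) ((c j - w * (if nat_of_ord j is i.+1 then c i else 0)) * z ^ j) =
   (1 - w * z) * (\csum_(j < n) (c j * z ^ j)) + w * last * z ^ n)%C.
  rewrite /last {H last}; elim: n => [|n IH].
    by rewrite !big_ord0 /=; ring.
  rewrite !big_ord_recr /= IH; case: n {IH} => [|n] /=; ring.
rewrite E (_ : _ - _ = (1 - w * z) * (f z - \csum_(j < n) (c j * z ^ j)) + (- w) * last * z ^ n)%C; last by ring.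
apply: Rle_trans (Cmod_triangle _ _) _; rewrite !Cmod_mult Cmod_opp Cmod_pow Rmult_plus_distr_r.
apply: Rplus_le_compat; last exact: Rle_refl.
rewrite Rmult_assoc; apply: Rmult_le_compat; try exact: Cmod_ge_0; last exact: H.
have := Cmod_triangle 1 (- (w * z)); rewrite Cmod_1 Cmod_opp Cmod_mult /K /Cminus; nra.
Qed.

(** The recursion of [exp_coef] is the Cauchy product in the degrees below [N];
    what is left of the product of the two truncations is divisible by [z ^ N]. *)
Lemma triangular_product (a p : nat -> C) N :
  exp_coef a p -> exists rem : C -> C, bdd_on unit_disc rem /\ forall z,
  ((\csum_(k < N) (a k.+1 * z ^ k)) * (\csum_(i < N.+1) (p i * z ^ i)) =
   \csum_(m < N) (RtoC (INR m.+1) * p m.+1 * z ^ m) + rem z * z ^ N)%C.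
Proof.
move=> [p0 prec].
exists (fun z => \csum_(k < N) (a k.+1 *
    \big[Cplus/RtoC 0]_(N - k <= i < N.+1) (p i * z ^ (k + i - N)%N)))%C; split.
  apply: bdd_csum => k _; apply: bdd_mult; first exact: bdd_const.
  by apply: bdd_csum => i _; apply: bdd_mult; [apply: bdd_const | apply: bdd_pow].
move=> z; have -> : (\csum_(m < N) (RtoC (INR m.+1) * p m.+1 * z ^ m) =
   \csum_(k < N) (a k.+1 * \big[Cplus/RtoC 0]_(0 <= i < N - k) (p i * z ^ (k + i)%N)))%C.
  transitivity (\csum_(m < N) \big[Cplus/RtoC 0]_(k < N | (k <= m)%N) (a k.+1 * (p (m - k)%N * z ^ m)))%C.
    apply: eq_bigr => m _; rewrite prec.
    rewrite Cmult_comm csum_mull (big_ord_widen N (fun k => z ^ m * (a k.+1 * p (m - k)%N))%C) //.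
    by apply: eq_bigr => k _; ring.
  rewrite (exchange_big_dep xpredT) //=; apply: eq_bigr => k _.
  rewrite csum_mull -(big_geq_mkord _ _ xpredT (fun m => a k.+1 * (p (m - k)%N * z ^ m))%C).
  rewrite -{1}(add0n (k : nat)) big_addn.
  by apply: eq_bigr => i _; rewrite addnK addnC.
rewrite [in RHS](Cmult_comm _ (z ^ N)) [in RHS]csum_mull -csum_split.
rewrite (Cmult_comm (\csum_(k < N) _)) csum_mull; apply: eq_bigr => k _.
have -> : (\csum_(i < N.+1) (p i * z ^ i) = \big[Cplus/RtoC 0]_(0 <= i < N - k) (p i * z ^ i) +
   \big[Cplus/RtoC 0]_(N - k <= i < N.+1) (p i * z ^ i))%C.
  by rewrite -(big_mkord xpredT (fun i => p i * z ^ i)%C) -big_cat_nat //= leqW // leq_subr.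
have E1 : (z ^ k * \big[Cplus/RtoC 0]_(0 <= i < N - k) (p i * z ^ i) =
     \big[Cplus/RtoC 0]_(0 <= i < N - k) (p i * z ^ (k + i)%N))%C.
  rewrite csum_mull; apply: eq_bigr => i _.
  by rewrite -(plusE) Cpow_add_r; ring.
have E2 : (z ^ k * \big[Cplus/RtoC 0]_(N - k <= i < N.+1) (p i * z ^ i) =
     z ^ N * \big[Cplus/RtoC 0]_(N - k <= i < N.+1) (p i * z ^ (k + i - N)%N))%C.
  rewrite !csum_mull; apply: eq_big_nat => i /andP [hi _].
  have e : (k + i = N + (k + i - N))%N by rewrite subnKC // -leq_subLR.
  have : (z ^ (k + i)%N = z ^ N * z ^ (k + i - N)%N)%C by rewrite {1}e -plusE Cpow_add_r.
  rewrite -{1}plusE Cpow_add_r => e2.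
  rewrite (_ : _ * (p i * _) = p i * (z ^ k * z ^ i))%C; last by ring.
  by rewrite e2; ring.
transitivity (a k.+1 * (z ^ k * \big[Cplus/RtoC 0]_(0 <= i < N - k) (p i * z ^ i)) +
  a k.+1 * (z ^ k * \big[Cplus/RtoC 0]_(N - k <= i < N.+1) (p i * z ^ i)))%C; first by ring.
by rewrite E1 E2; ring.
Qed.

Lemma csum_at0 n (c : nat -> C) : (\csum_(j < n.+1) (c j * RtoC 0 ^ j))%C = c 0%N.
Proof.
rewrite big_ord_recl big1 => [|j _]; first by rewrite /= Cmult_1_r Cplus_0_r.
by rewrite lift0 Cpow_S Cmult_0_l Cmult_0_r.
Qed.

(** If [S] is the partial sum prescribed by the recursion and [A] the truncated
    exponent, then [S exp (- A)] is flat at [0], because its derivative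
    [(S' - A' S) exp (- A)] vanishes to high order by [triangular_product]. *)
Lemma taylor_exp A a p :
  taylor A (fun k => if k is 0%N then RtoC 0 else a k / RtoC (INR k))%C ->
  exp_coef a p -> taylor (fun z => Cexp (A z)) p.
Proof.
move=> TA ep [|N].
  case: (TA 0%N) => M [d [M0 d0 HA]]; exists (exp M), d; split=> //.
    exact/Rlt_le/exp_pos.
  move=> z /HA; rewrite !big_ord0 !Rmult_1_r => h.
  rewrite (_ : Cexp _ - 0 = Cexp (A z))%C; last by ring.
  rewrite Cmod_Cexp; apply: exp_mono; apply: Rle_trans (Rle_abs _) _.
  apply: Rle_trans (re_le_Cmod _) _.
  by rewrite (_ : A z = A z - 0)%C //; ring.
have [p0 _] := ep.
case: (TA N.+1) => M [d [M0 d0 HA]].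
set AN := fun z : C => (\csum_(k < N) (a k.+1 / RtoC (INR k.+1) * z ^ k.+1))%C.
set SN := fun z : C => (\csum_(i < N.+1) (p i * z ^ i))%C.
case: (triangular_product N ep) => rem [[B [B0 brem]] prod].
have nz k : RtoC (INR k.+1) <> RtoC 0.
  by move=> /RtoC_inj; apply: not_0_INR.
have dA z : cder AN z (\csum_(k < N) (a k.+1 * z ^ k))%C.
  apply: cder_eq; first by apply: cder_csum => k _; apply: cder_scal (cder_pow k z).
  by apply: eq_bigr => k _; field; apply: nz.
have dS z : cder SN z (\csum_(m < N) (RtoC (INR m.+1) * p m.+1 * z ^ m))%C.
  apply: (@cder_ext (fun z => p 0%N + \csum_(m < N) (p m.+1 * z ^ m.+1))%C).
    by move=> w; rewrite /SN big_ord_recl /= Cmult_1_r.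
  apply: cder_eq.
    apply: cder_plus (cder_const _ _) _.
    by apply: cder_csum => k _; apply: cder_scal (cder_pow k z).
  by rewrite Cplus_0_l; apply: eq_bigr => k _; ring.
have [cA [cA0 bA]] : bdd_on unit_disc AN.
  by apply: bdd_csum => k _; apply: bdd_mult; [apply: bdd_const | apply: bdd_pow].
set E := fun z : C => (SN z * Cexp (- AN z))%C.
set D := fun z : C => (- (rem z * z ^ N) * Cexp (- AN z))%C.
have dE z : cder E z (D z).
  have dN : cder (fun w => - AN w)%C z (- (\csum_(k < N) (a k.+1 * z ^ k)))%C.
    apply: cder_eq; first by apply: cder_ext (cder_scal (- RtoC 1) (dA z)) => w; ring.
    by ring.
  apply: cder_eq (cder_mult (dS z) (cder_comp dN (cder_Cexp _))) _.
  have e : (\csum_(m < N) (RtoC (INR m.+1) * p m.+1 * z ^ m) =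
    (\csum_(k < N) (a k.+1 * z ^ k)) * SN z - rem z * z ^ N)%C.
    by rewrite /SN prod; ring.
  by rewrite e /D; ring.
have eA s z : unit_disc z -> Rabs s <= 1 -> exp (Re (RtoC s * AN z)) <= exp cA.
  move=> hz hs; apply: exp_mono; apply: Rle_trans (Rle_abs _) _.
  apply: Rle_trans (re_le_Cmod _) _; rewrite Cmod_mult Cmod_R.
  have := bA z hz; have := Cmod_ge_0 (AN z); have := Rabs_pos s; nra.
have eAm z : unit_disc z -> Cmod (Cexp (- AN z)) <= exp cA.
  move=> hz; rewrite Cmod_Cexp (_ : - AN z = RtoC (-1) * AN z)%C.
    by apply: eA => //; rewrite Rabs_left; lra.
  by ring.
have e0 := exp_pos cA.
have E0 : E (RtoC 0) = RtoC 1.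
  rewrite /E /SN csum_at0 p0 /AN big1 => [|k _]; last by rewrite Cpow_S Cmult_0_l Cmult_0_r.
  by rewrite (_ : - RtoC 0 = RtoC 0)%C ?Cexp_0; ring.
have flat z : Cmod z < 1 -> Cmod (E z - E (RtoC 0)) <= 2 * (B * exp cA) * Cmod z ^ N.+1.
  apply: mean_value_at0 => [|w hw]; first by apply: Rmult_le_pos; lra.
  split; first exact: dE.
  have uw : unit_disc w by apply: Rlt_le.
  rewrite /D !Cmod_mult Cmod_opp Cmod_mult Cmod_pow.
  rewrite Rmult_assoc (Rmult_comm (_ ^ _)) -Rmult_assoc; apply: Rmult_le_compat_r.
    by apply: pow_le; apply: Cmod_ge_0.
  by apply: Rmult_le_compat; try exact: Cmod_ge_0; [apply: brem | apply: eAm].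
exists (exp cA * (7 * M + 2 * (B * exp cA))), (Rmin d (Rmin 1 (/ (2 * (M + 1))))); split.
- by repeat apply: Rmult_le_pos; try lra; apply: Rplus_le_le_0_compat; repeat apply: Rmult_le_pos; lra.
- by repeat apply: Rmin_glb_lt; try lra; apply: Rinv_0_lt_compat; lra.
move=> z hz.
have [hz1 /Rmin_Rgt_l [hz2 hz3]] := Rmin_Rgt_l _ _ _ hz.
have uz : unit_disc z by apply: Rlt_le.
have z0 := Cmod_ge_0 z; have zn0 : 0 <= Cmod z ^ N.+1 by apply: pow_le.
have hA : Cmod (A z - AN z) <= M * Cmod z ^ N.+1.
  move: (HA z hz1); rewrite big_ord_recl.
  rewrite (_ : A z - AN z = A z - (0 * z ^ 0%N + AN z))%C //.
  by ring.
have zN : Cmod z ^ N.+1 <= Cmod z.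
  rewrite -[X in _ <= X]Rmult_1_r /=; apply: Rmult_le_compat_l => //.
  by rewrite -(pow1 N); apply: pow_incr; lra.
have hA2 : Cmod (A z - AN z) <= 1/2.
  apply: Rle_trans hA _; apply: (@Rle_trans _ ((M + 1) * / (2 * (M + 1)))).
    by apply: Rmult_le_compat; lra.
  by apply: Req_le; field; lra.
have eE : (Cexp (A z) - SN z = Cexp (AN z) * ((Cexp (A z - AN z) - 1) - (E z - E (RtoC 0))))%C.
  rewrite E0 /E {1}(_ : A z = AN z + (A z - AN z))%C; last by ring.
  rewrite Cexp_add -{1}[SN z]Cmult_1_l -(Cexp_opp (AN z)); ring.
rewrite eE Cmod_mult Rmult_assoc; apply: Rmult_le_compat; try exact: Cmod_ge_0.
  by rewrite Cmod_Cexp -[AN z]Cmult_1_l; apply: eA => //; rewrite Rabs_R1; lra.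
have t := Cmod_triangle (Cexp (A z - AN z) - 1) (- (E z - E (RtoC 0))).
rewrite Cmod_opp in t; have := Cexp_lip hA2; have := flat z hz2.
rewrite /Cminus in t hA *; nra.
Qed.

Lemma geometric_csum N (z : C) : ((1 - z) * (\csum_(k < N) (z ^ k)) = 1 - z ^ N)%C.
Proof.
elim: N => [|N IH]; first by rewrite big_ord0 /=; ring.
by rewrite big_ord_recr /= Cmult_plus_distr_l IH; ring.
Qed.

Lemma Clog1 : Clog (RtoC 1) = RtoC 0.
Proof.
rewrite -Cexp_0 Clog_Cexp //=; have := PI_RGT_0; lra.
Qed.

(** The derivative [1 / (1 - z)] minus its geometric partial sum is
    [z ^ N / (1 - z)], which [mean_value_at0] integrates. *)
Lemma taylor_llog : taylor llog (fun k => if k is 0%N then RtoC 0 else 1 / RtoC (INR k))%C.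
Proof.
pose AN N := fun z : C => (\csum_(k < N) (1 / RtoC (INR k.+1) * z ^ k.+1))%C.
have key N z : Cmod z < 1/2 -> Cmod (llog z - AN N z) <= 4 * Cmod z ^ N.+1.
  have f0 : (llog (RtoC 0) - AN N (RtoC 0) = 0)%C.
    rewrite /llog (_ : 1 / (1 - 0) = RtoC 1)%C; last by field.
    rewrite Clog1 /AN big1 => [|k _]; first by ring.
    by rewrite Cpow_S Cmult_0_l Cmult_0_r.
  move=> hz; rewrite (_ : llog z - AN N z = (llog z - AN N z) - (llog (RtoC 0) - AN N (RtoC 0)))%C; last first.
    by rewrite f0; ring.
  rewrite (_ : 4 = 2 * 2); last by lra.
  apply: (@mean_value_at0 (fun z => llog z - AN N z)%C (fun z => 1 / (1 - z) - \csum_(k < N) (z ^ k))%C _ (1/2)) => // [|w hw]; first lra.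
  have rw : 1/2 < Re (1 - w).
    rewrite re_plus re_opp /=; have := re_le_Cmod w; have := Rle_abs (Re w); lra.
  have sw : slit (1 - w) by right; lra.
  have n0 := slit_neq0 sw.
  split.
    apply: (@cder_ext (fun z => llog z + (- RtoC 1) * AN N z)%C); first by move=> v; ring.
    apply: cder_eq.
      apply: cder_plus (cder_llog sw) _; apply: cder_scal.
      by apply: cder_csum => k _; apply: cder_scal (cder_pow k w).
    have e : (\csum_(k < N) (1 / RtoC (INR k.+1) * (RtoC (INR k.+1) * w ^ k)) = \csum_(k < N) (w ^ k))%C.
      by apply: eq_bigr => k _; field; move=> /RtoC_inj; apply: not_0_INR.
    by rewrite e; ring.
  rewrite (_ : _ - _ = w ^ N / (1 - w))%C; last first.
    apply: (@eq_trans _ _ ((1 - (1 - w) * (\csum_(k < N) (w ^ k))) / (1 - w)))%C; first by field.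
    by rewrite geometric_csum; field.
  rewrite Cmod_div // Cmod_pow /Rdiv Rmult_comm; apply: Rmult_le_compat_r.
    by apply: pow_le; apply: Cmod_ge_0.
  rewrite -(Rinv_inv 2); apply: Rinv_le_contravar; first lra.
  have := re_le_Cmod (1 - w); have := Rle_abs (Re (1 - w)); lra.
move=> [|N].
  exists 4, (1/2); split; try lra; move=> z hz; rewrite big_ord0 /= Rmult_1_r.
  have := key 0%N z hz; rewrite /AN big_ord0 /= Rmult_1_r; lra.
exists 4, (1/2); split; try lra; move=> z hz; have := key N z hz.
by rewrite /AN big_ord_recl Cmult_0_l Cplus_0_l.
Qed.

Lemma bounded_of_eventually (u : nat -> R) c k0 :
  (forall k, (k0 <= k)%N -> u k <= c) -> exists B, 0 <= B /\ forall k, u k <= B.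
Proof.
elim: k0 c => [|k0 IH] c H.
  exists (Rmax 0 c); split=> [|k]; first exact: Rmax_l.
  by apply: Rle_trans (Rmax_r _ _); apply: H.
apply: (IH (Rmax (u k0) c)) => k; rewrite leq_eqVlt => /orP [/eqP <-|/H h].
  exact: Rmax_l.
exact: Rle_trans h (Rmax_r _ _).
Qed.

Lemma pseries_partial a t l :
  @is_pseries C_AbsRing C_NormedModule a t l ->
  forall e, 0 < e -> exists n0, forall n, (n0 <= n)%N ->
    Cmod (\csum_(j < n) (a j * t ^ j) - l) < e.
Proof.
move=> H e e0.
have powE j : pow_n (t : C_AbsRing) j = (t ^ j)%C.
  by elim: j => [|j IH] //=; rewrite IH.
have sumE n : sum_n (fun k => scal (pow_n (t : C_AbsRing) k) (a k : C_NormedModule)) n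
     = (\csum_(j < n.+1) (a j * t ^ j))%C.
  elim: n => [|n IH].
    by rewrite sum_O big_ord_recr big_ord0 powE /= Cplus_0_l Cmult_comm.
  by rewrite sum_Sn IH [RHS]big_ord_recr powE /= (Cmult_comm (a n.+1)).
have P : locally (l : C_NormedModule) (fun w => Cmod (w - l) < e).
  apply/locally_C; exists (mkposreal e e0) => w hw; exact: hw.
case: (H _ P) => n0 H0; exists n0.+1 => -[//|n] hn.
by rewrite -sumE; apply: H0; apply/leP.
Qed.

(** Convergence at [rho / 2] bounds the terms there, and a geometric series then
    bounds the tail at smaller arguments. *)
Lemma taylor_of_pseries a f rho : 0 < rho ->
  (forall t, Cmod t < rho -> @is_pseries C_AbsRing C_NormedModule a t (f t)) ->
  taylor f a.
Proof.
move=> rho0 H n.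
set s := rho / 2; have s0 : 0 < s by rewrite /s; lra.
have [B [B0 HB]] : exists B, 0 <= B /\ forall k, Cmod (a k) * s ^ k <= B.
  have cs : Cmod (RtoC s) < rho by rewrite Cmod_R Rabs_pos_eq /s; lra.
  case: (pseries_partial (H _ cs) Rlt_0_1) => n0 h0.
  apply: (@bounded_of_eventually _ 2 n0) => k hk.
  have := h0 k.+1 (leqW hk); have := h0 k hk; rewrite big_ord_recr /=.
  set S := (\csum_(j < k) _)%C; set l := f _ => h1 h2.
  have -> : Cmod (a k) * s ^ k = Cmod (a k * RtoC s ^ k).
    by rewrite Cmod_mult Cmod_pow Cmod_R Rabs_pos_eq //; lra.
  have := Cmod_triangle (S + a k * RtoC s ^ k - l) (- (S - l)); rewrite Cmod_opp.
  rewrite (_ : _ + - _ = a k * RtoC s ^ k)%C; last by ring.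
  lra.
exists (2 * B * (/ s) ^ n), (s / 2); split; [|lra|].
  by apply: Rmult_le_pos; [lra | apply/pow_le/Rlt_le/Rinv_0_lt_compat].
move=> z hz; set q := Cmod z / s.
have z0 := Cmod_ge_0 z.
have q0 : 0 <= q by apply: Rdiv_le_0_compat.
have q2 : q <= 1/2 by apply/Rle_div_l; lra.
have qn0 : 0 <= q ^ n by apply: pow_le.
have tail m : Cmod (\csum_(j < n + m) (a j * z ^ j) - \csum_(j < n) (a j * z ^ j))
     <= 2 * B * q ^ n * (1 - (1/2) ^ m).
  elim: m => [|m IH].
    by rewrite addn0 (_ : _ - _ = RtoC 0)%C ?Cmod_0 /=; [lra | ring].
  rewrite addnS big_ord_recr /=.
  set S := (\csum_(j < n + m) _)%C in IH *; set T := (\csum_(j < n) _)%C in IH *.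
  rewrite (_ : _ - _ = (S - T) + a (n + m)%N * z ^ (n + m)%N)%C; last by ring.
  apply: Rle_trans (Cmod_triangle _ _) _.
  have : Cmod (a (n + m)%N * z ^ (n + m)%N) <= B * (q ^ n * (1 / 2) ^ m).
    rewrite Cmod_mult Cmod_pow (_ : Cmod z = s * q); last by rewrite /q; field; lra.
    rewrite Rpow_mult_distr -Rmult_assoc; apply: Rmult_le_compat => //.
    - by apply: Rmult_le_pos; [apply: Cmod_ge_0 | apply: pow_le; lra].
    - exact: pow_le.
    - rewrite -plusE pow_add; apply: Rmult_le_compat_l => //.
      exact: pow_incr.
  lra.
have bound e : 0 < e -> Cmod (f z - \csum_(j < n) (a j * z ^ j)) <= 2 * B * q ^ n + e.
  move=> e0; have cz : Cmod z < rho by rewrite /s in hz; lra.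
  case: (pseries_partial (H z cz) e0) => n0 h0.
  have := h0 (n + n0)%N (leq_addl _ _); have := tail n0.
  have := pow_le (1/2) n0 ltac:(lra).
  set S := (\csum_(j < n + n0) _)%C; set T := (\csum_(j < n) _)%C => h1 h2 h3.
  have := Cmod_triang_minus (f z) S T; have := Cmod_sub_rev (f z) S.
  have : 0 <= 2 * B * q ^ n by apply: Rmult_le_pos => //; lra.
  nra.
have -> : 2 * B * (/ s) ^ n * Cmod z ^ n = 2 * B * q ^ n.
  by rewrite /q /Rdiv Rpow_mult_distr; ring.
exact: le_epsilon.
Qed.

(** * Bisection and Goursat's theorem *)

(** If the property failed, it would fail on a shrinking sequence of quarter
    squares, hence near their common point.  Goursat's theorem and the
    compactness of a rectangle are both instances. *)
Lemma square_bisection (P : R -> R -> R -> Prop) :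
  (forall s t h, 0 < h -> P s t (h / 2) -> P (s + h / 2) t (h / 2) ->
     P s (t + h / 2) (h / 2) -> P (s + h / 2) (t + h / 2) (h / 2) -> P s t h) ->
  (forall s t, 0 <= s <= 1 -> 0 <= t <= 1 -> exists d, 0 < d /\
     forall s' t' h, 0 < h < d -> s' <= s <= s' + h -> t' <= t <= t' + h -> P s' t' h) ->
  P 0 0 1.
Proof.
move=> split4 local; apply: NNPP => nP.
pose bad (x : R * R * R) := ~ P x.1.1 x.1.2 x.2.
have step (x : R * R * R) : 0 < x.2 -> bad x -> exists y : R * R * R,
    [/\ bad y, y.2 = x.2 / 2,
        x.1.1 <= y.1.1 <= x.1.1 + x.2 / 2 & x.1.2 <= y.1.2 <= x.1.2 + x.2 / 2].
  case: x => [[s t] h] /= h0 nb; apply: NNPP => no; apply: nb.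
  apply: split4 => //; apply: NNPP => nQ; apply: no.
  - by exists (s, t, h / 2); split=> //=; lra.
  - by exists (s + h / 2, t, h / 2); split=> //=; lra.
  - by exists (s, t + h / 2, h / 2); split=> //=; lra.
  - by exists (s + h / 2, t + h / 2, h / 2); split=> //=; lra.
have [nxt nxtP] : exists nxt : R * R * R -> R * R * R, forall x, 0 < x.2 -> bad x ->
    [/\ bad (nxt x), (nxt x).2 = x.2 / 2,
        x.1.1 <= (nxt x).1.1 <= x.1.1 + x.2 / 2 & x.1.2 <= (nxt x).1.2 <= x.1.2 + x.2 / 2].
  apply: (choice (fun x y => 0 < x.2 -> bad x -> [/\ bad y, y.2 = x.2 / 2,
    x.1.1 <= y.1.1 <= x.1.1 + x.2 / 2 & x.1.2 <= y.1.2 <= x.1.2 + x.2 / 2])) => x.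
  case: (classic (0 < x.2 /\ bad x)) => [[h b]|n].
    by case: (step x h b) => y hy; exists y.
  by exists x => h b; case: n.
pose u n := iter n nxt (0, 0, 1).
have u_ok n : bad (u n) /\ (u n).2 = (1/2) ^ n.
  elim: n => [|n [IH1 IH2]]; first by split.
  have h0 : 0 < (u n).2 by rewrite IH2; apply: pow_lt; lra.
  case: (nxtP _ h0 IH1) => b e _ _; split=> //.
  by rewrite [(u n.+1).2]e IH2 /=; field.
have hpos n : 0 < (u n).2 by rewrite (proj2 (u_ok n)); apply: pow_lt; lra.
have mono (f : R * R * R -> R) :
    (forall n, f (u n) <= f (u n.+1) /\ f (u n.+1) + (u n.+1).2 <= f (u n) + (u n).2) ->
    exists l, forall n, f (u n) <= l <= f (u n) + (u n).2.
  move=> H.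
  have up n m : f (u n) <= f (u (n + m)%N) /\ f (u (n + m)%N) + (u (n + m)%N).2 <= f (u n) + (u n).2.
    elim: m => [|m IH]; rewrite ?addn0 ?addnS; first lra.
    by have := H (n + m)%N; lra.
  have cross n m : f (u n) <= f (u m) + (u m).2.
    have := up n m; have := up m n; rewrite (addnC m n); have := hpos (n + m)%N; lra.
  case: (completeness (fun x => exists n, x = f (u n))).
  - by exists (f (u 0%N) + (u 0%N).2) => _ [n ->].
  - by exists (f (u 0%N)), 0%N.
  move=> l [ub lub]; exists l => n; split; first by apply: ub; exists n.
  by apply: lub => _ [m ->].
have stp n := nxtP _ (hpos n) (proj1 (u_ok n)).
case: (mono (fun x => x.1.1)) => [n|s Hs].
  by case: (stp n) => _ e h _; change (u n.+1) with (nxt (u n)); rewrite e; lra.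
case: (mono (fun x => x.1.2)) => [n|t Ht].
  by case: (stp n) => _ e _ h; change (u n.+1) with (nxt (u n)); rewrite e; lra.
have s01 := Hs 0%N; have t01 := Ht 0%N; rewrite /= in s01 t01.
case: (local s t) => [||d [d0 Hd]]; try lra.
have [n hn] : exists n, (1/2) ^ n < d.
  have := pow_lt_1_zero (1/2) _ d d0; rewrite Rabs_pos_eq; last lra.
  move=> /(_ ltac:(lra)) [n h]; exists n; have := h n (le_n _).
  by rewrite Rabs_pos_eq //; apply: pow_le; lra.
case: (u_ok n) => nb e; apply: nb; apply: Hd; rewrite ?e //.
- by split=> //; apply: pow_lt; lra.
- by rewrite -e; apply: Hs.
- by rewrite -e; apply: Ht.
Qed.

Definition rcont (f : R -> C) t : Prop :=
  forall e, 0 < e -> exists d, 0 < d /\ forall s, Rabs (s - t) < d -> Cmod (f s - f t) < e.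

Lemma rcont_ccont f t : rcont f t <-> ccont (fun z => f (Re z)) (RtoC t).
Proof.
split=> H e /H [d [d0 Hd]]; exists d; split=> //.
  move=> w hw; apply: Hd; apply: Rle_lt_trans hw.
  by apply: Rle_trans (re_le_Cmod _); rewrite re_plus re_opp re_RtoC; apply: Rle_refl.
move=> s hs; have := Hd (RtoC s); rewrite !re_RtoC; apply.
by rewrite -RtoC_minus Cmod_R.
Qed.

Lemma rcont_mult f h t : rcont f t -> rcont h t -> rcont (fun s => f s * h s)%C t.
Proof. by move=> /rcont_ccont a /rcont_ccont b; apply/rcont_ccont; apply: ccont_mult. Qed.

Lemma rcont_plus f h t : rcont f t -> rcont h t -> rcont (fun s => f s + h s)%C t.
Proof. by move=> /rcont_ccont a /rcont_ccont b; apply/rcont_ccont; apply: ccont_plus. Qed.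

Lemma rcont_const (c : C) t : rcont (fun=> c) t.
Proof. by apply/rcont_ccont; apply: ccont_const. Qed.

Lemma rcont_comp (f : C -> C) h t : rcont h t -> ccont f (h t) -> rcont (fun s => f (h s)) t.
Proof.
by move=> /rcont_ccont a b; apply/rcont_ccont; apply: (ccont_comp (f := fun z => h (Re z))).
Qed.

Lemma rcont_RtoC (f : R -> R) t : continuity_pt f t -> rcont (fun s => RtoC (f s)) t.
Proof.
move=> cf e e0; case: (cf e e0) => d [d0 H]; exists d; split=> // s hs.
rewrite -RtoC_minus Cmod_R; case: (Req_dec s t) => [->|n].
  by rewrite Rminus_diag Rabs_R0.
by apply: (H s); split=> //; split=> //; apply: not_eq_sym.
Qed.

Lemma rcont_continuous f t : rcont f t -> continuous (f : R -> CR) t.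
Proof.
move=> H; apply/filterlim_locally => e.
case: (H e (cond_pos e)) => d [d0 Hd]; exists (mkposreal d d0) => s hs.
have h := Hd s hs.
split; apply: Rle_lt_trans h.
  by apply: Rle_trans (re_le_Cmod _); rewrite re_plus re_opp; apply: Rle_refl.
by apply: Rle_trans (im_le_Cmod _); rewrite im_plus im_opp; apply: Rle_refl.
Qed.

Lemma is_derive_rcont (f : R -> C) t (l : C) : is_derive (f : R -> CR) t l -> rcont f t.
Proof.
move=> /curve_remainder H e e0; case: (H 1 Rlt_0_1) => d [d0 Hd].
have l0 := Cmod_ge_0 l.
have ep : 0 < e / (Cmod l + 1) by apply: Rdiv_lt_0_compat; lra.
exists (Rmin d (e / (Cmod l + 1))); split; first exact: Rmin_glb_lt.
move=> s hs; have h1 := Hd s (Rlt_le_trans _ _ _ hs (Rmin_l _ _)).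
have h2 := Rlt_le_trans _ _ _ hs (Rmin_r _ _).
have := Cmod_triangle (f s - f t - RtoC (s - t) * l) (RtoC (s - t) * l).
rewrite Cmod_mult Cmod_R (_ : _ + _ = f s - f t)%C; last by ring.
have : Rabs (s - t) * (Cmod l + 1) < e by apply/Rlt_div_r => //; lra.
lra.
Qed.

Definition CRint (f : R -> C) (a b : R) : C := RInt (f : R -> CR) a b.

Lemma CRint_correct f a b : a <= b -> (forall t, a <= t <= b -> rcont f t) ->
  is_RInt (f : R -> CR) a b (CRint f a b).
Proof.
move=> ab H; apply: (RInt_correct (V := CR)); apply: ex_RInt_continuous => t.
rewrite Rmin_left // Rmax_right // => ht; exact/rcont_continuous/H.
Qed.

Lemma CRint_Chasles f a b c : a <= b -> b <= c -> (forall t, a <= t <= c -> rcont f t) ->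
  CRint f a c = (CRint f a b + CRint f b c)%C.
Proof.
move=> ab bc H; apply: esym; apply: (RInt_Chasles (V := CR)).
  exists (CRint f a b); apply: CRint_correct => // t ht; apply: H; lra.
exists (CRint f b c); apply: CRint_correct => // t ht; apply: H; lra.
Qed.

(** The form [lin dz] has the primitive [Q], so its integral is known.  This is how
    the integral over a short edge or over a small circle is evaluated. *)
Lemma edge_estimate (q lin Q : C -> C) (g dg : R -> C) a b M :
  a <= b ->
  (forall t, is_derive (g : R -> CR) t (dg t)) -> (forall t, rcont dg t) ->
  (forall t, a <= t <= b -> ccont q (g t)) ->
  (forall z, cder Q z (lin z)) -> (forall z, ccont lin z) ->
  (forall t, a <= t <= b -> Cmod ((q (g t) - lin (g t)) * dg t) <= M) ->
  Cmod (CRint (fun t => q (g t) * dg t)%C a b - (Q (g b) - Q (g a))) <= (b - a) * M.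
Proof.
move=> ab dgP cdg cq dQ clin HM.
have cg t : rcont g t by apply: is_derive_rcont (dgP t).
have I1 : is_RInt ((fun t => q (g t) * dg t)%C : R -> CR) a b (CRint (fun t => q (g t) * dg t)%C a b).
  apply: CRint_correct => // t ht; apply: rcont_mult => //.
  by apply: rcont_comp => //; apply: cq.
have I2 : is_RInt ((fun t => lin (g t) * dg t)%C : R -> CR) a b (minus (Q (g b) : CR) (Q (g a))).
  apply: (is_RInt_derive ((fun t => Q (g t)) : R -> CR)) => t _.
    exact: curve_chain.
  by apply: rcont_continuous; apply: rcont_mult => //; apply: rcont_comp.
have := norm_RInt_le_const _ _ _ _ M ab _ (is_RInt_minus _ _ _ _ _ _ I1 I2).
rewrite CR_norm; apply=> t ht; apply: Rle_trans (HM t ht); apply: Req_le.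
have -> : ((q (g t) - lin (g t)) * dg t = q (g t) * dg t - lin (g t) * dg t)%C by ring.
exact: CR_norm.
Qed.

(** The boundary of the square [[s, s + h] x [t, t + h]], traversed through the
    map [F] with partial derivatives [Fs] and [Ft]. *)
Definition boundary (q : C -> C) (F Fs Ft : R -> R -> C) (s t h : R) : C :=
  (CRint (fun x => q (F x t) * Fs x t) s (s + h)
   + CRint (fun y => q (F (s + h)%R y) * Ft (s + h)%R y) t (t + h)
   - CRint (fun x => q (F x (t + h)%R) * Fs x (t + h)%R) s (s + h)
   - CRint (fun y => q (F s y) * Ft s y) t (t + h))%C.

(** Goursat's theorem for the image of a square.  Pulling the form [q dz] back
    along a map lets the sides of the square be bent, which spares a general
    theory of contours. *)
Lemma goursat_square (q : C -> C) (F Fs Ft : R -> R -> C) B :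
  (forall x y, is_derive ((fun x => F x y) : R -> CR) x (Fs x y)) ->
  (forall x y, is_derive ((fun y => F x y) : R -> CR) y (Ft x y)) ->
  (forall x y, rcont (fun x => Fs x y) x) -> (forall x y, rcont (fun y => Ft x y) y) ->
  (forall x y x' y', 0 <= x <= 1 -> 0 <= y <= 1 -> 0 <= x' <= 1 -> 0 <= y' <= 1 ->
     Cmod (F x y - F x' y') <= B * (Rabs (x - x') + Rabs (y - y'))) ->
  (forall x y, 0 <= x <= 1 -> 0 <= y <= 1 -> Cmod (Fs x y) <= B /\ Cmod (Ft x y) <= B) ->
  (forall x y, 0 <= x <= 1 -> 0 <= y <= 1 -> exists l, cder q (F x y) l) ->
  boundary q F Fs Ft 0 0 1 = RtoC 0.
Proof.
move=> dFs dFt cFs cFt lipF bF dq.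
have B0 : 0 <= B.
  by have [h _] := bF 0 0 ltac:(lra) ltac:(lra); have := Cmod_ge_0 (Fs 0 0); lra.
have cq x y : 0 <= x <= 1 -> 0 <= y <= 1 -> ccont q (F x y).
  by move=> hx hy; case: (dq x y hx hy) => l /cder_cont.
have cx x y : 0 <= x <= 1 -> 0 <= y <= 1 -> rcont (fun x => q (F x y) * Fs x y)%C x.
  move=> hx hy; apply: rcont_mult => //; apply: (rcont_comp (h := fun x => F x y)).
    exact: is_derive_rcont (dFs x y).
  exact: cq.
have cy x y : 0 <= x <= 1 -> 0 <= y <= 1 -> rcont (fun y => q (F x y) * Ft x y)%C y.
  move=> hx hy; apply: rcont_mult => //; apply: (rcont_comp (h := fun y => F x y)).
    exact: is_derive_rcont (dFt x y).
  exact: cq.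
suff small e : 0 < e -> Cmod (boundary q F Fs Ft 0 0 1) <= 0 + e.
  apply: Cmod_eq_0; apply: Rle_antisym; last exact: Cmod_ge_0.
  exact: le_epsilon.
move=> e0; rewrite Rplus_0_l.
suff : 0 <= 0 -> 0 + 1 <= 1 -> 0 <= 0 -> 0 + 1 <= 1 -> Cmod (boundary q F Fs Ft 0 0 1) <= e * 1 ^ 2.
  by move=> h; have := h ltac:(lra) ltac:(lra) ltac:(lra) ltac:(lra); lra.
apply: (square_bisection (P := fun s t h => 0 <= s -> s + h <= 1 -> 0 <= t -> t + h <= 1 ->
  Cmod (boundary q F Fs Ft s t h) <= e * h ^ 2)) => [s t h h0 P1 P2 P3 P4 s0 s1 t0 t1|s t hs ht].
  have e1 : s + h / 2 + h / 2 = s + h by field.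
  have e2 : t + h / 2 + h / 2 = t + h by field.
  have -> : boundary q F Fs Ft s t h =
     (boundary q F Fs Ft s t (h / 2) + boundary q F Fs Ft (s + h / 2) t (h / 2) +
      (boundary q F Fs Ft s (t + h / 2) (h / 2) + boundary q F Fs Ft (s + h / 2) (t + h / 2) (h / 2)))%C.
    rewrite /boundary !e1 !e2.
    rewrite (@CRint_Chasles (fun x => q (F x t) * Fs x t)%C s (s + h / 2) (s + h)); try lra; last first.
      by move=> x hx; apply: cx; lra.
    rewrite (@CRint_Chasles (fun x => q (F x (t + h)%R) * Fs x (t + h)%R)%C s (s + h / 2) (s + h)); try lra; last first.
      by move=> x hx; apply: cx; lra.
    rewrite (@CRint_Chasles (fun y => q (F s y) * Ft s y)%C t (t + h / 2) (t + h)); try lra; last first.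
      by move=> x hx; apply: cy; lra.
    rewrite (@CRint_Chasles (fun y => q (F (s + h)%R y) * Ft (s + h)%R y)%C t (t + h / 2) (t + h)); try lra; last first.
      by move=> x hx; apply: cy; lra.
    ring.
  have {}P1 := P1 ltac:(lra) ltac:(lra) ltac:(lra) ltac:(lra).
  have {}P2 := P2 ltac:(lra) ltac:(lra) ltac:(lra) ltac:(lra).
  have {}P3 := P3 ltac:(lra) ltac:(lra) ltac:(lra) ltac:(lra).
  have {}P4 := P4 ltac:(lra) ltac:(lra) ltac:(lra) ltac:(lra).
  apply: Rle_trans (Cmod_triangle _ _) _.
  have := Cmod_triangle (boundary q F Fs Ft s t (h / 2)) (boundary q F Fs Ft (s + h / 2) t (h / 2)).
  have := Cmod_triangle (boundary q F Fs Ft s (t + h / 2) (h / 2)) (boundary q F Fs Ft (s + h / 2) (t + h / 2) (h / 2)).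
  have : e * (h / 2) ^ 2 = e * h ^ 2 / 4 by field.
  lra.
case: (dq s t hs ht) => l dl; set p := F s t in dl *.
(* four sides of length [h], of speed at most [B], and whose points are at
   distance at most [2 (B + 1) h] from [p] *)
set e' := e / (8 * (B + 1) ^ 2).
have e'0 : 0 < e' by apply: Rdiv_lt_0_compat => //; have := pow_lt (B + 1) 2 ltac:(lra); lra.
case: (cder_remainder dl e'0) => d [d0 Hd].
exists (d / (2 * (B + 1))); split; first by apply: Rdiv_lt_0_compat; lra.
move=> s' t' h [h0 hd] hs' ht' s0 s1 t0 t1.
have hd2 : 2 * (B + 1) * h < d by have := proj2 (Rlt_div_r h d (2 * (B + 1)) ltac:(lra)) hd; lra.
set lin := fun z => (q p + l * (z - p))%C.
set Q := fun z => (q p * z + l * (z - p) ^ 2 / 2)%C.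
have clin z : ccont lin z.
  apply: ccont_plus; first exact: ccont_const.
  apply: ccont_mult; first exact: ccont_const.
  by apply: ccont_plus; [exact: ccont_id | exact: ccont_const].
have dQ z : cder Q z (lin z).
  have dm : cder (fun z => z - p)%C z (RtoC 1).
    by apply: cder_eq (cder_plus (cder_id z) (cder_const (- p)%C z)) _; ring.
  have := cder_plus (cder_scal (q p) (cder_id z)) (cder_scal (l / 2)%C (cder_mult dm dm)).
  move=> D; apply: cder_eq; first by apply: cder_ext D => w; rewrite /Q; field.
  by rewrite /lin; field.
set M := e' * (2 * (B + 1) * h) * B.
have est x y v : s' <= x <= s' + h -> t' <= y <= t' + h -> Cmod v <= B ->
    Cmod ((q (F x y) - lin (F x y)) * v) <= M.
  move=> hx hy hv.
  have dist : Cmod (F x y - p) <= 2 * (B + 1) * h.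
    apply: Rle_trans (lipF x y s t _ _ _ _) _; try lra.
    have a1 : Rabs (x - s) <= h by apply: Rabs_le; lra.
    have a2 : Rabs (y - t) <= h by apply: Rabs_le; lra.
    have := Rabs_pos (x - s); have := Rabs_pos (y - t); nra.
  rewrite Cmod_mult; apply: Rmult_le_compat; try exact: Cmod_ge_0; last by [].
  rewrite /lin (_ : _ - _ = q (F x y) - q p - l * (F x y - p))%C; last by ring.
  apply: Rle_trans (Hd _ _) _; first lra.
  by apply: Rmult_le_compat_l => //; lra.
have E1 := @edge_estimate q lin Q (fun x => F x t') (fun x => Fs x t') s' (s' + h) M.
have E2 := @edge_estimate q lin Q (fun y => F (s' + h) y) (fun y => Ft (s' + h) y) t' (t' + h) M.
have E3 := @edge_estimate q lin Q (fun x => F x (t' + h)) (fun x => Fs x (t' + h)) s' (s' + h) M.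
have E4 := @edge_estimate q lin Q (fun y => F s' y) (fun y => Ft s' y) t' (t' + h) M.
have {}E1 := E1 ltac:(lra) (fun x => dFs x t') (fun x => cFs x t')
  (fun x hx => cq x t' ltac:(lra) ltac:(lra)) dQ clin
  (fun x hx => est x t' _ hx ltac:(lra) (proj1 (bF x t' ltac:(lra) ltac:(lra)))).
have {}E3 := E3 ltac:(lra) (fun x => dFs x (t' + h)) (fun x => cFs x (t' + h))
  (fun x hx => cq x (t' + h) ltac:(lra) ltac:(lra)) dQ clin
  (fun x hx => est x (t' + h) _ hx ltac:(lra) (proj1 (bF x (t' + h) ltac:(lra) ltac:(lra)))).
have {}E2 := E2 ltac:(lra) (fun x => dFt (s' + h) x) (fun x => cFt (s' + h) x)
  (fun x hx => cq (s' + h) x ltac:(lra) ltac:(lra)) dQ clin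
  (fun x hx => est (s' + h) x _ ltac:(lra) hx (proj2 (bF (s' + h) x ltac:(lra) ltac:(lra)))).
have {}E4 := E4 ltac:(lra) (fun x => dFt s' x) (fun x => cFt s' x)
  (fun x hx => cq s' x ltac:(lra) ltac:(lra)) dQ clin
  (fun x hx => est s' x _ ltac:(lra) hx (proj2 (bF s' x ltac:(lra) ltac:(lra)))).
rewrite /boundary.
set I1 := CRint _ _ _ in E1 *; set I2 := CRint _ _ _ in E2 *.
set I3 := CRint _ _ _ in E3 *; set I4 := CRint _ _ _ in E4 *.
set D1 := (I1 - _)%C in E1; set D2 := (I2 - _)%C in E2.
set D3 := (I3 - _)%C in E3; set D4 := (I4 - _)%C in E4.
have -> : (I1 + I2 - I3 - I4 = D1 + D2 + (- D3 + - D4))%C by rewrite /D1 /D2 /D3 /D4; ring.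
apply: Rle_trans (Cmod_triangle _ _) _.
have := Cmod_triangle D1 D2; have := Cmod_triangle (- D3) (- D4); rewrite !Cmod_opp.
have : 4 * (h * M) <= e * h ^ 2.
  have -> : 4 * (h * M) = e * h ^ 2 * (B / (B + 1)) by rewrite /M /e'; field; lra.
  rewrite -[X in _ <= X]Rmult_1_r; apply: Rmult_le_compat_l.
    by apply: Rmult_le_pos; [lra | apply: pow2_ge_0].
  by apply/Rle_div_l; lra.
move: E1 E2 E3 E4; rewrite !(Rplus_comm _ h) /Rminus !Rplus_assoc !Rplus_opp_r !Rplus_0_r; lra.
Qed.

(** * Taylor coefficients as contour integrals *)

Definition pt (x y : R) : C := (x, y).

Lemma CRint_ext f g a b : (forall x, f x = g x) -> CRint f a b = CRint g a b.
Proof. by move=> fg; apply: (RInt_ext (V := CR) f g a b) => x _; apply: fg. Qed.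

Lemma cder_Cexp_lin (a : C) u : cder (fun u => Cexp (a * u)) u (a * Cexp (a * u))%C.
Proof.
have d := cder_scal a (cder_id u).
by apply: cder_eq (cder_comp d (cder_Cexp _)) _; ring.
Qed.

Lemma Cexp_nat_2pi n x : Cexp (RtoC (INR n) * pt x (2 * PI)) = Cexp (RtoC (INR n) * pt x 0).
Proof.
rewrite -!Cexp_pow; congr Cpow; rewrite /Cexp /= cos_0 sin_0.
by rewrite cos_2PI sin_2PI.
Qed.

Lemma Cexp_pair_2pi x : Cexp (pt x (2 * PI)) = Cexp (pt x 0).
Proof. by have := Cexp_nat_2pi 1 x; rewrite !Cmult_1_l. Qed.

Lemma curve_pair (f1 f2 : R -> R) t l1 l2 :
  is_derive f1 t l1 -> is_derive f2 t l2 ->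
  is_derive ((fun s => pt (f1 s) (f2 s)) : R -> CR) t (pt l1 l2).
Proof.
move=> /is_derive_remainder H1 /is_derive_remainder H2; apply/curve_remainder => e e0.
case: (H1 (e / 2)) => [|d1 [d10 D1]]; first lra.
case: (H2 (e / 2)) => [|d2 [d20 D2]]; first lra.
exists (Rmin d1 d2); split; first exact: Rmin_glb_lt.
move=> s hs.
have b1 : Rabs (f1 s - f1 t - (s - t) * l1) <= e / 2 * Rabs (s - t).
  by apply: D1; apply: Rlt_le_trans hs (Rmin_l _ _).
have b2 : Rabs (f2 s - f2 t - (s - t) * l2) <= e / 2 * Rabs (s - t).
  by apply: D2; apply: Rlt_le_trans hs (Rmin_r _ _).
apply: Rle_trans (Cmod_le_abs _) _.
have -> : Re (pt (f1 s) (f2 s) - pt (f1 t) (f2 t) - RtoC (s - t) * pt l1 l2) = f1 s - f1 t - (s - t) * l1.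
  by rewrite /=; ring.
have -> : Im (pt (f1 s) (f2 s) - pt (f1 t) (f2 t) - RtoC (s - t) * pt l1 l2) = f2 s - f2 t - (s - t) * l2.
  by rewrite /=; ring.
lra.
Qed.

Lemma rcont_pair (f1 f2 : R -> R) t :
  continuity_pt f1 t -> continuity_pt f2 t -> rcont (fun s => pt (f1 s) (f2 s)) t.
Proof.
move=> /rcont_RtoC c1 /rcont_RtoC c2.
have c := rcont_plus c1 (rcont_mult c2 (rcont_const Ci t)).
have E x y : (RtoC x + RtoC y * Ci = pt x y)%C.
  by rewrite /pt /Cplus /Cmult /=; congr pair; ring.
by move=> e /c [d [d0 H]]; exists d; split=> // s /H; rewrite !E.
Qed.

(** In the coordinate [u = log z] the terms of degree [j < n] become multiples of
    [exp ((j - n) u)], which have periodic primitives.  On a small circle only the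
    coefficient [h n] and the Taylor remainder survive. *)
Lemma circle_integral (H : C -> C) (h : nat -> C) n :
  taylor H h -> exists M x0, 0 <= M /\ forall x, x < x0 ->
    (forall y, 0 <= y <= 1 -> ccont H (Cexp (pt x (2 * PI * y)))) ->
    Cmod (CRint (fun y => H (Cexp (pt x (2 * PI * y))) * Cexp (- (RtoC (INR n) * pt x (2 * PI * y))) * pt 0 (2 * PI))%C 0 1
          - h n * pt 0 (2 * PI)) <= M * exp x.
Proof.
move=> T; case: (T n.+1) => M [d [M0 d0 HT]].
have pi0 := PI_RGT_0.
exists (M * (2 * PI)), (ln d); split; first by apply: Rmult_le_pos; lra.
move=> x hx cH.
pose g y : C := pt x (2 * PI * y).
pose q u : C := (H (Cexp u) * Cexp (- (RtoC (INR n) * u)))%C.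
pose a (j : 'I_n) : C := RtoC (INR j - INR n).
have an0 j : a j <> RtoC 0.
  move=> /RtoC_inj; have : INR j < INR n by apply: lt_INR; apply/ltP.
  lra.
pose lin u : C := (h n + \csum_(j < n) (h j * Cexp (a j * u)))%C.
pose Q u : C := (h n * u + \csum_(j < n) (h j / a j * Cexp (a j * u)))%C.
have dsum (c : 'I_n -> C) u : cder (fun u => \csum_(j < n) (c j * Cexp (a j * u)))%C u
    (\csum_(j < n) (c j * (a j * Cexp (a j * u))))%C.
  by apply: cder_csum => j _; apply: cder_scal (cder_Cexp_lin (a j) u).
have dQ u : cder Q u (lin u).
  have D := cder_plus (cder_scal (h n) (cder_id u)) (dsum (fun j => h j / a j)%C u).
  apply: cder_eq D _; rewrite Cmult_1_r /lin; congr (_ + _)%C.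
  by apply: eq_bigr => j _; field.
have dlin u : ccont lin u.
  have := cder_plus (cder_const (h n) u) (dsum (fun j => h j) u).
  by move/cder_cont.
have dg y : is_derive (g : R -> CR) y (pt 0 (2 * PI)).
  apply: curve_pair; first exact: is_derive_const.
  by auto_derive => //; ring.
have e2 : (Q (g 1%R) - Q (g 0%R) = h n * pt 0 (2 * PI))%C.
  have per j : Cexp (a j * g 1%R) = Cexp (a j * g 0%R).
    rewrite /a RtoC_minus /g Rmult_1_r Rmult_0_r /Cminus !Cmult_plus_distr_r !Cexp_add.
    rewrite Cexp_nat_2pi; congr (_ * _)%C.
    have E w : (- RtoC (INR n) * w = - (RtoC (INR n) * w))%C by ring.
    by rewrite !E !Cexp_inv Cexp_nat_2pi.
  rewrite /Q; under eq_bigr => j _ do rewrite per.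
  set S := (\csum_(j < n) _)%C; rewrite /g Rmult_1_r Rmult_0_r.
  transitivity (h n * (pt x (2 * PI) - pt x 0))%C; first by ring.
  by congr (_ * _)%C; rewrite /pt /Cminus /Cplus /=; congr pair; ring.
rewrite -e2.
have := @edge_estimate q lin Q g (fun=> pt 0 (2 * PI)) 0 1 (M * (2 * PI) * exp x).
rewrite Rminus_0_r Rmult_1_l; apply=> //; first lra.
- by move=> y; apply: rcont_const.
- move=> y hy; apply: ccont_mult.
    apply: ccont_comp (cH y hy); exact: cder_cont (cder_Cexp _).
  have := cder_cont (cder_Cexp_lin (- RtoC (INR n)) (g y)).
  by apply: ccont_ext => w; congr Cexp; ring.
move=> y _; rewrite Cmod_mult.
have m2 : Cmod (pt 0 (2 * PI)) = 2 * PI.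
  rewrite Cmod_ReIm /= (_ : 0 * (0 * 1) + _ = (2 * PI) * (2 * PI)); last by ring.
  by apply: sqrt_square; lra.
rewrite m2 (_ : M * (2 * PI) * exp x = M * exp x * (2 * PI)); last by ring.
apply: Rmult_le_compat_r; first lra.
set u := g y; set z := Cexp u.
have cz : Cmod z = exp x by rewrite Cmod_Cexp.
have := HT z; rewrite cz => /(_ _) h1.
have {}h1 := h1 ltac:(rewrite -(exp_ln d) //; exact: exp_increasing).
have zn : (z ^ n * Cexp (- (RtoC (INR n) * u)) = 1)%C by rewrite Cexp_pow Cexp_opp.
have -> : (q u - lin u = (H z - \csum_(j < n.+1) (h j * z ^ j)) * Cexp (- (RtoC (INR n) * u)))%C.
  rewrite /q -/z big_ord_recr /=.
  have -> : ((H z - (\csum_(j < n) (h j * z ^ j) + h n * z ^ n)) * Cexp (- (RtoC (INR n) * u)) =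
     H z * Cexp (- (RtoC (INR n) * u)) - Cexp (- (RtoC (INR n) * u)) * (\csum_(j < n) (h j * z ^ j))
      - h n * (z ^ n * Cexp (- (RtoC (INR n) * u))))%C by ring.
  rewrite zn csum_mull /lin.
  have -> : (\csum_(j < n) (Cexp (- (RtoC (INR n) * u)) * (h j * z ^ j)) =
     \csum_(j < n) (h j * Cexp (a j * u)))%C.
    apply: eq_bigr => j _; rewrite Cexp_pow /a RtoC_minus.
    rewrite (_ : (RtoC (INR j) - RtoC (INR n)) * u = RtoC (INR j) * u + - (RtoC (INR n) * u))%C; last by ring.
    by rewrite Cexp_add; ring.
  by ring.
rewrite Cmod_mult; have -> : Cmod (Cexp (- (RtoC (INR n) * u))) = / exp x ^ n.
  rewrite Cexp_inv Cmod_inv; last exact: Cexp_neq0.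
  by rewrite -Cexp_pow Cmod_pow Cmod_Cexp.
apply: Rle_trans (Rmult_le_compat_r _ _ _ _ h1) _.
  by apply/Rlt_le/Rinv_0_lt_compat/pow_lt/exp_pos.
apply: Req_le; rewrite /=; field; apply: pow_nonzero.
by have := exp_pos x; lra.
Qed.

(** A Taylor coefficient is controlled by the integral of the function over any
    contour [|z| = exp (L (arg z))] that can be retracted radially to [0] inside
    the domain of holomorphy: [goursat_square] applies to the annulus between the
    contour and a small circle, cut along a radius. *)
Lemma coef_bound (H : C -> C) (h : nat -> C) n (L dL m : R -> R) K BI :
  taylor H h ->
  (forall y, is_derive L y (dL y)) -> (forall y, continuity_pt dL y) ->
  (forall y, Rabs (dL y) <= K) -> L (2 * PI) = L 0 ->
  (forall x y, 0 <= y <= 2 * PI -> x <= L y -> exists l, cder H (Cexp (pt x y)) l) ->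
  (forall y, 0 <= y <= 2 * PI ->
     Cmod (H (Cexp (pt (L y) y))) * exp (- (INR n * L y)) * (Rabs (dL y) + 1) <= m y) ->
  is_RInt m 0 (2 * PI) BI ->
  2 * PI * Cmod (h n) <= BI.
Proof.
move=> T dLP cdL KP per hol bnd IB.
have pi0 := PI_RGT_0.
have K0 : 0 <= K by have := KP 0; have := Rabs_pos (dL 0); lra.
have lip y y' : Rabs (L y - L y') <= K * Rabs (y - y').
  apply: (@bounded_variation L dL K y' y) => t _; split; [exact: dLP | exact: KP].
pose A := Rabs (L 0) + K * (2 * PI).
have LA y : 0 <= y <= 2 * PI -> Rabs (L y) <= A.
  move=> hy; have := lip y 0; rewrite Rminus_0_r (Rabs_pos_eq y); last lra.
  have := Rabs_triang (L y - L 0) (L 0); rewrite (_ : L y - L 0 + L 0 = L y); last by ring.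
  rewrite /A; have : K * y <= K * (2 * PI) by apply: Rmult_le_compat_l; lra.
  lra.
case: (circle_integral n T) => M [x0 [M0 hc]].
suff small e : 0 < e -> 2 * PI * Cmod (h n) <= BI + e by apply: le_epsilon.
move=> e0.
pose l0 := Rmin (Rmin (- A - 1) (x0 - 1)) (ln (e / (M + 1))).
have l1 : l0 <= - A - 1 by apply: Rle_trans (Rmin_l _ _) (Rmin_l _ _).
have l2 : l0 < x0.
  by have : l0 <= x0 - 1; [apply: Rle_trans (Rmin_l _ _) (Rmin_r _ _) | lra].
have l3 : M * exp l0 <= e.
  have p : 0 < e / (M + 1) by apply: Rdiv_lt_0_compat; lra.
  have : exp l0 <= e / (M + 1) by rewrite -(exp_ln _ p); apply: exp_mono; apply: Rmin_r.
  have := exp_pos l0 => ep h1.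
  have : (M + 1) * exp l0 <= (M + 1) * (e / (M + 1)) by apply: Rmult_le_compat_l; lra.
  rewrite (_ : (M + 1) * (e / (M + 1)) = e); last by field; lra.
  lra.
have {hc} hc := hc l0 l2.
(* the square is mapped onto the annulus between the small circle, at [x = 0],
   and the contour, at [x = 1] *)
pose F (x y : R) : C := pt (l0 + x * (L (2 * PI * y) - l0)) (2 * PI * y).
pose Fs (x y : R) : C := pt (L (2 * PI * y) - l0) 0.
pose Ft (x y : R) : C := pt (x * (2 * PI * dL (2 * PI * y))) (2 * PI).
pose q u : C := (H (Cexp u) * Cexp (- (RtoC (INR n) * u)))%C.
have rg y : 0 <= y <= 1 -> 0 <= 2 * PI * y <= 2 * PI by nra.
have Fdom x y : 0 <= x <= 1 -> 0 <= y <= 1 -> exists l, cder q (F x y) l.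
  move=> hx hy; have [l hl] : exists l, cder H (Cexp (F x y)) l.
    apply: hol; first exact: rg.
    have /Rabs_le_between := LA _ (rg y hy); nra.
  have dn : cder (fun u => Cexp (- (RtoC (INR n) * u)))%C (F x y)
      (- RtoC (INR n) * Cexp (- RtoC (INR n) * F x y))%C.
    by apply: cder_ext (cder_Cexp_lin _ _) => w; congr Cexp; ring.
  exists (l * Cexp (F x y) * Cexp (- (RtoC (INR n) * F x y)) +
    H (Cexp (F x y)) * (- RtoC (INR n) * Cexp (- RtoC (INR n) * F x y)))%C.
  exact: cder_mult (cder_comp (cder_Cexp _) hl) dn.
have dL2 y : is_derive (fun y => L (2 * PI * y)) y (2 * PI * dL (2 * PI * y)).
  have d1 : is_derive (fun y => 2 * PI * y) y (2 * PI) by auto_derive => //; ring.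
  exact: (is_derive_comp L (fun y => 2 * PI * y) y _ _ (dLP _) d1).
have dFs x y : is_derive ((fun x => F x y) : R -> CR) x (Fs x y).
  apply: curve_pair; last exact: is_derive_const.
  by auto_derive => //; ring.
have dFt x y : is_derive ((fun y => F x y) : R -> CR) y (Ft x y).
  apply: curve_pair; last by auto_derive => //; ring.
  have D := is_derive_scal (fun y => L (2 * PI * y)) y x _ (dL2 y).
  apply: (is_derive_ext (fun y => plus (l0 - x * l0) (x * L (2 * PI * y)))) => [t|].
    by rewrite /plus /=; ring.
  have := is_derive_plus _ _ _ _ _ (is_derive_const (l0 - x * l0) y) D.
  by rewrite plus_zero_l.
have cFs x y : rcont (fun x => Fs x y) x by apply: rcont_const.
have cFt x y : rcont (fun y => Ft x y) y.
  apply: rcont_pair; last exact: continuity_pt_const.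
  have c2 : continuity_pt (fun y => dL (2 * PI * y)) y.
    apply: (continuity_pt_comp (fun y => 2 * PI * y)); last exact: cdL.
    by apply: derivable_continuous_pt; exists (2 * PI); apply/is_derive_Reals; auto_derive => //; ring.
  apply: (@continuity_pt_ext (fun y => (x * (2 * PI)) * dL (2 * PI * y))) => [t|]; first by ring.
  exact: continuity_pt_scal.
pose B := (A + Rabs l0) + 2 * PI * K + 2 * PI.
have B2 := Rabs_pos l0.
have B3 : 0 <= 2 * PI * K by apply: Rmult_le_pos; lra.
have B1 : 0 <= A by rewrite /A; have := Rabs_pos (L 0); lra.
have hFs x y : 0 <= y <= 1 -> Cmod (Fs x y) <= A + Rabs l0.
  move=> hy; apply: Rle_trans (Cmod_le_abs _) _; rewrite /= Rabs_R0 Rplus_0_r.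
  have := LA _ (rg y hy); have := Rabs_triang (L (2 * PI * y)) (- l0); rewrite Rabs_Ropp /Rminus; lra.
have G0 : boundary q F Fs Ft 0 0 1 = RtoC 0.
  apply: (@goursat_square q F Fs Ft B) => //.
    move=> x y x' y' hx hy hx' hy'; apply: Rle_trans (Cmod_le_abs _) _.
    have -> : Re (F x y - F x' y') = x * (L (2 * PI * y) - L (2 * PI * y')) + (x - x') * (L (2 * PI * y') - l0).
      by rewrite /F /=; ring.
    have -> : Im (F x y - F x' y') = 2 * PI * (y - y') by rewrite /F /=; ring.
    apply: (@Rle_trans _ ((2 * PI * K) * Rabs (y - y') + (A + Rabs l0) * Rabs (x - x') + 2 * PI * Rabs (y - y'))).
      apply: Rplus_le_compat; last by rewrite Rabs_mult Rabs_pos_eq; lra.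
      apply: Rle_trans (Rabs_triang _ _) _; rewrite !Rabs_mult; apply: Rplus_le_compat.
        have := lip (2 * PI * y) (2 * PI * y'); rewrite -Rmult_minus_distr_l Rabs_mult (Rabs_pos_eq (2 * PI)); last lra.
        have := Rabs_pos (L (2 * PI * y) - L (2 * PI * y')); rewrite (Rabs_pos_eq x); last lra.
        nra.
      rewrite Rmult_comm; apply: Rmult_le_compat_r; first exact: Rabs_pos.
      have := LA _ (rg y' hy'); have := Rabs_triang (L (2 * PI * y')) (- l0); rewrite Rabs_Ropp /Rminus; lra.
    have := Rabs_pos (x - x'); have := Rabs_pos (y - y'); rewrite /B; nra.
  move=> x y hx hy; split; first by have := hFs x y hy; rewrite /B; lra.
  apply: Rle_trans (Cmod_le_abs _) _ => /=.
  have p2 : Rabs (2 * PI) = 2 * PI by apply: Rabs_pos_eq; lra.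
  rewrite p2 Rabs_mult (Rabs_pos_eq x) ?(Rabs_mult (2 * PI)) ?p2; last lra.
  have : x * (2 * PI * Rabs (dL (2 * PI * y))) <= 1 * (2 * PI * K).
    have := KP (2 * PI * y); have := Rabs_pos (dL (2 * PI * y)) => k1 k2.
    apply: Rmult_le_compat; try lra; first by apply: Rmult_le_pos; lra.
    by apply: Rmult_le_compat_l; lra.
  rewrite /B; lra.
(* the two radial sides of the square cancel by periodicity *)
have sides : CRint (fun x => q (F x (0 + 1)%R) * Fs x (0 + 1)%R)%C 0 (0 + 1)
           = CRint (fun x => q (F x 0%R) * Fs x 0%R)%C 0 (0 + 1).
  apply: CRint_ext => x; rewrite /Fs /F Rplus_0_l Rmult_1_r Rmult_0_r per /q.
  by rewrite Cexp_pair_2pi !Cexp_inv Cexp_nat_2pi.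
have E : CRint (fun y => q (F 1 y) * Ft 1 y)%C 0 1 = CRint (fun y => q (F 0 y) * Ft 0 y)%C 0 1.
  move: G0; rewrite /boundary sides !Rplus_0_l => G0.
  set X := CRint _ _ _ in G0; set Y := CRint _ _ _ in G0 *; set Z := CRint _ _ _ in G0 *.
  have -> : Y = (X + Y - X - Z + Z)%C by ring.
  by rewrite G0; ring.
have E0 : CRint (fun y => q (F 0 y) * Ft 0 y)%C 0 1 =
  CRint (fun y => H (Cexp (pt l0 (2 * PI * y))) * Cexp (- (RtoC (INR n) * pt l0 (2 * PI * y))) * pt 0 (2 * PI))%C 0 1.
  by apply: CRint_ext => y; rewrite /q /F /Ft !Rmult_0_l Rplus_0_r.
have C0 : Cmod (CRint (fun y => q (F 0 y) * Ft 0 y)%C 0 1 - h n * pt 0 (2 * PI)) <= M * exp l0.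
  rewrite E0; apply: hc => y hy.
  case: (hol l0 (2 * PI * y) (rg y hy)) => [|l /cder_cont //].
  have /Rabs_le_between := LA _ (rg y hy); lra.
have C1 : Cmod (CRint (fun y => q (F 1 y) * Ft 1 y)%C 0 1) <= BI.
  rewrite -CR_norm.
  have I : is_RInt ((fun y => q (F 1 y) * Ft 1 y)%C : R -> CR) 0 1 (CRint (fun y => q (F 1 y) * Ft 1 y)%C 0 1).
    apply: CRint_correct; first lra.
    move=> y hy; apply: rcont_mult; last exact: cFt.
    apply: (rcont_comp (h := fun y => F 1 y)); first exact: is_derive_rcont (dFt 1 y).
    by case: (Fdom 1 y) => [||l /cder_cont //]; lra.
  apply: (norm_RInt_le _ (fun y => scal (2 * PI) (m (2 * PI * y + 0))) 0 1 _ BI _ _ I).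
  - lra.
  - move=> y hy; rewrite CR_norm !Cmod_mult.
    have hy' := rg y hy; have := bnd _ hy'.
    have -> : F 1 y = pt (L (2 * PI * y)) (2 * PI * y) by rewrite /F; congr pt; ring.
    rewrite Rplus_0_r /scal /= /mult /=.
    have -> : Cmod (Cexp (- (RtoC (INR n) * pt (L (2 * PI * y)) (2 * PI * y)))) = exp (- (INR n * L (2 * PI * y))).
      by rewrite Cmod_Cexp; congr exp; rewrite re_opp re_scal_l.
    have -> : Cmod (Ft 1 y) = 2 * PI * Cmod (pt (dL (2 * PI * y)) 1).
      rewrite -{1}(Rabs_pos_eq (2 * PI)); last lra.
      rewrite -Cmod_R -Cmod_mult; congr Cmod; rewrite /Ft /pt /Cmult /=; congr pair; ring.
    have : Cmod (pt (dL (2 * PI * y)) 1) <= Rabs (dL (2 * PI * y)) + 1.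
      by apply: Rle_trans (Cmod_le_abs _) _; rewrite /= Rabs_R1; lra.
    set X := Cmod (H _); set Y := exp _; set Z := Cmod _; set V := Rabs _ => h1 h2.
    have X0 : 0 <= X * Y by apply: Rmult_le_pos; [apply: Cmod_ge_0 | apply/Rlt_le/exp_pos].
    rewrite (_ : X * Y * (2 * PI * Z) = 2 * PI * (X * Y * Z)); last by ring.
    apply: Rmult_le_compat_l; first lra.
    apply: Rle_trans h2; exact: Rmult_le_compat_l.
  - apply: (is_RInt_comp_lin m (2 * PI) 0 0 1).
    by rewrite Rmult_0_r !Rplus_0_r Rmult_1_r.
have m2 : Cmod (h n * pt 0 (2 * PI)) = 2 * PI * Cmod (h n).
  rewrite Cmod_mult Rmult_comm; congr (_ * _).
  rewrite Cmod_ReIm /= (_ : 0 * (0 * 1) + _ = (2 * PI) * (2 * PI)); last by ring.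
  by apply: sqrt_square; lra.
have t := Cmod_ge_sub (h n * pt 0 (2 * PI)) (CRint (fun y => q (F 1 y) * Ft 1 y)%C 0 1).
rewrite -m2; rewrite -E Cmod_sub_rev in C0; lra.
Qed.

(** * Contours that avoid several singular points *)

HB.instance Definition _ :=
  Monoid.isComLaw.Build R 0 Rplus (fun x y z => esym (Rplus_assoc x y z)) Rplus_comm Rplus_0_l.
HB.instance Definition _ :=
  Monoid.isComLaw.Build R 1 Rmult (fun x y z => esym (Rmult_assoc x y z)) Rmult_comm Rmult_1_l.

Lemma Rprod_gt0 (I : Type) (s : seq I) (Q : pred I) (F : I -> R) :
  (forall i, Q i -> 0 < F i) -> 0 < \big[Rmult/1]_(i <- s | Q i) F i.
Proof. by move=> H; apply: big_ind => //; [lra | exact: Rmult_lt_0_compat]. Qed.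

Lemma Rprod_le (I : Type) (s : seq I) (Q : pred I) (F G : I -> R) :
  (forall i, Q i -> 0 <= F i <= G i) ->
  \big[Rmult/1]_(i <- s | Q i) F i <= \big[Rmult/1]_(i <- s | Q i) G i.
Proof.
move=> H; suff : 0 <= \big[Rmult/1]_(i <- s | Q i) F i <= \big[Rmult/1]_(i <- s | Q i) G i by lra.
apply: (big_ind2 (fun x y => 0 <= x <= y)) => //; first lra.
move=> x1 x2 y1 y2 h1 h2; split; first by apply: Rmult_le_pos; lra.
by apply: Rmult_le_compat; lra.
Qed.

Lemma Rprod_le1 (I : Type) (s : seq I) (Q : pred I) (F : I -> R) :
  (forall i, Q i -> 0 <= F i <= 1) -> \big[Rmult/1]_(i <- s | Q i) F i <= 1.
Proof.
by move=> H; have := @Rprod_le I s Q F (fun=> 1) H; rewrite [X in _ <= X]big1.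
Qed.

Lemma Rprod_mult (I : Type) (s : seq I) (F G : I -> R) :
  \big[Rmult/1]_(i <- s) (F i * G i) =
  \big[Rmult/1]_(i <- s) F i * \big[Rmult/1]_(i <- s) G i.
Proof. exact: big_split. Qed.

Lemma Rsum_ge_term (I : finType) (F : I -> R) i :
  (forall j, 0 <= F j) -> F i <= \big[Rplus/0]_(j : I) F j.
Proof.
move=> H; rewrite (bigD1 i) //=.
have : 0 <= \big[Rplus/0]_(j | j != i) F j.
  by apply: big_ind => //; [lra | move=> x y; lra].
lra.
Qed.

Lemma Rabs_sin_le1 x : Rabs (sin x) <= 1.
Proof. by apply: Rabs_le; have := SIN_bound x; lra. Qed.

Lemma sqrt_sqr_add_ge x y : Rabs x <= sqrt (y ^ 2 + x ^ 2).
Proof.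
rewrite -sqrt_Rsqr_abs Rsqr_pow2; apply: sqrt_le_1_alt.
have := pow2_ge_0 y; lra.
Qed.

Section Contour.
Variables (I : finType) (th : I -> R).

(** Up to a constant factor, [cw e i y] is the distance from [exp (i y)] to the
    [i]-th singular point, smoothed at scale [e]; the product [cW] does the same
    for the product of the distances. *)
Definition cw (e : R) (i : I) (y : R) : R := sqrt (e ^ 2 + sin ((y - th i) / 2) ^ 2).
Definition cW (e y : R) : R := \big[Rmult/1]_(i : I) cw e i y.

Lemma cw_ge_eps e i y : 0 < e -> e <= cw e i y.
Proof.
move=> e0; have := sqrt_sqr_add_ge e (sin ((y - th i) / 2)).
by rewrite Rplus_comm Rabs_pos_eq //; lra.
Qed.

Lemma cw_gt0 e i y : 0 < e -> 0 < cw e i y.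
Proof. by move=> e0; have := cw_ge_eps i y e0; lra. Qed.

Lemma cw_ge_sin e i y : Rabs (sin ((y - th i) / 2)) <= cw e i y.
Proof. exact: sqrt_sqr_add_ge. Qed.

Lemma cw_le_add e i y : 0 < e -> cw e i y <= e + Rabs (sin ((y - th i) / 2)).
Proof.
move=> e0; set s := sin _; have s0 := Rabs_pos s.
rewrite -(sqrt_pow2 (e + Rabs s)); last lra.
apply: sqrt_le_1_alt; rewrite -(pow2_abs s); nra.
Qed.

Lemma cw_le2 e i y : 0 < e <= 1 -> cw e i y <= 2.
Proof.
move=> [e0 e1]; have := cw_le_add i y e0.
have := Rabs_sin_le1 ((y - th i) / 2); lra.
Qed.

Lemma cw_sqr e i y : cw e i y ^ 2 = e ^ 2 + sin ((y - th i) / 2) ^ 2.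
Proof.
apply: pow2_sqrt; have := pow2_ge_0 e; have := pow2_ge_0 (sin ((y - th i) / 2)); lra.
Qed.

Lemma cW_gt0 e y : 0 < e -> 0 < cW e y.
Proof. by move=> e0; apply: Rprod_gt0 => i _; apply: cw_gt0. Qed.

Lemma cW_le_cw : exists B, 0 < B /\ forall e y i, 0 < e <= 1 -> cW e y <= B * cw e i y.
Proof.
exists (\big[Rmult/1]_(i : I) 2); split; first by apply: Rprod_gt0 => i _; lra.
move=> e y i he; rewrite /cW (bigD1 i) //= Rmult_comm.
apply: Rmult_le_compat_r; first by apply/Rlt_le/cw_gt0; lra.
rewrite [X in _ <= X](bigD1 i) //=.
have : \big[Rmult/1]_(j | j != i) cw e j y <= \big[Rmult/1]_(j | j != i) 2.
  apply: Rprod_le => j _; split; last exact: cw_le2.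
  by apply/Rlt_le/cw_gt0; lra.
have : 0 < \big[Rmult/1]_(j : I | j != i) 2 by apply: Rprod_gt0 => j _; lra.
lra.
Qed.

Lemma cw_derive e i y : 0 < e -> is_derive (cw e i) y
  (sin ((y - th i) / 2) * cos ((y - th i) / 2) / 2 / cw e i y).
Proof.
move=> e0; have p := cw_gt0 i y e0; have sq := cw_sqr e i y.
rewrite /cw in p sq *.
auto_derive.
  have := pow2_ge_0 (sin ((y - th i) / 2)); have := pow_lt e 2 e0.
  rewrite /Rminus /Rdiv /= => h1 h2; repeat split => //.
  by move: h1 h2; lra.
rewrite /Rdiv /Rminus /=; move: p; rewrite /Rdiv /Rminus /= => p.
field; lra.
Qed.

Lemma cw_derive_cont e i y : 0 < e ->
  continuity_pt (fun y => sin ((y - th i) / 2) * cos ((y - th i) / 2) / 2 / cw e i y) y.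
Proof.
move=> e0; have p := cw_gt0 i y e0.
have c1 : continuity_pt (fun y => sin ((y - th i) / 2) * cos ((y - th i) / 2) / 2) y.
  apply: derivable_continuous_pt; eexists; apply/is_derive_Reals; auto_derive => //; reflexivity.
apply: continuity_pt_div => //; last lra.
apply: derivable_continuous_pt; eexists; apply/is_derive_Reals; exact: cw_derive.
Qed.

Lemma cw_derive_bound e i y : 0 < e ->
  Rabs (sin ((y - th i) / 2) * cos ((y - th i) / 2) / 2 / cw e i y) <= 1.
Proof.
move=> e0; have p := cw_gt0 i y e0; have q := cw_ge_sin e i y.
rewrite Rabs_div; last lra.
rewrite (Rabs_pos_eq (cw e i y)); last lra.
apply/Rle_div_l => //; rewrite Rmult_1_l /Rdiv !Rabs_mult (Rabs_pos_eq (/ 2)); last lra.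
have c : Rabs (cos ((y - th i) / 2)) <= 1.
  by apply: Rabs_le; have := COS_bound ((y - th i) / 2); lra.
have := Rabs_pos (sin ((y - th i) / 2)); have := Rabs_pos (cos ((y - th i) / 2)).
rewrite /Rdiv in c q *; nra.
Qed.

(** At all scales [e <= 1] the smoothed distances and their derivatives are
    bounded, so the Lipschitz constant of the contour does not depend on [e]. *)
Lemma cW_derive_seq (s : seq I) : exists K, 0 <= K /\ forall e, 0 < e <= 1 ->
  exists d : R -> R, [/\ forall y, is_derive (fun y => \big[Rmult/1]_(i <- s) cw e i y) y (d y),
    forall y, continuity_pt d y & forall y, Rabs (d y) <= K].
Proof.
elim: s => [|i s [K [K0 IH]]].
  exists 0; split=> [|e _]; first lra.
  exists (fun=> 0); split=> y; last by rewrite Rabs_R0; lra.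
    apply: (is_derive_ext (fun=> 1)); first by move=> t; rewrite big_nil.
    exact: is_derive_const.
  exact: continuity_pt_const.
exists (\big[Rmult/1]_(j <- s) 2 + 2 * K).
have B0 : 0 < \big[Rmult/1]_(j <- s) 2 by apply: Rprod_gt0 => j _; lra.
split=> [|e he]; first lra.
case: (IH e he) => d [d1 d2 d3]; have e0 : 0 < e by lra.
pose di y := sin ((y - th i) / 2) * cos ((y - th i) / 2) / 2 / cw e i y.
pose P y := \big[Rmult/1]_(j <- s) cw e j y.
exists (fun y => di y * P y + cw e i y * d y); split=> y.
- apply: (is_derive_ext (fun y => cw e i y * P y)); first by move=> t; rewrite big_cons.
  apply: (is_derive_mult (cw e i) P y (di y) (d y)); [exact: cw_derive | exact: d1 |].
  by move=> *; apply: Rmult_comm.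
- apply: continuity_pt_plus; apply: continuity_pt_mult => //; first exact: cw_derive_cont.
    by apply: derivable_continuous_pt; exists (d y); apply/is_derive_Reals; apply: d1.
  by apply: derivable_continuous_pt; eexists; apply/is_derive_Reals; apply: cw_derive.
- apply: Rle_trans (Rabs_triang _ _) _; rewrite (Rabs_mult (di y)) (Rabs_mult (cw e i y)).
  have P0 : 0 < P y by apply: Rprod_gt0 => j _; apply: cw_gt0.
  have PB : P y <= \big[Rmult/1]_(j <- s) 2.
    apply: Rprod_le => j _; split; [exact/Rlt_le/cw_gt0 | exact: cw_le2].
  have c0 := cw_gt0 i y e0; have c2 := cw_le2 i y he.
  rewrite (Rabs_pos_eq (P y)) ?(Rabs_pos_eq (cw e i y)); try lra.
  apply: Rplus_le_compat; last by apply: Rmult_le_compat; try exact: Rabs_pos; try exact: d3; lra.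
  rewrite -[X in _ <= X]Rmult_1_l; apply: Rmult_le_compat; try exact: Rabs_pos; try exact: cw_derive_bound; lra.
Qed.

Lemma cW_period e : cW e (2 * PI) = cW e 0.
Proof.
apply: eq_bigr => i _; rewrite /cw (_ : (2 * PI - th i) / 2 = (0 - th i) / 2 + PI); last by field.
by rewrite neg_sin; congr sqrt; ring.
Qed.

Hypothesis sep : forall i j, i != j -> sin ((th i - th j) / 2) <> 0.

(** A point close to two singular points would make these close to each other, by
    the addition formula for the sine. *)
Lemma sin_separated : exists m, 0 < m <= 1 /\ forall y i j, i != j ->
  m <= Rabs (sin ((y - th i) / 2)) \/ m <= Rabs (sin ((y - th j) / 2)).
Proof.
pose f (p : I * I) := if p.1 == p.2 then 1 else Rabs (sin ((th p.1 - th p.2) / 2)) / 2.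
have fp p : 0 < f p <= 1.
  rewrite /f; case: eqP => [_|/eqP n]; first lra.
  have := Rabs_sin_le1 ((th p.1 - th p.2) / 2); have := Rabs_pos_lt _ (sep n); lra.
exists (\big[Rmult/1]_(p : I * I) f p); split.
  split; first by apply: Rprod_gt0 => p _; case: (fp p).
  by apply: Rprod_le1 => p _; have := fp p; lra.
move=> y i j nij.
have le : \big[Rmult/1]_(p : I * I) f p <= f (i, j).
  rewrite (bigD1 (i, j)) // -[X in _ <= X]Rmult_1_r.
  apply: Rmult_le_compat_l; first by have := fp (i, j); lra.
  by apply: Rprod_le1 => p _; have := fp p; lra.
have fij : f (i, j) = Rabs (sin ((th i - th j) / 2)) / 2 by rewrite /f /= (negbTE nij).
rewrite fij in le.
set a := (y - th j) / 2; set b := (y - th i) / 2.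
have E : sin ((th i - th j) / 2) = sin a * cos b - cos a * sin b.
  by rewrite -sin_minus; congr sin; rewrite /a /b; field.
have : Rabs (sin ((th i - th j) / 2)) <= Rabs (sin a) + Rabs (sin b).
  rewrite E; apply: Rle_trans (Rabs_triang _ _) _; rewrite Rabs_Ropp !Rabs_mult.
  have ca : Rabs (cos a) <= 1 by apply: Rabs_le; have := COS_bound a; lra.
  have cb : Rabs (cos b) <= 1 by apply: Rabs_le; have := COS_bound b; lra.
  have := Rabs_pos (sin a); have := Rabs_pos (sin b); nra.
case: (Rle_lt_dec (\big[Rmult/1]_(p : I * I) f p) (Rabs (sin b))) => h; [by left | right; lra].
Qed.

(** All factors but the one of the nearest singular point are bounded below. *)
Lemma cW_ge_cw : I -> exists c, 0 < c <= 1 /\ forall e y, 0 < e <= 1 ->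
  exists i, c * cw e i y <= cW e y.
Proof.
move=> i0; case: sin_separated => m [hm mP].
exists (\big[Rmult/1]_(i : I) m); split.
  split; first by apply: Rprod_gt0 => i _; lra.
  by apply: Rprod_le1 => i _; lra.
move=> e y he; have e0 : 0 < e by lra.
have [i iP] : exists i, forall j, j != i -> m <= cw e j y.
  case: (classic (exists i, Rabs (sin ((y - th i) / 2)) < m)) => [[i hi]|no].
    exists i => j nj; apply: Rle_trans (cw_ge_sin e j y).
    by case: (mP y j i nj); lra.
  exists i0 => j _; apply: Rle_trans (cw_ge_sin e j y).
  by case: (Rle_lt_dec m (Rabs (sin ((y - th j) / 2)))) => // h; case: no; exists j.
exists i; rewrite /cW (bigD1 i) //= [X in _ <= X](bigD1 i) //= [X in _ <= X]Rmult_comm.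
apply: Rmult_le_compat_r; first exact/Rlt_le/cw_gt0.
have a1 : \big[Rmult/1]_(j | j != i) m <= \big[Rmult/1]_(j | j != i) cw e j y.
  by apply: Rprod_le => j nj; split; [lra | apply: iP].
have : 0 < \big[Rmult/1]_(j : I | j != i) m by apply: Rprod_gt0 => j _; lra.
nra.
Qed.

(** Summing over all singular points replaces the nearest one, which varies with
    [y], and makes the bound easy to integrate. *)
Lemma cW_inv_sqr : I -> exists c, 0 < c /\ forall e y, 0 < e <= 1 ->
  c * e <= cW e y /\ / cW e y ^ 2 <= / c ^ 2 * \big[Rplus/0]_(i : I) (/ cw e i y ^ 2).
Proof.
move=> i0; case: (cW_ge_cw i0) => c [hc cP]; exists c; split=> [|e y he]; first lra.
have e0 : 0 < e by lra.
case: (cP e y he) => i hi; have g := cw_ge_eps i y e0.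
split; first by apply: Rle_trans hi; apply: Rmult_le_compat_l; lra.
have p : 0 < c * cw e i y by apply: Rmult_lt_0_compat; lra.
apply: (@Rle_trans _ (/ c ^ 2 * / cw e i y ^ 2)).
  rewrite -Rinv_mult -Rpow_mult_distr; apply: Rinv_le_contravar; first exact: pow_lt.
  by apply: pow_incr; lra.
apply: Rmult_le_compat_l; first by apply/Rlt_le/Rinv_0_lt_compat/pow_lt; lra.
apply: (Rsum_ge_term (F := fun i => / cw e i y ^ 2)) => j.
by apply/Rlt_le/Rinv_0_lt_compat/pow_lt/cw_gt0.
Qed.

End Contour.

Lemma Cmod_one_sub_Cexp x p :
  Cmod (1 - Cexp (pt x p)) ^ 2 = (1 - exp x) ^ 2 + 4 * exp x * sin (p / 2) ^ 2.
Proof.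
rewrite Cmod2_alt /=; have := sin2_cos2 p; rewrite /Rsqr => h.
have c := cos_half p.
have -> : 4 * exp x * sin (p / 2) ^ 2 = 2 * exp x * (1 - cos p) by rewrite c; ring.
set a := sin p in h *; set b := cos p in h *; set E := exp x; clearbody a b E.
have h' : a * a = 1 - b * b by lra.
transitivity (1 - 2 * E * b + E * E * (b * b) + E * E * (a * a)); first by ring.
by rewrite h'; ring.
Qed.

Lemma sqr_le_inv a b : 0 <= b -> a ^ 2 <= b ^ 2 -> a <= b.
Proof.
by move=> b0; rewrite -!Rsqr_pow2 => h; apply: Rsqr_incr_0_var.
Qed.

(** [|1 - exp (x + i p)|^2 = (1 - exp x)^2 + 4 exp x sin^2 (p / 2)].  Close to the
    singular point [x] is comparable to [- e]; elsewhere the second summand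
    dominates. *)
Lemma contour_dist e x p : 0 < e <= 1 ->
  - e <= x <= - e + sqrt (e ^ 2 + sin (p / 2) ^ 2) / 4 ->
  sqrt (e ^ 2 + sin (p / 2) ^ 2) / 3 <= Cmod (1 - Cexp (pt x p))
    <= 7 * sqrt (e ^ 2 + sin (p / 2) ^ 2).
Proof.
move=> [e0 e1]; set s := sin (p / 2); set w := sqrt _ => hx.
have s2 : 0 <= s ^ 2 by apply: pow2_ge_0.
have w2 : w ^ 2 = e ^ 2 + s ^ 2 by apply: pow2_sqrt; have := pow2_ge_0 e; lra.
have we : e <= w by apply: sqr_le_inv; [exact: sqrt_pos | lra].
have w22 : w <= 2.
  apply: sqr_le_inv; first lra.
  have := Rabs_sin_le1 (p / 2); rewrite -/s => /Rabs_le_between; rewrite w2; nra.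
have E1 := exp_ineq1_le x; have E2 := @exp_le_inv x ltac:(lra).
have ep := exp_pos x.
have E3 : exp x <= 2.
  by apply: Rle_trans E2 _; rewrite -(Rinv_inv 2); apply: Rinv_le_contravar; lra.
have E4 : / 3 <= exp x.
  rewrite -(Rinv_inv (exp x)) -exp_Ropp; apply: Rinv_le_contravar; first exact: exp_pos.
  by apply: Rle_trans exp_le_3; apply: exp_mono; lra.
have F := Cmod_one_sub_Cexp x p; rewrite -/s in F; have C0 := Cmod_ge_0 (1 - Cexp (pt x p)).
set U := Cmod _ in F C0 *; set E := exp x in E1 E2 E3 E4 ep F; clearbody E U.
have up : E - 1 <= w.
  case: (Rle_lt_dec x 0) => x0.
    have : / (1 - x) <= 1 by rewrite -Rinv_1; apply: Rinv_le_contravar; lra.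
    lra.
  have : / (1 - x) <= 1 + 2 * x.
    by apply: (Rmult_le_reg_l (1 - x)); [lra | rewrite Rinv_r; [nra | lra]].
  lra.
split; apply: sqr_le_inv; try lra; rewrite F.
  rewrite /Rdiv Rpow_mult_distr.
  case: (Rle_lt_dec (2 * e) w) => h.
    have : 4 * e ^ 2 <= w ^ 2 by nra.
    have : / 3 * s ^ 2 <= E * s ^ 2 by apply: Rmult_le_compat_r.
    have := pow2_ge_0 (1 - E); lra.
  have hx2 : x <= - e / 2 by lra.
  have : e / 3 <= 1 - E.
    have : / (1 - x) <= / (1 + e / 2) by apply: Rinv_le_contravar; lra.
    have : / (1 + e / 2) <= 1 - e / 3.
      by apply: (Rmult_le_reg_l (1 + e / 2)); [lra | rewrite Rinv_r; [nra | lra]].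
    lra.
  move=> h2; have h3 : (e / 3) ^ 2 <= (1 - E) ^ 2 by apply: pow_incr; lra.
  have : / 3 * s ^ 2 <= E * s ^ 2 by apply: Rmult_le_compat_r.
  have h4 : (e / 3) ^ 2 = e ^ 2 / 9 by field.
  rewrite h4 in h3; have : (/ 3) ^ 2 = / 9 by field.
  move=> ->; lra.
have a1 : (1 - E) ^ 2 <= w ^ 2 by apply: sqr_le_Rabs; rewrite (Rabs_pos_eq w); [apply: Rabs_le; lra | lra].
have a2 : E * s ^ 2 <= 2 * s ^ 2 by apply: Rmult_le_compat_r.
have a3 := pow2_ge_0 e.
have -> : (7 * w) ^ 2 = 49 * w ^ 2 by ring.
lra.
Qed.

Lemma sin_lower t : 0 <= t <= PI / 2 -> t / 6 <= sin t.
Proof.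
move=> [t0 t1]; have p4 := PI_4; have p2 := PI2_1.
have small u : 0 <= u <= 7/10 -> u / 2 <= sin u.
  move=> hu; have /Rabs_le_between := sin_sub_bound u; rewrite (Rabs_pos_eq u); last lra.
  nra.
case: (Rle_lt_dec t (7/10)) => h; first by have := small t ltac:(lra); lra.
have := small (7/10) ltac:(lra); have := sin_incr_1 (7/10) t; lra.
Qed.

Lemma sin_half_sqr_lower u : Rabs u <= PI -> u ^ 2 / 144 <= sin (u / 2) ^ 2.
Proof.
move=> hu; have P v : 0 <= v <= PI -> v ^ 2 / 144 <= sin (v / 2) ^ 2.
  move=> hv; have h := @sin_lower (v / 2) ltac:(lra).
  rewrite (_ : v ^ 2 / 144 = (v / 2 / 6) ^ 2); last by field.
  by apply: pow_incr; lra.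
have /Rabs_le_between hu' := hu.
case: (Rle_lt_dec 0 u) => u0; first by apply: P; lra.
have := P (- u) ltac:(lra).
rewrite (_ : - u / 2 = - (u / 2)); last by field.
rewrite sin_neg; lra.
Qed.

Lemma is_RInt_cauchy e v a b : 0 < e -> a <= b ->
  is_RInt (fun y => / (e ^ 2 + (y + v) ^ 2)) a b (atan ((b + v) / e) / e - atan ((a + v) / e) / e).
Proof.
move=> e0 ab.
apply: (is_RInt_derive (fun y => atan ((y + v) / e) / e)) => y _.
  have p : 0 < e ^ 2 + (y + v) ^ 2.
    by have := pow_lt e 2 e0; have := pow2_ge_0 (y + v); lra.
  auto_derive; first by lra.
  move: p; set Y := y + v => p.
  have -> : 1 + Y * / e * (Y * / e * 1) = (e ^ 2 + Y ^ 2) / e ^ 2 by field; lra.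
  by field; lra.
apply: (@ex_derive_continuous R_AbsRing R_NormedModule).
have p : e ^ 2 + (y + v) ^ 2 <> 0.
  by have := pow_lt e 2 e0; have := pow2_ge_0 (y + v); lra.
by auto_derive.
Qed.

Lemma cauchy_integral_le e v a b : 0 < e ->
  atan ((b + v) / e) / e - atan ((a + v) / e) / e <= PI / e.
Proof.
move=> e0; have [_ h1] := atan_bound ((b + v) / e); have [h2 _] := atan_bound ((a + v) / e).
set A := atan _ in h1 *; set B := atan _ in h2 *.
rewrite (_ : A / e - B / e = (A - B) / e); last by field; lra.
by apply: Rmult_le_compat_r; [apply/Rlt_le/Rinv_0_lt_compat | lra].
Qed.

(** Since [sin^2 (u / 2) >= u^2 / 144] for [|u| <= pi], the integrand is dominated
    by two Cauchy densities, centred at the two representatives of the angle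
    [th i] that an [y] in [[0, 2 pi]] can be close to. *)
Lemma cw_inv_sqr_integral (I : finType) (th : I -> R) e i : 0 < e <= 1 -> - PI <= th i <= PI ->
  exists m BI, [/\ forall y, 0 <= y <= 2 * PI -> / cw th e i y ^ 2 <= m y,
    is_RInt m 0 (2 * PI) BI & BI <= 288 * PI / e].
Proof.
move=> [e0 e1] hth; have pi0 := PI_RGT_0.
pose f y v := / (e ^ 2 + (y + v) ^ 2).
have pos y v : 0 < e ^ 2 + (y + v) ^ 2.
  by have := pow_lt e 2 e0; have := pow2_ge_0 (y + v); lra.
have I1 := @is_RInt_cauchy e (- th i) 0 (2 * PI) e0 ltac:(lra).
have I2 := @is_RInt_cauchy e (- th i - 2 * PI) 0 (2 * PI) e0 ltac:(lra).
have S := is_RInt_scal _ _ _ 144 _ (is_RInt_plus _ _ _ _ _ _ I1 I2).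
have {}S : is_RInt (fun y => 144 * (f y (- th i) + f y (- th i - 2 * PI))) 0 (2 * PI)
  (144 * ((atan ((2 * PI + - th i) / e) / e - atan ((0 + - th i) / e) / e) +
   (atan ((2 * PI + (- th i - 2 * PI)) / e) / e - atan ((0 + (- th i - 2 * PI)) / e) / e))) by exact: S.
eexists; eexists; split; [ | exact: S | ]; last first.
  have c1 := @cauchy_integral_le e (- th i) 0 (2 * PI) e0.
  have c2 := @cauchy_integral_le e (- th i - 2 * PI) 0 (2 * PI) e0.
  have -> : 288 * PI / e = 144 * (PI / e + PI / e) by field; lra.
  by apply: Rmult_le_compat_l; lra.
move=> y hy; rewrite cw_sqr /f.
have p1 := pos y (- th i); have p2 := pos y (- th i - 2 * PI).
have i1 := Rinv_0_lt_compat _ p1; have i2 := Rinv_0_lt_compat _ p2.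
have key v : sin ((y - th i) / 2) ^ 2 = sin ((y + v) / 2) ^ 2 -> Rabs (y + v) <= PI ->
    / (e ^ 2 + sin ((y - th i) / 2) ^ 2) <= 144 * / (e ^ 2 + (y + v) ^ 2).
  move=> -> /sin_half_sqr_lower h; have p := pos y v.
  have -> : 144 * / (e ^ 2 + (y + v) ^ 2) = / ((e ^ 2 + (y + v) ^ 2) / 144) by field; lra.
  by apply: Rinv_le_contravar; have := pow2_ge_0 e; have := pow2_ge_0 (y + v); lra.
case: (Rle_lt_dec (y - th i) PI) => h.
  by have := key (- th i) erefl ltac:(apply: Rabs_le; lra); lra.
have := key (- th i - 2 * PI) _ ltac:(apply: Rabs_le; lra).
have -> : (y + (- th i - 2 * PI)) / 2 = (y - th i) / 2 - PI by field.
rewrite sin_minus cos_PI sin_PI => k.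
have {}k := k ltac:(ring); lra.
Qed.

Lemma cw_inv_sqr_sum_integral (I : finType) (th : I -> R) : (forall i, - PI <= th i <= PI) ->
  exists A, 0 <= A /\ forall e, 0 < e <= 1 ->
  exists m BI, [/\ forall y, 0 <= y <= 2 * PI -> \big[Rplus/0]_(i : I) (/ cw th e i y ^ 2) <= m y,
    is_RInt m 0 (2 * PI) BI & BI <= A / e].
Proof.
move=> hth; elim: (index_enum I) => [|i s [A [A0 IH]]].
  exists 0; split=> [|e [e0 e1]]; first lra.
  exists (fun=> 0), 0; split; last by rewrite /Rdiv Rmult_0_l; lra.
    by move=> y _; rewrite big_nil; lra.
  have := @is_RInt_const R_NormedModule 0 (2 * PI) 0.
  by rewrite /scal /= /mult /= Rmult_0_r.
have pi0 := PI_RGT_0.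
exists (288 * PI + A); split=> [|e he]; first lra.
case: (IH e he) => m [BI [h1 h2 h3]].
case: (@cw_inv_sqr_integral I th e i he (hth i)) => m' [BI' [h1' h2' h3']].
exists (fun y => m' y + m y), (BI' + BI); split.
- by move=> y hy; rewrite big_cons; have := h1 y hy; have := h1' y hy; lra.
- exact: (is_RInt_plus _ _ _ _ _ _ h2' h2).
- by rewrite Rdiv_plus_distr; lra.
Qed.

Lemma pow_exp_bound p k t0 : 0 < k -> 0 < t0 ->
  exists c, 0 < c /\ forall t, t0 <= t -> Rpower t p * exp (- (k * t)) <= c.
Proof.
move=> k0 t00; case: (Rle_lt_dec 0 p) => hp.
  set d := k / (p + 1); have d0 : 0 < d by apply: Rdiv_lt_0_compat; lra.
  exists (exp (p * (- ln d))); split=> [|t ht]; first exact: exp_pos.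
  rewrite /Rpower -exp_plus; apply: exp_mono.
  have h := exp_ineq1_le (ln (d * t)).
  have dt : 0 < d * t by apply: Rmult_lt_0_compat; lra.
  have ld : ln (d * t) = ln d + ln t by apply: ln_mult; lra.
  rewrite (exp_ln _ dt) ld in h.
  have : p * ln t <= p * (d * t - ln d) by apply: Rmult_le_compat_l; lra.
  have : p * (d * t) <= k * t.
    have -> : k * t = (p + 1) * (d * t) by rewrite /d; field; lra.
    by apply: Rmult_le_compat_r; lra.
  lra.
exists (exp (p * ln t0)); split=> [|t ht]; first exact: exp_pos.
rewrite /Rpower -exp_plus; apply: exp_mono.
have : ln t0 <= ln t by apply: ln_le.
by nra.
Qed.

(** * The transfer principle *)

(** [exp (x + i p)] lies off a thin closed cone with apex [1] and axis [[1, +oo)].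
    In these logarithmic coordinates its complement is stable under decreasing [x]. *)
Definition off_cone (c x p : R) : Prop :=
  x < 0 \/ (x <= c * Rabs (sin (p / 2)) /\ sin (p / 2) <> 0).

Definition sing_dist (I : finType) (th : I -> R) (x y : R) : R :=
  \big[Rmult/1]_(i : I) Cmod (1 - Cexp (pt x (y - th i))).

Lemma Rpower_mono_l a a' b : 0 < a -> a <= a' -> 0 <= b -> Rpower a b <= Rpower a' b.
Proof.
move=> a0 h b0; apply: exp_mono; apply: Rmult_le_compat_l => //.
exact: ln_le.
Qed.

Lemma Rpower_anti_l a a' b : 0 < a -> a <= a' -> b <= 0 -> Rpower a' b <= Rpower a b.
Proof.
move=> a0 h b0; apply: exp_mono.
by have := ln_le _ _ a0 h; nra.
Qed.

Lemma Rpower_gt0 a b : 0 < Rpower a b.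
Proof. exact: exp_pos. Qed.

(** A power of either sign preserves comparability up to a constant. *)
Lemma Rpower_comparable lo hi b : 0 < lo -> 0 < hi -> exists r, 0 < r /\
  forall u w, 0 < w -> lo * w <= u <= hi * w -> r * Rpower w b <= Rpower u b.
Proof.
move=> l0 h0; case: (Rle_lt_dec 0 b) => hb.
  exists (Rpower lo b); split=> [|u w w0 [h1 h2]]; first exact: Rpower_gt0.
  rewrite Rpower_mult_distr //; apply: Rpower_mono_l => //.
  exact: Rmult_lt_0_compat.
exists (Rpower hi b); split=> [|u w w0 [h1 h2]]; first exact: Rpower_gt0.
have u0 : 0 < u by have := Rmult_lt_0_compat _ _ l0 w0; lra.
by rewrite Rpower_mult_distr //; apply: Rpower_anti_l; lra.
Qed.

(** The transfer principle, for several singular points at once.  The contour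
    passes at distance [1 / n] from each singular point, and leaves the disc
    linearly in the angle elsewhere; there [z ^ (- n)] decays exponentially in the
    smoothed distance, measured in units of [1 / n]. *)
Lemma transfer (I : finType) (th : I -> R) c (H : C -> C) (h : nat -> C) b M :
  (forall i j, i != j -> sin ((th i - th j) / 2) <> 0) ->
  (forall i, - PI <= th i <= PI) -> I -> 0 < c -> taylor H h ->
  (forall x y, (forall i, off_cone c x (y - th i)) ->
     exists l, cder H (Cexp (pt x y)) l) ->
  (forall x y, -1 <= x <= 1 -> 0 <= y <= 2 * PI -> (forall i, off_cone c x (y - th i)) ->
     Cmod (H (Cexp (pt x y))) * Rpower (sing_dist th x y) b <= M) ->
  exists D, forall n, (0 < n)%N -> Cmod (h n) <= D * Rpower (INR n) (b - 1).
Proof.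
move=> sep range i0 c0 T hol bnd.
have pi0 := PI_RGT_0.
case: (cW_le_cw th) => B [B0 HB].
case: (cW_derive_seq th (index_enum I)) => K [K0 HK].
case: (cW_inv_sqr sep i0) => c1 [c10 H1].
case: (cw_inv_sqr_sum_integral range) => A [A0 HA].
(* the slope of the contour: [c] keeps it off the cones, and [1/4] makes
   [contour_dist] apply *)
set k := Rmin c (1/4) / B.
have m0 : 0 < Rmin c (1/4) by apply: Rmin_glb_lt; lra.
have k0 : 0 < k by apply: Rdiv_lt_0_compat.
have kB : k * B = Rmin c (1/4) by rewrite /k; field; lra.
have kB1 : k * B <= c by rewrite kB; apply: Rmin_l.
have kB2 : k * B <= 1/4 by rewrite kB; apply: Rmin_r.
have kB3 : 0 < k * B by lra.
pose lo := \big[Rmult/1]_(i : I) / 3; pose hi := \big[Rmult/1]_(i : I) 7.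
have lo0 : 0 < lo by apply: Rprod_gt0 => i _; lra.
have hi0 : 0 < hi by apply: Rprod_gt0 => i _; lra.
case: (Rpower_comparable b lo0 hi0) => r [r0 Hr].
case: (@pow_exp_bound (2 - b) k c1 k0 c10) => C1 [C10 HC1].
have M0 : 0 <= M.
  have cn i : off_cone c (-1) (0 - th i) by left; lra.
  have := bnd (-1) 0 ltac:(lra) ltac:(lra) cn.
  apply: Rle_trans; apply: Rmult_le_pos; [exact: Cmod_ge_0 | exact/Rlt_le/Rpower_gt0].
pose D := M / r * (exp 1 * (k * K + 1)) * C1 * / c1 ^ 2.
have D0 : 0 <= D.
  have := exp_pos 1 => e1.
  have i1 : 0 < / c1 ^ 2 by apply/Rinv_0_lt_compat/pow_lt.
  have i2 : 0 <= M / r by apply: Rdiv_le_0_compat.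
  have i3 : 0 <= exp 1 * (k * K + 1).
    by apply: Rmult_le_pos; [lra | have := Rmult_le_pos k K; lra].
  by rewrite /D; repeat apply: Rmult_le_pos => //; lra.
exists (D * A / (2 * PI)) => n n0.
have N0 : 1 <= INR n by rewrite -[1]/(INR 1); apply: le_INR; apply/leP.
set N := INR n in N0 *; set e := / N.
have e0 : 0 < e by apply: Rinv_0_lt_compat; lra.
have e1 : e <= 1 by rewrite -Rinv_1; apply: Rinv_le_contravar; lra.
have he : 0 < e <= 1 by [].
have Ne : N * e = 1 by rewrite /e; field; lra.
case: (HK e he) => d [d1 d2 d3].
case: (HA e he) => m [BI [hm1 hm2 hm3]].
pose L y := - e + k * cW th e y.
have Lle y i : L y <= - e + k * B * cw th e i y.
  have := HB e y i he; rewrite /L; nra.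
have cone y x : x <= L y -> forall i, off_cone c x (y - th i).
  move=> hx i; have h1 := Lle y i; have h2 := cw_le_add th i y e0.
  have s0 := Rabs_pos (sin ((y - th i) / 2)).
  have h3 : x <= - e + k * B * (e + Rabs (sin ((y - th i) / 2))) by nra.
  case: (Rlt_le_dec x 0) => x0; [by left | right; split; first by nra].
  by move=> s; rewrite s Rabs_R0 in h3; nra.
suff : 2 * PI * Cmod (h n) <= D * A * Rpower N (b - 1).
  move=> hh; apply: (Rmult_le_reg_l (2 * PI)); first lra.
  have -> : 2 * PI * (D * A / (2 * PI) * Rpower N (b - 1)) = D * A * Rpower N (b - 1) by field; lra.
  exact: hh.
pose Z := D * (Rpower N b * / N ^ 2).
have Z0 : 0 <= Z.
  apply: Rmult_le_pos => //; apply: Rmult_le_pos; first exact/Rlt_le/Rpower_gt0.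
  by apply/Rlt_le/Rinv_0_lt_compat/pow_lt; lra.
apply: (@Rle_trans _ (Z * BI)); last first.
  have NN : Rpower N (b - 1) = Rpower N b * / N.
    by rewrite /Rminus Rpower_plus Rpower_Ropp Rpower_1; lra.
  have -> : D * A * Rpower N (b - 1) = Z * (A / e) by rewrite NN /Z /e; field; lra.
  exact: Rmult_le_compat_l.
apply: (@coef_bound H h n L (fun y => k * d y) (fun y => Z * m y) (k * K) (Z * BI) T).
- move=> y; have := is_derive_plus _ _ _ _ _ (is_derive_const (- e) y) (is_derive_scal _ _ k _ (d1 y)).
  by rewrite plus_zero_l.
- by move=> y; apply: continuity_pt_scal.
- move=> y; rewrite Rabs_mult Rabs_pos_eq; last lra.
  by apply: Rmult_le_compat_l; [lra | exact: d3].
- by rewrite /L cW_period.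
- by move=> x y _ hx; apply: hol; apply: cone hx.
- move=> y hy; have W0 := cW_gt0 th y e0; set w := cW th e y in W0.
  have x1 i : - e <= L y <= - e + sqrt (e ^ 2 + sin ((y - th i) / 2) ^ 2) / 4.
    have := Lle y i; have := cw_gt0 th i y e0; rewrite /cw => h1 h2; split; last by nra.
    by rewrite /L -/w; nra.
  have x2 : -1 <= L y <= 1.
    by have := x1 i0; have := cw_le2 th i0 y he; rewrite /cw; lra.
  have cmp i := contour_dist he (x1 i).
  have Ucmp : lo * w <= sing_dist th (L y) y <= hi * w.
    rewrite /lo /hi /w /cW -!Rprod_mult; split; apply: Rprod_le => i _.
      split; last by have := cmp i; rewrite /cw; lra.
      by apply: Rmult_le_pos; [lra | apply/Rlt_le/cw_gt0].
    by split; [exact: Cmod_ge_0 | case: (cmp i)].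
  have hU := Hr _ _ W0 Ucmp.
  have hH := bnd _ _ x2 hy (cone y (L y) (Rle_refl _)).
  set X := Cmod _ in hH *; have X0 : 0 <= X by apply: Cmod_ge_0.
  have P0 := Rpower_gt0 w b.
  have XM : X <= M / r * Rpower w (- b).
    rewrite Rpower_Ropp; apply: (Rmult_le_reg_r (r * Rpower w b)); first exact: Rmult_lt_0_compat.
    have -> : M / r * / Rpower w b * (r * Rpower w b) = M by field; lra.
    by apply: Rle_trans hH; apply: Rmult_le_compat_l.
  have [h1 h2] := H1 e y he; rewrite -/w in h1 h2.
  set t := N * w; have t0 : 0 < t by apply: Rmult_lt_0_compat; lra.
  have tc : c1 <= t.
    have : N * (c1 * e) <= t by apply: Rmult_le_compat_l; lra.
    have -> : N * (c1 * e) = c1 * (N * e) by ring.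
    rewrite Ne; lra.
  have hE : exp (- (N * L y)) = exp 1 * exp (- (k * t)).
    by rewrite -exp_plus; congr exp; rewrite /L -/w /t; lra.
  (* [t] is bounded below, so [t ^ (2 - b)] is absorbed by the exponential, and
     [1 / w ^ 2] is left, whose integral is of order [n] *)
  have key : Rpower w (- b) * exp (- (k * t)) <= C1 * (Rpower N b * / N ^ 2 * / w ^ 2).
    have -> : Rpower w (- b) = Rpower t (2 - b) * (Rpower N b * / N ^ 2 * / w ^ 2).
      rewrite /Rminus (Rpower_plus 2 (- b) t) -[2]/(INR 2) Rpower_pow //.
      rewrite {2}/t -Rpower_mult_distr //; last lra.
      have n1 := Rpower_gt0 N b; rewrite (Rpower_Ropp N).
      by rewrite /t; field; lra.
    rewrite Rmult_assoc (Rmult_comm _ (exp _)) -Rmult_assoc; apply: Rmult_le_compat_r.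
      apply: Rmult_le_pos; first apply: Rmult_le_pos; first exact/Rlt_le/Rpower_gt0.
        by apply/Rlt_le/Rinv_0_lt_compat/pow_lt; lra.
      exact/Rlt_le/Rinv_0_lt_compat/pow_lt.
    exact: HC1.
  rewrite hE.
  have dK : Rabs (k * d y) + 1 <= k * K + 1.
    rewrite Rabs_mult (Rabs_pos_eq k); last lra.
    by have := d3 y; nra.
  have ee := exp_pos 1; have ek := exp_pos (- (k * t)).
  have sm : / w ^ 2 <= / c1 ^ 2 * m y.
    apply: Rle_trans h2 _; apply: Rmult_le_compat_l; last exact: hm1.
    by apply/Rlt_le/Rinv_0_lt_compat/pow_lt.
  have Mr : 0 <= M / r by apply: Rdiv_le_0_compat.
  have kK : 0 <= exp 1 * (k * K + 1).
    by apply: Rmult_le_pos; [lra | have := Rmult_le_pos k K; lra].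
  apply: (@Rle_trans _ (M / r * (exp 1 * (k * K + 1)) * (Rpower w (- b) * exp (- (k * t))))).
    have -> : M / r * (exp 1 * (k * K + 1)) * (Rpower w (- b) * exp (- (k * t)))
       = (M / r * Rpower w (- b)) * (exp 1 * exp (- (k * t))) * (k * K + 1) by ring.
    apply: Rmult_le_compat => //.
    - by apply: Rmult_le_pos => //; apply: Rmult_le_pos; lra.
    - by have := Rabs_pos (k * d y); lra.
    - by apply: Rmult_le_compat_r => //; apply: Rmult_le_pos; lra.
  have -> : Z * m y = M / r * (exp 1 * (k * K + 1)) * (C1 * (Rpower N b * / N ^ 2 * (/ c1 ^ 2 * m y))).
    by rewrite /Z /D; ring.
  apply: Rmult_le_compat_l; first exact: Rmult_le_pos.
  apply: Rle_trans key _; apply: Rmult_le_compat_l; first lra.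
  apply: Rmult_le_compat_l => //.
  apply: Rmult_le_pos; first exact/Rlt_le/Rpower_gt0.
  by apply/Rlt_le/Rinv_0_lt_compat/pow_lt; lra.
- exact: (is_RInt_scal m 0 (2 * PI) Z BI hm2).
Qed.

(** * The reciprocal Gamma function *)

Lemma inv_nat_diff n : / INR n.+1 - / INR n.+2 = / (INR n.+1 * INR n.+2).
Proof.
rewrite !S_INR; field; have := pos_INR n; lra.
Qed.

Lemma telescoping_limit_R (v : nat -> R) c :
  (forall n, Rabs (v n.+2 - v n.+1) <= c * (/ INR n.+1 - / INR n.+2)) ->
  exists l, forall n, Rabs (v n.+1 - l) <= c * / INR n.+1.
Proof.
move=> H.
have mono n : v n.+1 - c * / INR n.+1 <= v n.+2 - c * / INR n.+2 /\
              v n.+2 + c * / INR n.+2 <= v n.+1 + c * / INR n.+1.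
  by have /Rabs_le_between := H n; lra.
have up n m : v n.+1 - c * / INR n.+1 <= v (n + m).+1 - c * / INR (n + m).+1 /\
              v (n + m).+1 + c * / INR (n + m).+1 <= v n.+1 + c * / INR n.+1.
  elim: m => [|m IH]; rewrite ?addn0 ?addnS; first by split; apply: Rle_refl.
  by have := mono (n + m)%N; lra.
have c0 : 0 <= c.
  have h := H 0%N; have := Rabs_pos (v 2%N - v 1%N); rewrite /= in h *; nra.
have p n : 0 < / INR n.+1 by apply/Rinv_0_lt_compat/lt_0_INR/ltP.
have cross n m : v n.+1 - c * / INR n.+1 <= v m.+1 + c * / INR m.+1.
  have := up n m; have := up m n; rewrite (addnC m n); have := p (n + m)%N.
  by have := Rmult_le_pos _ _ c0 (Rlt_le _ _ (p (n + m)%N)); lra.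
case: (completeness (fun x => exists n, x = v n.+1 - c * / INR n.+1)).
- by exists (v 1%N + c * / INR 1) => _ [n ->]; apply: cross.
- by exists (v 1%N - c * / INR 1), 0%N.
move=> l [ub lub]; exists l => n.
have h1 : v n.+1 - c * / INR n.+1 <= l by apply: ub; exists n.
have h2 : l <= v n.+1 + c * / INR n.+1 by apply: lub => _ [m ->]; apply: cross.
by apply: Rabs_le; lra.
Qed.

(** Steps dominated by those of [c / n] sum to at most [c / n]; the factor [2]
    comes from the two coordinates. *)
Lemma telescoping_limit (v : nat -> C) c :
  (forall n, Cmod (v n.+2 - v n.+1) <= c * (/ INR n.+1 - / INR n.+2)) ->
  exists l, forall n, Cmod (v n.+1 - l) <= 2 * c * / INR n.+1.
Proof.
move=> H.
case: (@telescoping_limit_R (fun n => Re (v n)) c) => [n|a Ha].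
  by apply: Rle_trans (H n); apply: Rle_trans (re_le_Cmod _); rewrite re_plus re_opp; apply: Rle_refl.
case: (@telescoping_limit_R (fun n => Im (v n)) c) => [n|b Hb].
  by apply: Rle_trans (H n); apply: Rle_trans (im_le_Cmod _); rewrite im_plus im_opp; apply: Rle_refl.
exists (pt a b) => n; apply: Rle_trans (Cmod_le_abs _) _.
have -> : Re (v n.+1 - pt a b) = Re (v n.+1) - a by rewrite re_plus re_opp.
have -> : Im (v n.+1 - pt a b) = Im (v n.+1) - b by rewrite im_plus im_opp.
by have := Ha n; have := Hb n; lra.
Qed.

Lemma ln_ratio h : 0 < h <= 1/2 -> Rabs (ln (1 - h) + h) <= 2 * h ^ 2.
Proof.
move=> hh; have h1 := exp_ineq1_le (ln (1 - h)); rewrite exp_ln in h1; last lra.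
have h2 := exp_ineq1_le (- ln (1 - h)); rewrite exp_Ropp exp_ln in h2; last lra.
have : / (1 - h) <= 1 + h + 2 * h ^ 2.
  by apply: (Rmult_le_reg_l (1 - h)); [lra | rewrite Rinv_r; [nra | lra]].
move=> h3; apply: Rabs_le; split; first lra.
by have := pow2_ge_0 h; lra.
Qed.

(** The factor by which one step changes the Euler-Gauss sequence is
    [1 + O (1 / n^2)], because the logarithm cancels the linear term [z / n]. *)
Lemma euler_factor z : exists B, 0 <= B /\ forall n,
  Cmod ((1 + z * RtoC (/ INR n.+2)) * Cexp (z * RtoC (ln (1 - / INR n.+2))) - 1)
    <= B * / INR n.+2 ^ 2.
Proof.
have z0 := Cmod_ge_0 z; set Z := Cmod z in z0.
pose f n := Cmod ((1 + z * RtoC (/ INR n.+2)) * Cexp (z * RtoC (ln (1 - / INR n.+2))) - 1) * INR n.+2 ^ 2.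
have [n0 hn0] : exists n0 : nat, 4 * (Z + 1) <= INR n0.
  by case: (INR_unbounded (4 * (Z + 1))) => n0 h; exists n0; lra.
case: (@bounded_of_eventually f (2 * Z + 4 * Z ^ 2 + 48 * Z ^ 2 * (1 + Z)) n0) => [n hn|B [B0 HB]].
  rewrite /f; set N := INR n.+2.
  have N1 : 4 * (Z + 1) <= N.
    by apply: Rle_trans hn0 _; apply: le_INR; apply/leP; rewrite (leq_trans hn) // -addn2 leq_addr.
  have N0 : 0 < N by lra.
  set h := / N; have h0 : 0 < h by apply: Rinv_0_lt_compat.
  have hN : h * N = 1 by rewrite /h; field; lra.
  have hZ : Z * h <= 1/4 by nra.
  have h2 : h <= 1/4 by nra.
  set lam := ln (1 - h); have hl := @ln_ratio h ltac:(lra); rewrite -/lam in hl.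
  have hh : h ^ 2 <= h * (1/4) by rewrite /= Rmult_1_r; apply: Rmult_le_compat_l; lra.
  have lam2 : Rabs lam <= 2 * h by move/Rabs_le_between: hl => hl; apply: Rabs_le; lra.
  have zl : Cmod (z * RtoC lam) <= 2 * (Z * h).
    by rewrite Cmod_mult Cmod_R -/Z; nra.
  have hR := @Cexp_sub_bound (z * RtoC lam) ltac:(lra).
  set Rr := (Cexp (z * RtoC lam) - 1 - z * RtoC lam)%C in hR.
  have hR2 : Cmod Rr <= 48 * Z ^ 2 * h ^ 2.
    apply: Rle_trans hR _.
    have : Cmod (z * RtoC lam) ^ 2 <= (2 * (Z * h)) ^ 2.
      by apply: pow_incr; split=> //; apply: Cmod_ge_0.
    have -> : (2 * (Z * h)) ^ 2 = 4 * (Z ^ 2 * h ^ 2) by ring.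
    lra.
  have -> : ((1 + z * RtoC h) * Cexp (z * RtoC lam) - 1 =
     z * RtoC (lam + h) + z * z * RtoC (h * lam) + (1 + z * RtoC h) * Rr)%C.
    by rewrite /Rr RtoC_plus RtoC_mult; ring.
  have t : Cmod (z * RtoC (lam + h) + z * z * RtoC (h * lam) + (1 + z * RtoC h) * Rr)
     <= Z * (2 * h ^ 2) + Z * Z * (h * (2 * h)) + (1 + Z) * (48 * Z ^ 2 * h ^ 2).
    apply: Rle_trans (Cmod_triangle _ _) _; apply: Rplus_le_compat.
      apply: Rle_trans (Cmod_triangle _ _) _; rewrite !Cmod_mult !Cmod_R -/Z; apply: Rplus_le_compat.
        exact: Rmult_le_compat_l.
      apply: Rmult_le_compat_l; first exact: Rmult_le_pos.
      rewrite Rabs_mult (Rabs_pos_eq h); last lra.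
      by apply: Rmult_le_compat_l; lra.
    rewrite Cmod_mult; apply: Rmult_le_compat; try exact: Cmod_ge_0; last exact: hR2.
    apply: Rle_trans (Cmod_triangle _ _) _; rewrite Cmod_1 Cmod_mult Cmod_R (Rabs_pos_eq h) -/Z; nra.
  apply: Rle_trans (Rmult_le_compat_r _ _ _ (pow2_ge_0 N) t) _.
  have -> : (Z * (2 * h ^ 2) + Z * Z * (h * (2 * h)) + (1 + Z) * (48 * Z ^ 2 * h ^ 2)) * N ^ 2
     = (2 * Z + 2 * Z ^ 2 + 48 * Z ^ 2 * (1 + Z)) * (h * N) ^ 2 by ring.
  rewrite hN; have := pow2_ge_0 Z; lra.
exists B; split=> // n; have := HB n; rewrite /f.
have p : 0 < INR n.+2 ^ 2 by apply/pow_lt/lt_0_INR/ltP.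
by move=> h; apply/Rle_div_r.
Qed.

Lemma Cmod_Rcpow x s : Cmod (Rcpow x s) = Rpower x (Re s).
Proof. by rewrite /Rcpow Cmod_Cexp re_scal_r. Qed.

Lemma Rcpow_neq0 x s : Rcpow x s <> RtoC 0.
Proof. exact: Cexp_neq0. Qed.

Lemma INRS_gt0 n : 0 < INR n.+1.
Proof. by apply/lt_0_INR/ltP. Qed.

Lemma RtoC_INRS_neq0 n : RtoC (INR n.+1) <> RtoC 0.
Proof. by move=> /RtoC_inj; have := INRS_gt0 n; lra. Qed.

Lemma RtoC_factn_neq0 n : RtoC (INR n`!) <> RtoC 0.
Proof. by move=> /RtoC_inj; have := INR_factn_gt0 n; lra. Qed.

Lemma cprod_recr (F : nat -> C) n :
  (\cprod_(j < n.+1) F j = (\cprod_(j < n) F j) * F n)%C.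
Proof. by rewrite big_ord_recr. Qed.

Lemma rGamma_seq_step z n : (rGamma_seq z n.+2 = rGamma_seq z n.+1 *
  ((1 + z * RtoC (/ INR n.+2)) * Cexp (z * RtoC (ln (1 - / INR n.+2)))))%C.
Proof.
have n1 := INRS_gt0 n; have n2 := INRS_gt0 n.+1.
have -> : ln (1 - / INR n.+2) = ln (INR n.+1) - ln (INR n.+2).
  rewrite -ln_div //; congr ln; rewrite (S_INR n.+1); field.
  by rewrite S_INR in n2; lra.
rewrite /rGamma_seq (cprod_recr (fun j => z + RtoC (INR j))%C) /Rcpow RtoC_minus.
rewrite (_ : z * (RtoC (ln (INR n.+1)) - RtoC (ln (INR n.+2))) =
   z * RtoC (ln (INR n.+1)) + - (z * RtoC (ln (INR n.+2))))%C; last by ring.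
rewrite Cexp_add Cexp_inv factS mult_INR RtoC_mult RtoC_inv; last lra.
have := @Cexp_neq0 (z * RtoC (ln (INR n.+1))); have := @Cexp_neq0 (z * RtoC (ln (INR n.+2))).
set P := (\cprod_(j < n.+2) _)%C; set X := Cexp _; set Y := Cexp _ => Y0 X0.
have f0 := @RtoC_factn_neq0 n.+1; have i0 := @RtoC_INRS_neq0 n.+1.
by field.
Qed.

(** By [euler_factor] the sequence converges at rate [1 / n].  A late term changes
    by at most half of its size afterwards, so nonzero terms have a nonzero limit. *)
Lemma rGamma_limit z : exists2 c, 0 <= c &
  (forall n, Cmod (rGamma_seq z n.+1 - rGamma z) <= c * / INR n.+1) /\
  ((forall n, rGamma_seq z n.+1 <> RtoC 0) -> rGamma z <> RtoC 0).
Proof.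
case: (euler_factor z) => B [B0 HB].
pose u n := rGamma_seq z n.
have p n : 0 < / INR n.+1 by apply/Rinv_0_lt_compat/INRS_gt0.
have d n : Cmod (u n.+2 - u n.+1) <= Cmod (u n.+1) * (B * (/ INR n.+1 - / INR n.+2)).
  rewrite /u rGamma_seq_step; set E := (_ * Cexp _)%C.
  have -> : (rGamma_seq z n.+1 * E - rGamma_seq z n.+1 = rGamma_seq z n.+1 * (E - 1))%C by ring.
  rewrite Cmod_mult; apply: Rmult_le_compat_l; first exact: Cmod_ge_0.
  apply: Rle_trans (HB n) _; apply: Rmult_le_compat_l => //; rewrite inv_nat_diff.
  apply: Rinv_le_contravar.
    by apply: Rmult_lt_0_compat; apply: INRS_gt0.
  rewrite /= Rmult_1_r; apply: Rmult_le_compat_r; first exact/Rlt_le/(INRS_gt0 n.+1).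
  by rewrite -/(INR n.+1) -/(INR n.+2) (S_INR n.+1); lra.
have grow m n : Cmod (u (m + n).+1) <= Cmod (u m.+1) * exp (B * / INR m.+1 - B * / INR (m + n).+1).
  elim: n => [|n IH]; first by rewrite addn0 Rminus_diag exp_0; lra.
  rewrite addnS; set k := (m + n)%N in IH *.
  have h := Cmod_triangle (u k.+2 - u k.+1) (u k.+1).
  rewrite (_ : _ - _ + _ = u k.+2)%C in h; last by ring.
  have c0 := Cmod_ge_0 (u k.+1).
  have : Cmod (u k.+2) <= Cmod (u k.+1) * exp (B * (/ INR k.+1 - / INR k.+2)).
    have := exp_ineq1_le (B * (/ INR k.+1 - / INR k.+2)); have := d k; nra.
  move=> h2; apply: Rle_trans h2 _.
  apply: Rle_trans (Rmult_le_compat_r _ _ _ (Rlt_le _ _ (exp_pos _)) IH) _.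
  by apply: Req_le; rewrite Rmult_assoc -exp_plus; congr (_ * exp _); ring.
have grow' m n : Cmod (u (m + n).+1) <= Cmod (u m.+1) * exp (B * / INR m.+1).
  apply: Rle_trans (grow m n) _; apply: Rmult_le_compat_l; first exact: Cmod_ge_0.
  by apply: exp_mono; have := Rmult_le_pos _ _ B0 (Rlt_le _ _ (p (m + n)%N)); lra.
have dm m n : Cmod (u (m + n).+1 - u m.+1) <=
    Cmod (u m.+1) * exp (B * / INR m.+1) * B * (/ INR m.+1 - / INR (m + n).+1).
  elim: n => [|n IH].
    by rewrite addn0 (_ : u m.+1 - u m.+1 = RtoC 0)%C ?Cmod_0; [lra | ring].
  rewrite addnS; have t := Cmod_triang_minus (u (m + n).+2) (u (m + n).+1) (u m.+1).
  have h := d (m + n)%N; have g := grow' m n.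
  have q : 0 <= B * (/ INR (m + n).+1 - / INR (m + n).+2).
    apply: Rmult_le_pos => //; rewrite inv_nat_diff; apply/Rlt_le/Rinv_0_lt_compat.
    by apply: Rmult_lt_0_compat; apply: INRS_gt0.
  have := Rmult_le_compat_r _ _ _ q g; lra.
set A := Cmod (u 1%N) * exp (B * / INR 1) * B.
have A0 : 0 <= A.
  by repeat apply: Rmult_le_pos => //; [apply: Cmod_ge_0 | apply/Rlt_le/exp_pos].
case: (@telescoping_limit u A) => [n|l Hl].
  apply: Rle_trans (d n) _; rewrite /A Rmult_assoc -Rmult_assoc.
  rewrite (Rmult_assoc _ B); apply: Rmult_le_compat_r; last by have := grow' 0%N n; rewrite add0n.
  apply: Rmult_le_pos => //; rewrite inv_nat_diff; apply/Rlt_le/Rinv_0_lt_compat.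
  by apply: Rmult_lt_0_compat; apply: INRS_gt0.
have small e : 0 < e -> exists n0, forall n, (n0 <= n)%coq_nat -> Cmod (u n - l) < e.
  move=> e0; case: (INR_unbounded ((2 * A + 1) / e)) => n0 h.
  exists n0.+1 => -[|n] hn; first by lia.
  apply: Rle_lt_trans (Hl n) _.
  have : (2 * A + 1) / e < INR n.+1.
    apply: Rlt_le_trans h _; apply: le_INR; lia.
  move/(proj1 (Rlt_div_l _ _ _ e0)) => h2; apply/Rlt_div_l; first exact: INRS_gt0.
  by have := INRS_gt0 n; lra.
have lim (f : C -> R) : (forall w v, Rabs (f w - f v) <= Cmod (w - v)) ->
    Lim_seq (fun n => f (u n)) = f l.
  move=> lip; apply: is_lim_seq_unique; apply/is_lim_seq_spec => e.
  case: (small e (cond_pos e)) => n0 h; exists n0 => n /h; apply: Rle_lt_trans.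
  exact: lip.
have El : rGamma z = l.
  have e1 : Lim_seq (fun n => Re (rGamma_seq z n)) = Re l.
    by apply: lim => w v; apply: Rle_trans (re_le_Cmod _); rewrite re_plus re_opp; apply: Rle_refl.
  have e2 : Lim_seq (fun n => Im (rGamma_seq z n)) = Im l.
    by apply: lim => w v; apply: Rle_trans (im_le_Cmod _); rewrite im_plus im_opp; apply: Rle_refl.
  by rewrite /rGamma e1 e2; case: (l).
exists (2 * A); first lra.
split=> [n|nz]; rewrite El; first exact: Hl.
have [m hm] : exists m : nat, 12 * (B + 1) <= INR m.
  by case: (INR_unbounded (12 * (B + 1))) => m h; exists m; lra.
have um : 0 < Cmod (u m.+1) by apply/Cmod_gt_0; apply: nz.
have Bm : B * / INR m.+1 <= 1/12.
  apply/Rle_div_l; first exact: INRS_gt0.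
  by have := S_INR m; lra.
have Bm0 : 0 <= B * / INR m.+1 by apply: Rmult_le_pos => //; apply/Rlt_le.
have ex : exp (B * / INR m.+1) <= 3.
  by apply: Rle_trans exp_le_3; apply: exp_mono; lra.
have close n : Cmod (u (m + n).+1 - u m.+1) <= Cmod (u m.+1) / 4.
  apply: Rle_trans (dm m n) _.
  have q : B * (/ INR m.+1 - / INR (m + n).+1) <= 1/12.
    by have := Rmult_le_pos _ _ B0 (Rlt_le _ _ (p (m + n)%N)); lra.
  rewrite Rmult_assoc Rmult_assoc; apply: Rmult_le_compat_l; first lra.
  have : exp (B * / INR m.+1) * (B * (/ INR m.+1 - / INR (m + n).+1)) <= exp (B * / INR m.+1) * (1/12).
    by apply: Rmult_le_compat_l => //; apply/Rlt_le/exp_pos.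
  lra.
move=> l0; case: (small (Cmod (u m.+1) / 4)) => [|n0 h]; first lra.
have := h (m + n0).+1 ltac:(by apply/leP; rewrite leqW // leq_addl).
have := close n0; rewrite l0 => h1 h2.
have := Cmod_ge_sub (u m.+1) (u (m + n0).+1); rewrite Cmod_sub_rev.
rewrite (_ : u (m + n0).+1 - 0 = u (m + n0).+1)%C in h2; last by ring.
lra.
Qed.

(** * Coefficients of powers *)

(** The coefficients of [(1 - z) ^ (- al)]. *)
Definition bin_coef (al : C) (n : nat) : C :=
  (\cprod_(j < n) ((al + RtoC (INR j)) / RtoC (INR j.+1)))%C.

Lemma bin_coef_S al n :
  (RtoC (INR n.+1) * bin_coef al n.+1 = (al + RtoC (INR n)) * bin_coef al n)%C.
Proof.
rewrite /bin_coef (cprod_recr (fun j => (al + RtoC (INR j)) / RtoC (INR j.+1))%C).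
by field; apply: RtoC_INRS_neq0.
Qed.

Lemma bin_coef_exp al : exp_coef (fun=> al) (bin_coef al).
Proof.
split=> [|n]; first by rewrite /bin_coef big_ord0.
rewrite bin_coef_S; elim: n => [|n IH].
  by rewrite big_ord_recr big_ord0 /= subnn; ring.
rewrite [RHS]big_ord_recl subn0.
rewrite (eq_bigr (fun k : 'I_n.+1 => al * bin_coef al (n - k)%N)%C); last first.
  by move=> k _; rewrite lift0 subSS.
by rewrite -IH -[in RHS]bin_coef_S; ring.
Qed.

Lemma taylor_power al : taylor (fun z => Cexp (al * llog z)) (bin_coef al).
Proof.
apply: (taylor_exp (a := fun=> al)); last exact: bin_coef_exp.
apply: taylor_ext (taylor_scal al taylor_llog) => // -[|k]; first by ring.
by rewrite /Cdiv Cmult_1_l.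
Qed.

Lemma rGamma_seq_bin al n :
  (bin_coef al n.+1 * (al + RtoC (INR n.+1)) = rGamma_seq al n.+1 * Rcpow (INR n.+1) al)%C.
Proof.
rewrite /rGamma_seq (cprod_recr (fun j => al + RtoC (INR j))%C).
have -> : (\cprod_(j < n.+1) (al + RtoC (INR j)) = bin_coef al n.+1 * RtoC (INR (n.+1)`!))%C.
  rewrite /bin_coef; elim: n.+1 => [|k IH]; first by rewrite !big_ord0 /=; ring.
  rewrite (cprod_recr (fun j => al + RtoC (INR j))%C) IH.
  rewrite (cprod_recr (fun j => (al + RtoC (INR j)) / RtoC (INR j.+1))%C).
  by rewrite factS mult_INR RtoC_mult; field; apply: RtoC_INRS_neq0.
have f0 := @RtoC_factn_neq0 n.+1; have i0 := @Rcpow_neq0 (INR n.+1) al.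
by field.
Qed.

(** [m n = xi ^ n n ^ (al - 1) (g + O (1 / n))].  The error is absolute, so that
    [g = 0] is allowed: this happens where [1 / Gamma] vanishes. *)
Definition coef_asym (xi al g : C) (m : nat -> C) : Prop :=
  exists M n0, 0 <= M /\ forall n, (n0 <= n)%N ->
    Cmod (m n - xi ^ n * Rcpow (INR n) (al - 1) * g) <= M * Rpower (INR n) (Re al - 2).

Lemma Rpower_sub2 n a : (0 < n)%N -> Rpower (INR n) (a - 2) = Rpower (INR n) (a - 1) * / INR n.
Proof.
case: n => // n _; have n0 := INRS_gt0 n.
by rewrite (_ : a - 2 = (a - 1) + - (1)) ?Rpower_plus ?Rpower_Ropp ?Rpower_1 //; ring.
Qed.

Lemma Cmod_Rcpow_sub1 x al : Cmod (Rcpow x (al - 1)) = Rpower x (Re al - 1).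
Proof. by rewrite Cmod_Rcpow re_plus re_opp. Qed.

Lemma Rcpow_sub1 n al : (Rcpow (INR n.+1) al = Rcpow (INR n.+1) (al - 1) * RtoC (INR n.+1))%C.
Proof.
rewrite /Rcpow -{3}(exp_ln _ (INRS_gt0 n)) -Cexp_RtoC -Cexp_add; congr Cexp; ring.
Qed.

(** Up to the factor [al + n] and the power [n ^ al], binomial coefficients are the
    terms of the Euler-Gauss sequence. *)
Lemma bin_coef_asym al : coef_asym (RtoC 1) al (rGamma al) (bin_coef al).
Proof.
case: (rGamma_limit al) => c c0 [hl _].
set g := rGamma al in hl *; have a0 := Cmod_ge_0 al; have g0 := Cmod_ge_0 g.
case: (INR_unbounded (2 * Cmod al + 1)) => n0 hn0.
exists (c + 2 * Cmod al * (Cmod g + c)), n0.+1; split.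
  by apply: Rplus_le_le_0_compat => //; apply: Rmult_le_pos; lra.
case=> // n hn; have N0 := INRS_gt0 n.
have Nn : INR n0 <= INR n.+1 by apply: le_INR; apply/leP; apply: leq_trans hn.
have N1 : 1 <= INR n.+1 by rewrite -[1]/(INR 1); apply: le_INR; apply/leP.
rewrite Rpower_sub2 // -Cmod_Rcpow_sub1.
set w := Rcpow _ _; set u := rGamma_seq al n.+1; set N := INR n.+1 in hl N0 Nn N1 *.
have den : N / 2 <= Cmod (al + RtoC N).
  have := Cmod_ge_sub (RtoC N) (- al)%C; rewrite Cmod_opp Cmod_R Rabs_pos_eq; last lra.
  rewrite (_ : RtoC N - - al = al + RtoC N)%C; last by ring.
  lra.
have dn0 : (al + RtoC N)%C <> RtoC 0 by apply/Cmod_gt_0; lra.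
have nn0 : RtoC N <> RtoC 0 by apply: RtoC_INRS_neq0.
have e : bin_coef al n.+1 = (w * (u * RtoC N / (al + RtoC N)))%C.
  have := rGamma_seq_bin al n; rewrite Rcpow_sub1 -/w -/u -/N => h.
  rewrite -[LHS]Cmult_1_r -(Cinv_r _ dn0) Cmult_assoc h; field.
  exact: dn0.
rewrite e Cpow_1_l (_ : _ - _ = w * ((u - g) - al * u / (al + RtoC N)))%C; last first.
  by field; apply: dn0.
rewrite Cmod_mult (Rmult_comm _ (Cmod w * _)) Rmult_assoc; apply: Rmult_le_compat_l; first exact: Cmod_ge_0.
have hu := hl n; rewrite -/u -/N in hu.
have iN : / N <= 1 by rewrite -Rinv_1; apply: Rinv_le_contravar; lra.
have iN0 : 0 < / N by apply: Rinv_0_lt_compat.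
have ub : Cmod u <= Cmod g + c.
  have := Cmod_triangle (u - g) g; rewrite (_ : u - g + g = u)%C; last by ring.
  nra.
have t := Cmod_triangle (u - g) (- (al * u / (al + RtoC N))); rewrite Cmod_opp in t.
apply: Rle_trans t _.
have : Cmod (al * u / (al + RtoC N)) <= 2 * Cmod al * (Cmod g + c) * / N.
  rewrite Cmod_div // Cmod_mult; apply/Rle_div_l; first by lra.
  have u0 := Cmod_ge_0 u.
  apply: (@Rle_trans _ (2 * Cmod al * (Cmod g + c) * / N * (N / 2))).
    have -> : 2 * Cmod al * (Cmod g + c) * / N * (N / 2) = Cmod al * (Cmod g + c) by field; lra.
    exact: Rmult_le_compat_l.
  apply: Rmult_le_compat_l => //; apply: Rmult_le_pos; last lra.
  by apply: Rmult_le_pos; lra.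
lra.
Qed.

Lemma coef_asym_scal xi al g m a : coef_asym xi al g m ->
  coef_asym xi al (a * g) (fun n => a * m n)%C.
Proof.
move=> [M [n0 [M0 H]]]; exists (Cmod a * M), n0; split.
  by apply: Rmult_le_pos => //; apply: Cmod_ge_0.
move=> n /H h; rewrite (_ : _ - _ = a * (m n - xi ^ n * Rcpow (INR n) (al - 1) * g))%C; last by ring.
by rewrite Cmod_mult Rmult_assoc; apply: Rmult_le_compat_l => //; apply: Cmod_ge_0.
Qed.

Lemma coef_asym_dilate xi al g m : Cmod xi = 1 -> coef_asym (RtoC 1) al g m ->
  coef_asym xi al g (fun n => xi ^ n * m n)%C.
Proof.
move=> x1 [M [n0 [M0 H]]]; exists M, n0; split=> // n /H; rewrite Cpow_1_l => h.
rewrite (_ : _ - _ = xi ^ n * (m n - 1 * Rcpow (INR n) (al - 1) * g))%C; last by ring.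
by rewrite Cmod_mult Cmod_pow x1 pow1 Rmult_1_l.
Qed.

Lemma Rcpow_shift s : exists c n0, 0 <= c /\ forall n, (n0 <= n)%N ->
  Cmod (Rcpow (INR n) s - Rcpow (INR n.+1) s) <= c * Rpower (INR n.+1) (Re s - 1).
Proof.
have s0 := Cmod_ge_0 s.
case: (INR_unbounded (4 * Cmod s + 2)) => n0 hn0.
exists (14 * Cmod s), n0; split=> [|n hn]; first lra.
have Nn : INR n0 <= INR n by apply: le_INR; apply/leP.
have e1 := S_INR n; set N := INR n.+1 in e1 *.
set h := / N; have N0 : 0 < N by lra.
have h0 : 0 < h by apply: Rinv_0_lt_compat.
have hN : h * N = 1 by rewrite /h; field; lra.
have h2 : h <= 1/2 by nra.
have hs : Cmod s * h <= 1/4 by nra.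
have hl := @ln_ratio h ltac:(lra).
have hh : h ^ 2 <= h * (1/2) by rewrite /= Rmult_1_r; apply: Rmult_le_compat_l; lra.
have lam2 : Rabs (ln (1 - h)) <= 2 * h by move/Rabs_le_between: hl => hl; apply: Rabs_le; lra.
have el : ln (INR n) = ln N + ln (1 - h).
  rewrite -ln_mult; [congr ln; rewrite /h; field_simplify; lra | lra | lra].
have E : Rcpow (INR n) s = (Rcpow N s * Cexp (s * RtoC (ln (1 - h))))%C.
  by rewrite /Rcpow el RtoC_plus -Cexp_add; congr Cexp; ring.
rewrite E (_ : _ - _ = Rcpow N s * (Cexp (s * RtoC (ln (1 - h))) - 1))%C; last by ring.
have sm : Cmod (s * RtoC (ln (1 - h))) <= 2 * (Cmod s * h).
  by rewrite Cmod_mult Cmod_R; nra.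
have := @Cexp_lip (s * RtoC (ln (1 - h))) ltac:(lra) => L.
have -> : Rpower N (Re s - 1) = Rpower N (Re s) * h.
  by rewrite /Rminus Rpower_plus Rpower_Ropp Rpower_1.
rewrite Cmod_mult Cmod_Rcpow.
have p := Rpower_gt0 N (Re s).
rewrite (_ : 14 * Cmod s * (Rpower N (Re s) * h) = Rpower N (Re s) * (14 * (Cmod s * h))); last by ring.
by apply: Rmult_le_compat_l; lra.
Qed.

(** Multiplication by [1 - w z] acts on the leading term as the value of that
    factor at the singular point [1 / xi]. *)
Lemma coef_asym_mul_linear xi w al g m : Cmod xi = 1 -> coef_asym xi al g m ->
  coef_asym xi al (g * (1 - w / xi))%C (fun n => m n - w * (if n is k.+1 then m k else 0))%C.
Proof.
move=> x1 [M [n0 [M0 H]]].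
have xn0 : xi <> RtoC 0 by apply/Cmod_gt_0; lra.
case: (Rcpow_shift (al - 1)) => c [n1 [c0 H1]].
have [r [r0 Hr]] := @Rpower_comparable (1/2) 1 (2 - Re al) ltac:(lra) ltac:(lra).
have w0 := Cmod_ge_0 w; have g0 := Cmod_ge_0 g.
exists (M + Cmod w * (M / r) + Cmod w * (Cmod g * c)), (n0 + n1 + 2)%N; split.
  have : 0 <= Cmod w * (M / r) by apply: Rmult_le_pos => //; apply: Rdiv_le_0_compat.
  have : 0 <= Cmod w * (Cmod g * c) by apply: Rmult_le_pos => //; apply: Rmult_le_pos.
  lra.
move=> [|n]; first by rewrite addn2.
rewrite addn2 ltnS => hn.
have hn0 : (n0 <= n)%N by apply: leq_trans hn; apply: leqW; apply: leq_addr.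
have hn1 : (n1 <= n)%N by apply: leq_trans hn; apply: leqW; apply: leq_addl.
have n_gt0 : (0 < n)%N by apply: leq_trans hn.
have A := H n.+1 (leqW hn0); have B := H n hn0; have D := H1 n hn1.
have eRe : Re (al - 1) - 1 = Re al - 2 by rewrite re_plus re_opp /=; ring.
rewrite eRe in D.
set P := Rpower (INR n.+1) (Re al - 2) in A D *.
have N1 : 1 <= INR n by rewrite -[1]/(INR 1); apply: le_INR; apply/leP.
have eN := S_INR n.
have Pn : Rpower (INR n) (Re al - 2) <= / r * P.
  have := Hr (INR n) (INR n.+1) (INRS_gt0 n) ltac:(lra).
  have e2 a : Rpower a (Re al - 2) = / Rpower a (2 - Re al).
    by rewrite -Rpower_Ropp; congr Rpower; ring.
  rewrite /P !e2 -Rinv_mult => h; apply: Rinv_le_contravar => //.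
  by apply: Rmult_lt_0_compat => //; apply: Rpower_gt0.
set X := Rcpow (INR n.+1) (al - 1) in A D *; set Y := Rcpow (INR n) (al - 1) in B D.
have -> : (m n.+1 - w * m n - xi ^ n.+1 * X * (g * (1 - w / xi)) =
   (m n.+1 - xi ^ n.+1 * X * g) + - w * (m n - xi ^ n * Y * g) + - w * (xi ^ n * g * (Y - X)))%C.
  by rewrite Cpow_S; field.
have t1 := Cmod_triangle ((m n.+1 - xi ^ n.+1 * X * g) + - w * (m n - xi ^ n * Y * g)) (- w * (xi ^ n * g * (Y - X))).
have t2 := Cmod_triangle (m n.+1 - xi ^ n.+1 * X * g) (- w * (m n - xi ^ n * Y * g)).
rewrite !Cmod_mult Cmod_opp Cmod_pow x1 pow1 Rmult_1_l in t1 t2.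
have i1 : Cmod w * Cmod (m n - xi ^ n * Y * g) <= Cmod w * (M * (/ r * P)).
  apply: Rmult_le_compat_l => //; apply: Rle_trans B _; exact: Rmult_le_compat_l.
have i2 : Cmod w * (Cmod g * Cmod (Y - X)) <= Cmod w * (Cmod g * (c * P)).
  by apply: Rmult_le_compat_l => //; apply: Rmult_le_compat_l.
apply: Rle_trans t1 _.
have e : (M + Cmod w * (M / r) + Cmod w * (Cmod g * c)) * P =
  M * P + Cmod w * (M * (/ r * P)) + Cmod w * (Cmod g * (c * P)) by rewrite /Rdiv; ring.
rewrite e; lra.
Qed.

(** * Local and global bounds *)

Definition cdiff (f : C -> C) (z : C) : Prop := exists l, cder f z l.

Lemma cdiff_ccont f z : cdiff f z -> ccont f z.
Proof. by case=> l /cder_cont. Qed.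

Lemma cdiff_const (a z : C) : cdiff (fun=> a) z.
Proof. by exists (RtoC 0); apply: cder_const. Qed.

Lemma cdiff_plus f g z : cdiff f z -> cdiff g z -> cdiff (fun w => f w + g w)%C z.
Proof. by move=> [l a] [m b]; exists (l + m)%C; apply: cder_plus. Qed.

Lemma cdiff_mult f g z : cdiff f z -> cdiff g z -> cdiff (fun w => f w * g w)%C z.
Proof. by move=> [l a] [m b]; eexists; apply: cder_mult a b. Qed.

Lemma cdiff_comp f g z : cdiff f z -> cdiff g (f z) -> cdiff (fun w => g (f w)) z.
Proof. by move=> [l a] [m b]; eexists; apply: cder_comp a b. Qed.

Lemma cdiff_scale (a z : C) : cdiff (fun w => a * w)%C z.
Proof. by eexists; apply: cder_scal; apply: cder_id. Qed.

Lemma cdiff_linear (a z : C) : cdiff (fun w => 1 - a * w)%C z.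
Proof.
have [l h] := cdiff_plus (cdiff_const 1 z) (cdiff_scale (- a) z).
by exists l; apply: cder_ext h => w; ring.
Qed.

Lemma cdiff_Cexp z : cdiff Cexp z.
Proof. by exists (Cexp z); apply: cder_Cexp. Qed.

Lemma cdiff_pow f n z : cdiff f z -> cdiff (fun w => f w ^ n)%C z.
Proof.
move=> df; elim: n => [|n IH]; first exact: cdiff_const.
exact: cdiff_mult df IH.
Qed.

Lemma cdiff_csum (I : Type) (s : seq I) (Q : pred I) (F : I -> C -> C) z :
  (forall i, Q i -> cdiff (F i) z) ->
  cdiff (fun w => \big[Cplus/RtoC 0]_(i <- s | Q i) F i w) z.
Proof.
move=> H; elim: s => [|i s [l IH]].
  by exists (RtoC 0); apply: cder_ext (cder_const (RtoC 0) z) => w; rewrite big_nil.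
case Qi: (Q i); last by exists l; apply: cder_ext IH => w; rewrite big_cons Qi.
case: (cdiff_plus (H i Qi) (ex_intro _ l IH)) => m h; exists m.
by apply: cder_ext h => w; rewrite big_cons Qi.
Qed.

Lemma cdiff_cprod (I : Type) (s : seq I) (Q : pred I) (F : I -> C -> C) z :
  (forall i, Q i -> cdiff (F i) z) ->
  cdiff (fun w => \big[Cmult/RtoC 1]_(i <- s | Q i) F i w) z.
Proof.
move=> H; elim: s => [|i s [l IH]].
  by exists (RtoC 0); apply: cder_ext (cder_const (RtoC 1) z) => w; rewrite big_nil.
case Qi: (Q i); last by exists l; apply: cder_ext IH => w; rewrite big_cons Qi.
case: (cdiff_mult (H i Qi) (ex_intro _ l IH)) => m h; exists m.
by apply: cder_ext h => w; rewrite big_cons Qi.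
Qed.

Lemma ccont_bounded f z : ccont f z -> exists d B, [/\ 0 < d, 0 <= B &
  forall w, Cmod (w - z) < d -> Cmod (f w) <= B].
Proof.
move=> cf; case: (cf 1 Rlt_0_1) => d [d0 H].
exists d, (Cmod (f z) + 1); split=> //; first by have := Cmod_ge_0 (f z); lra.
move=> w /H; have := Cmod_ge_sub (f w) (f z); lra.
Qed.

Lemma ccont_away f z : ccont f z -> f z <> RtoC 0 -> exists d lo hi,
  [/\ 0 < d, 0 < lo, 0 < hi & forall w, Cmod (w - z) < d -> lo <= Cmod (f w) <= hi].
Proof.
move=> cf fz; have m0 : 0 < Cmod (f z) by apply/Cmod_gt_0.
case: (cf (Cmod (f z) / 2)) => [|d [d0 H]]; first lra.
exists d, (Cmod (f z) / 2), (2 * Cmod (f z)); split; try lra.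
move=> w /H; have := Cmod_ge_sub (f w) (f z); have := Cmod_ge_sub (f z) (f w).
rewrite (Cmod_sub_rev (f z)); lra.
Qed.

Lemma cdiff_lipschitz f z : cdiff f z -> exists d B, [/\ 0 < d, 0 <= B &
  forall w, Cmod (w - z) < d -> Cmod (f w - f z) <= B * Cmod (w - z)].
Proof.
case=> l [q [cq _ E]]; case: (ccont_bounded cq) => d [B [d0 B0 H]].
exists d, B; split=> // w hw; rewrite [f w]E (_ : _ - _ = q w * (w - z))%C; last by ring.
by rewrite Cmod_mult; apply: Rmult_le_compat_r; [apply: Cmod_ge_0 | apply: H].
Qed.

Lemma Cmod_cprod (I : Type) (s : seq I) (Q : pred I) (F : I -> C) :
  Cmod (\big[Cmult/RtoC 1]_(i <- s | Q i) F i) = \big[Rmult/1]_(i <- s | Q i) Cmod (F i).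
Proof. by apply: (big_morph _ Cmod_mult Cmod_1). Qed.

Lemma off_cone_slit c x p : off_cone c x p -> slit (1 - Cexp (pt x p)).
Proof.
move=> h; have ex := exp_pos x.
have eI : Im (1 - Cexp (pt x p)) = - (exp x * sin p) by rewrite im_plus im_opp /=; ring.
have eR : Re (1 - Cexp (pt x p)) = 1 - exp x * cos p by rewrite re_plus re_opp.
case: (Req_dec (sin p) 0) => s0; last first.
  by left; rewrite eI; apply/Ropp_neq_0_compat/Rmult_integral_contrapositive_currified; lra.
right; rewrite eR; case: h => [x0|[_ sh]].
  have : exp x < 1 by rewrite -exp_0; apply: exp_increasing.
  by have := COS_bound p; nra.
have c0 : cos (p / 2) = 0.
  have := sin_2a (p / 2); rewrite (_ : 2 * (p / 2) = p) ?s0; last by field.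
  move=> /esym /Rmult_integral [h|//]; lra.
have := sin2_cos2 (p / 2); rewrite c0 /Rsqr => h.
rewrite cos_half; have : sin (p / 2) ^ 2 = 1 by rewrite /= Rmult_1_r; lra.
by move=> ->; lra.
Qed.

Lemma cdiff_llog q : slit (1 - q) -> cdiff llog q.
Proof. by move=> h; eexists; apply: cder_llog. Qed.

(** [square_bisection] as compactness. *)
Lemma box_bounded (D : R -> R -> Prop) (f : R -> R -> R) :
  (forall s t, 0 <= s <= 1 -> 0 <= t <= 1 -> exists d M, 0 < d /\
     forall s' t', Rabs (s' - s) < d -> Rabs (t' - t) < d -> D s' t' -> f s' t' <= M) ->
  exists M, forall s t, 0 <= s <= 1 -> 0 <= t <= 1 -> D s t -> f s t <= M.
Proof.
move=> loc.
have : exists M, forall s t, 0 <= s <= 0 + 1 -> 0 <= t <= 0 + 1 -> D s t -> f s t <= M.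
  apply: (@square_bisection (fun s t h => exists M, forall s' t', s <= s' <= s + h ->
     t <= t' <= t + h -> D s' t' -> f s' t' <= M)).
    move=> s t h h0 [M1 H1] [M2 H2] [M3 H3] [M4 H4].
    exists (Rmax (Rmax M1 M2) (Rmax M3 M4)) => s' t' hs ht hD.
    have := Rmax_l (Rmax M1 M2) (Rmax M3 M4); have := Rmax_r (Rmax M1 M2) (Rmax M3 M4).
    have := Rmax_l M1 M2; have := Rmax_r M1 M2; have := Rmax_l M3 M4; have := Rmax_r M3 M4.
    case: (Rle_lt_dec s' (s + h / 2)) => cs; case: (Rle_lt_dec t' (t + h / 2)) => ct.
    - by have := H1 s' t' ltac:(lra) ltac:(lra) hD; lra.
    - by have := H3 s' t' ltac:(lra) ltac:(lra) hD; lra.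
    - by have := H2 s' t' ltac:(lra) ltac:(lra) hD; lra.
    - by have := H4 s' t' ltac:(lra) ltac:(lra) hD; lra.
  move=> s t hs ht; case: (loc s t hs ht) => d [M [d0 H]].
  exists d; split=> // s' t' h [h0 hd] ks kt; exists M => s'' t'' ls lt hD.
  by apply: H => //; apply: Rabs_def1; lra.
by case=> M H; exists M => s t hs ht; apply: H; lra.
Qed.

Lemma taylor_mul_pow (w : C) L xi al g f m : Cmod xi = 1 ->
  taylor f m -> coef_asym xi al g m ->
  exists m', taylor (fun z => f z * (1 - w * z) ^ L)%C m' /\
             coef_asym xi al (g * (1 - w / xi) ^ L)%C m'.
Proof.
move=> x1; elim: L f g m => [|L IH] f g m T A.
  exists m; split; first by apply: taylor_ext T => // z; rewrite /= Cmult_1_r.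
  by rewrite /= Cmult_1_r.
case: (IH _ _ _ (taylor_mul_linear w T) (coef_asym_mul_linear w x1 A)) => m' [T' A'].
exists m'; split.
  by apply: taylor_ext T' => // z; rewrite Cpow_S; ring.
by move: A'; rewrite Cpow_S -Cmult_assoc.
Qed.

Lemma taylor_mul_prod (I : Type) (s : seq I) (Q : pred I) (w : I -> C) L xi al g f m :
  Cmod xi = 1 -> taylor f m -> coef_asym xi al g m ->
  exists m', taylor (fun z => f z * \big[Cmult/RtoC 1]_(j <- s | Q j) ((1 - w j * z) ^ L))%C m' /\
     coef_asym xi al (g * \big[Cmult/RtoC 1]_(j <- s | Q j) ((1 - w j / xi) ^ L))%C m'.
Proof.
move=> x1; elim: s f g m => [|j s IH] f g m T A.
  exists m; split; first by apply: taylor_ext T => // z; rewrite big_nil Cmult_1_r.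
  by rewrite big_nil Cmult_1_r.
case Qj: (Q j); last first.
  case: (IH _ _ _ T A) => m' [T' A']; exists m'; split; last by rewrite big_cons Qj.
  by apply: taylor_ext T' => // z; rewrite big_cons Qj.
case: (taylor_mul_pow (w j) L x1 T A) => m1 [T1 A1].
case: (IH _ _ _ T1 A1) => m' [T' A']; exists m'; split.
  by apply: taylor_ext T' => // z; rewrite big_cons Qj Cmult_assoc.
by rewrite big_cons Qj Cmult_assoc.
Qed.

(** * Singularity analysis with several singular points *)

Lemma Cexp_pt_add x y x' y' : (Cexp (pt x y) * Cexp (pt x' y') = Cexp (pt (x + x') (y + y')))%C.
Proof. by rewrite -Cexp_add. Qed.

Section Singularities.
Variables (gam : C -> C) (c vt : R) (K : C) (Mg dg : R) (tau : nat -> C).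
Hypothesis c_gt0 : 0 < c.
Hypothesis dg_gt0 : 0 < dg.
Hypothesis Mg_ge0 : 0 <= Mg.
Hypothesis vt_gt0 : 0 < vt.
Hypothesis gam_hol : forall x p, off_cone c x p -> cdiff gam (Cexp (pt x p)).
Hypothesis gam_sing : forall x p, off_cone c x p -> Cmod (1 - Cexp (pt x p)) < dg ->
  Cmod (gam (Cexp (pt x p)) - (RtoC vt * llog (Cexp (pt x p)) + K)) <= Mg * Cmod (1 - Cexp (pt x p)).
Hypothesis gam_taylor : taylor gam (fun k => if k is 0%N then RtoC 0 else tau k / RtoC (INR k))%C.

Variables (I : finType) (th : I -> R) (b : I -> C) (beta : R).
Hypothesis sep : forall i j, i != j -> sin ((th i - th j) / 2) <> 0.
Hypothesis range : forall i, - PI <= th i <= PI.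
Hypothesis b_le : forall i, Re (b i) <= beta.

Definition rot (i : I) : C := Cexp (pt 0 (- th i)).
(** The function whose coefficients are sought; its singular points on the unit
    circle are the inverses of the rotations. *)
Definition fgf (z : C) : C := Cexp (\csum_(i : I) (b i * gam (rot i * z)))%C.
(** The factors of [fgf] that are regular at the inverse of [rot i], evaluated
    there, and the constant term [K] of the singular factor. *)
Definition sing_amp (i : I) : C :=
  (Cexp (b i * K) * Cexp (\big[Cplus/RtoC 0]_(j | j != i) (b j * gam (Cexp (pt 0 (th i - th j))))))%C.
(** Polar coordinates with an unbounded angle, so that no branch of the argument
    is chosen. *)
Definition in_dom (z : C) : Prop :=
  exists x y, z = Cexp (pt x y) /\ forall i, off_cone c x (y - th i).
Definition alpha (i : I) : C := (RtoC vt * b i)%C.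
Definition sdist (z : C) : R := \big[Rmult/1]_(i : I) Cmod (1 - rot i * z).

Lemma Cmod_rot i : Cmod (rot i) = 1.
Proof. by rewrite Cmod_Cexp exp_0. Qed.

Lemma rot_neq0 i : rot i <> RtoC 0.
Proof. exact: Cexp_neq0. Qed.

Lemma rot_pt i x y : (rot i * Cexp (pt x y) = Cexp (pt x (y - th i)))%C.
Proof. by rewrite /rot Cexp_pt_add; congr (Cexp (pt _ _)); ring. Qed.

Definition spt (i : I) : C := Cexp (pt 0 (th i)).

Lemma rot_spt i j : (rot j * spt i = Cexp (pt 0 (th i - th j)))%C.
Proof. exact: rot_pt. Qed.

Lemma rot_spt_same i : (rot i * spt i = 1)%C.
Proof. by rewrite rot_spt Rminus_diag -[pt 0 0]/(RtoC 0) Cexp_0. Qed.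

Lemma inv_rot i : (/ rot i = spt i)%C.
Proof.
have r0 := @rot_neq0 i; rewrite -[RHS]Cmult_1_l -(Cinv_l (rot i) r0) -Cmult_assoc.
by rewrite rot_spt_same Cmult_1_r.
Qed.

Lemma off_cone_spt i j : j != i -> off_cone c 0 (th i - th j).
Proof.
move=> ji; right; have h := @sep i j; rewrite eq_sym in h; split; last exact: h.
by apply: Rmult_le_pos; [lra | apply: Rabs_pos].
Qed.

Lemma dist_spt i z : Cmod (1 - rot i * z) = Cmod (z - spt i).
Proof.
rewrite -(rot_spt_same i) (_ : rot i * spt i - rot i * z = rot i * (spt i - z))%C; last by ring.
by rewrite Cmod_mult Cmod_rot Rmult_1_l Cmod_sub_rev.
Qed.

Lemma in_dom_slit z i : in_dom z -> slit (1 - rot i * z).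
Proof. by move=> [x [y [-> h]]]; rewrite rot_pt; apply: off_cone_slit (h i). Qed.

Lemma in_dom_gam z i : in_dom z -> cdiff (fun w => gam (rot i * w))%C z.
Proof.
move=> [x [y [-> h]]]; apply: cdiff_comp; first exact: cdiff_scale.
by rewrite rot_pt; apply: gam_hol.
Qed.

Lemma spt_gam i j : j != i -> cdiff (fun w => gam (rot j * w))%C (spt i).
Proof.
move=> ji; apply: cdiff_comp; first exact: cdiff_scale.
by rewrite rot_spt; apply/gam_hol/off_cone_spt.
Qed.

Lemma spt_slit i j : j != i -> slit (1 - rot j * spt i).
Proof. by move=> ji; rewrite rot_spt; apply/off_cone_slit/off_cone_spt. Qed.

Lemma fgf_cdiff z : in_dom z -> cdiff fgf z.
Proof.
move=> hz; apply: cdiff_comp; last exact: cdiff_Cexp.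
apply: cdiff_csum => i _; apply: cdiff_mult; first exact: cdiff_const.
exact: in_dom_gam.
Qed.

(** The [i]-th local model is damped to order [L] at the other singular points, so
    that subtracting all models at once improves [fgf] at each singular point. *)
Definition damp (L : nat) (i : I) (z : C) : C :=
  \big[Cmult/RtoC 1]_(j | j != i) ((1 - rot j * z) ^ L)%C.
Definition model (L : nat) (i : I) (z : C) : C :=
  (sing_amp i / damp L i (spt i) * (Cexp (alpha i * llog (rot i * z)) * damp L i z))%C.

Lemma damp_neq0 L i : damp L i (spt i) <> RtoC 0.
Proof.
apply/Cmod_gt_0; rewrite Cmod_cprod; apply: Rprod_gt0 => j ji; rewrite Cmod_pow.
by apply/pow_lt/Cmod_gt_0/slit_neq0/spt_slit.
Qed.

Lemma damp_cdiff L i z : cdiff (damp L i) z.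
Proof. by apply: cdiff_cprod => j _; apply/cdiff_pow/cdiff_linear. Qed.

Lemma Cexp_llog_cdiff al i z : slit (1 - rot i * z) -> cdiff (fun z => Cexp (al * llog (rot i * z)))%C z.
Proof.
move=> h; apply: (@cdiff_comp (fun z => al * llog (rot i * z))%C Cexp); last exact: cdiff_Cexp.
apply: cdiff_mult; first exact: cdiff_const.
by apply: (@cdiff_comp (fun z => rot i * z)%C llog); [apply: cdiff_scale | apply: cdiff_llog].
Qed.

Lemma model_cdiff L i z : in_dom z -> cdiff (model L i) z.
Proof.
move=> hz; apply: cdiff_mult; first exact: cdiff_const.
apply: cdiff_mult; last exact: damp_cdiff.
exact: Cexp_llog_cdiff (in_dom_slit i hz).
Qed.

Lemma model_taylor L i : exists m, taylor (model L i) m /\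
  coef_asym (rot i) (alpha i) (sing_amp i * rGamma (alpha i)) m.
Proof.
have T := taylor_dilate (@rot_neq0 i) (taylor_power (alpha i)).
have A := coef_asym_dilate (Cmod_rot i) (bin_coef_asym (alpha i)).
case: (taylor_mul_prod (index_enum I) (fun j => j != i) rot L (Cmod_rot i) T A) => m [Tm Am].
exists (fun n => sing_amp i / damp L i (spt i) * m n)%C; split.
  exact: taylor_scal Tm.
have := coef_asym_scal (sing_amp i / damp L i (spt i)) Am.
have e : \big[Cmult/RtoC 1]_(j | j != i) ((1 - rot j / rot i) ^ L)%C = damp L i (spt i).
  by apply: eq_bigr => j _; rewrite /Cdiv inv_rot.
rewrite e (_ : _ * (rGamma (alpha i) * _) = sing_amp i * rGamma (alpha i))%C //.
by field; apply: damp_neq0.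
Qed.

Lemma Cmod_Cexp_llog al q : (1 - q)%C <> RtoC 0 ->
  Cmod (Cexp (al * llog q)) <= exp (PI * Rabs (Im al)) * Rpower (Cmod (1 - q)) (- Re al).
Proof.
move=> q0; have m0 : 0 < Cmod (1 - q) by apply/Cmod_gt_0.
rewrite Cmod_Cexp /Rpower -exp_plus; apply: exp_mono.
rewrite re_mult Re_llog //.
have h : Rabs (Im (llog q)) <= PI.
  have n0 : (1 / (1 - q))%C <> RtoC 0.
    by apply/Cmod_gt_0; rewrite Cmod_div // Cmod_1; apply: Rdiv_lt_0_compat => //; lra.
  by apply: Rabs_le; have := Carg_range n0; rewrite /llog /Clog /=; lra.
have := Rle_abs (- (Im al * Im (llog q))); rewrite Rabs_Ropp Rabs_mult.
have := Rabs_pos (Im al); have := Rabs_pos (Im (llog q)); nra.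
Qed.

Lemma model_other L i k : i != k -> exists d B, [/\ 0 < d, 0 <= B &
  forall z, Cmod (z - spt k) < d -> Cmod (model L i z) <= B * Cmod (z - spt k) ^ L].
Proof.
move=> ik; have ki : k != i by rewrite eq_sym.
pose rest z := (sing_amp i / damp L i (spt i) * (Cexp (alpha i * llog (rot i * z)) *
  \big[Cmult/RtoC 1]_(j | (j != i) && (j != k)) ((1 - rot j * z) ^ L)))%C.
have cr : ccont rest (spt k).
  apply: cdiff_ccont; apply: cdiff_mult; first exact: cdiff_const.
  apply: cdiff_mult; first by apply: Cexp_llog_cdiff; apply: spt_slit.
  by apply: cdiff_cprod => j _; apply/cdiff_pow/cdiff_linear.
case: (ccont_bounded cr) => d [B [d0 B0 H]]; exists d, B; split=> // z hz.
have -> : model L i z = (rest z * (1 - rot k * z) ^ L)%C.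
  have dE : damp L i z = ((1 - rot k * z) ^ L *
      \big[Cmult/RtoC 1]_(j | (j != i) && (j != k)) ((1 - rot j * z) ^ L))%C.
    by rewrite /damp (bigD1 k).
  by rewrite /model dE /rest; ring.
rewrite Cmod_mult Cmod_pow dist_spt; apply: Rmult_le_compat_r; last exact: H.
by apply: pow_le; apply: Cmod_ge_0.
Qed.

Lemma model_others L k (s : seq I) : exists d B, [/\ 0 < d, 0 <= B &
  forall z, Cmod (z - spt k) < d ->
    Cmod (\big[Cplus/RtoC 0]_(i <- s | i != k) model L i z) <= B * Cmod (z - spt k) ^ L].
Proof.
elim: s => [|i s [d [B [d0 B0 IH]]]].
  exists 1, 0; split; try lra; move=> z _; rewrite big_nil Cmod_0; lra.
case: (boolP (i != k)) => ik; last first.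
  by exists d, B; split=> // z hz; rewrite big_cons (negbTE ik); apply: IH.
case: (model_other L ik) => d' [B' [d0' B0' H]].
exists (Rmin d d'), (B' + B); split; [exact: Rmin_glb_lt | lra |] => z hz.
rewrite big_cons ik; apply: Rle_trans (Cmod_triangle _ _) _; rewrite Rmult_plus_distr_r.
apply: Rplus_le_compat; [apply: H | apply: IH].
  exact: Rlt_le_trans hz (Rmin_r _ _).
exact: Rlt_le_trans hz (Rmin_l _ _).
Qed.

(** [fgf] and the model share the singular factor, and their regular cofactors
    agree at the singular point, hence to first order near it. *)
Lemma model_main L k : exists d B, [/\ 0 < d, 0 <= B &
  forall z, in_dom z -> Cmod (z - spt k) < d ->
    Cmod (fgf z - model L k z) <=
    B * (Cmod (z - spt k) * Rpower (Cmod (z - spt k)) (- Re (alpha k)))].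
Proof.
pose E z := (\big[Cplus/RtoC 0]_(j | j != k) (b j * gam (rot j * z)))%C.
have dE : cdiff E (spt k).
  apply: cdiff_csum => j jk; apply: cdiff_mult; first exact: cdiff_const.
  exact: spt_gam.
pose Q z := (sing_amp k / damp L k (spt k) * damp L k z)%C.
have dQ : cdiff Q (spt k) by apply: cdiff_mult (damp_cdiff _ _ _); apply: cdiff_const.
have Q0 : Q (spt k) = sing_amp k by rewrite /Q; field; apply: damp_neq0.
case: (cdiff_lipschitz dE) => d1 [B1 [d10 B10 H1]].
case: (cdiff_lipschitz dQ) => d2 [B2 [d20 B20 H2]].
set A := sing_amp k in Q0; set P := exp (PI * Rabs (Im (alpha k))).
have P0 : 0 < P by apply: exp_pos.
have A0 := Cmod_ge_0 A; have bk0 := Cmod_ge_0 (b k).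
set B3 := B1 + Cmod (b k) * Mg.
have B30 : 0 <= B3 by have := Rmult_le_pos _ _ bk0 Mg_ge0; rewrite /B3; lra.
have d30 : 0 < / (2 * (B3 + 1)) by apply: Rinv_0_lt_compat; lra.
exists (Rmin (Rmin d1 d2) (Rmin dg (/ (2 * (B3 + 1))))), (P * (Cmod A * (7 * B3) + B2)); split.
- by repeat apply: Rmin_glb_lt.
- apply: Rmult_le_pos; first lra.
  by have : 0 <= Cmod A * (7 * B3); [apply: Rmult_le_pos; lra | lra].
move=> z hz hd.
have [/Rmin_Rgt_l [h1 h2] /Rmin_Rgt_l [h3 h4]] := Rmin_Rgt_l _ _ _ hd.
have {}H1 := H1 z h1; have {}H2 := H2 z h2.
have n0 := slit_neq0 (in_dom_slit k hz).
set w := Cmod (z - spt k) in h1 h2 h3 h4 H1 H2 *.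
have ew : Cmod (1 - rot k * z) = w by rewrite dist_spt.
have w0 : 0 < w by rewrite -ew; apply/Cmod_gt_0.
set q := (rot k * z)%C in n0 ew.
have hg : Cmod (gam q - (RtoC vt * llog q + K)) <= Mg * w.
  have [x [y [ez hc]]] := hz.
  have eq : q = Cexp (pt x (y - th k)) by rewrite /q ez rot_pt.
  by rewrite -ew eq; apply: gam_sing; rewrite -?eq ?ew.
set rho := (gam q - _)%C in hg.
set eta := (b k * rho + (E z - E (spt k)))%C.
have heta : Cmod eta <= B3 * w.
  have := Cmod_triangle (b k * rho) (E z - E (spt k)); rewrite -/eta Cmod_mult /B3.
  have : Cmod (b k) * Cmod rho <= Cmod (b k) * (Mg * w) by apply: Rmult_le_compat_l.
  lra.
have heta2 : Cmod eta <= 1/2.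
  apply: Rle_trans heta _.
  have : (B3 + 1) * w <= (B3 + 1) * / (2 * (B3 + 1)) by apply: Rmult_le_compat_l; lra.
  have -> : (B3 + 1) * / (2 * (B3 + 1)) = 1/2 by field; lra.
  lra.
have eF : fgf z = (Cexp (alpha k * llog q) * (A * Cexp eta))%C.
  rewrite /fgf (bigD1 k) //= -/(E z) -/q.
  have e0 : A = (Cexp (b k * K) * Cexp (E (spt k)))%C.
    rewrite /A /sing_amp; congr (_ * Cexp _)%C.
    by apply: eq_bigr => j _; rewrite rot_spt.
  rewrite e0 -!Cexp_add; congr Cexp; rewrite /eta /rho /alpha; ring.
have eT : model L k z = (Cexp (alpha k * llog q) * Q z)%C.
  by rewrite /model /Q -/q /A; ring.
rewrite eF eT (_ : _ - _ = Cexp (alpha k * llog q) * (A * (Cexp eta - 1) - (Q z - Q (spt k))))%C; last first.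
  by rewrite Q0; ring.
rewrite Cmod_mult.
have i1 := Cmod_Cexp_llog (alpha k) n0; rewrite ew -/P in i1.
have i2 : Cmod (A * (Cexp eta - 1) - (Q z - Q (spt k))) <= (Cmod A * (7 * B3) + B2) * w.
  apply: Rle_trans (Cmod_triangle _ _) _; rewrite Cmod_opp Cmod_mult.
  have : Cmod A * Cmod (Cexp eta - 1) <= Cmod A * (7 * (B3 * w)).
    apply: Rmult_le_compat_l => //; apply: Rle_trans (Cexp_lip heta2) _; lra.
  lra.
have -> : P * (Cmod A * (7 * B3) + B2) * (w * Rpower w (- Re (alpha k))) =
  P * Rpower w (- Re (alpha k)) * ((Cmod A * (7 * B3) + B2) * w) by ring.
by apply: Rmult_le_compat => //; apply: Cmod_ge_0.
Qed.

Definition remainder (L : nat) (z : C) : C := (fgf z - \csum_(i : I) model L i z)%C.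

Lemma sdist_cprod z : sdist z = Cmod (\big[Cmult/RtoC 1]_(i : I) (1 - rot i * z))%C.
Proof. by rewrite Cmod_cprod. Qed.

Lemma Rpower_between u lo hi a : 0 < lo -> lo <= u <= hi -> Rpower u a <= Rpower lo a + Rpower hi a.
Proof.
move=> l0 hu; have p1 := Rpower_gt0 lo a; have p2 := Rpower_gt0 hi a.
case: (Rle_lt_dec 0 a) => ha.
  by have := @Rpower_mono_l u hi a ltac:(lra) ltac:(lra) ha; lra.
by have := @Rpower_anti_l lo u a l0 ltac:(lra) ltac:(lra); lra.
Qed.

(** The point gains one order over its own singular term, and [L] makes the other
    models negligible; both are dominated by the order [vt beta - 1]. *)
Lemma remainder_at_sing L k : 1 - vt * beta <= INR L -> exists d M, 0 < d /\
  forall z, in_dom z -> Cmod (z - spt k) < d ->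
    Cmod (remainder L z) * Rpower (sdist z) (vt * beta - 1) <= M.
Proof.
move=> hL.
case: (model_main L k) => d1 [B1 [d10 B10 H1]].
case: (model_others L k (index_enum I)) => d2 [B2 [d20 B20 H2]].
pose V z := (\big[Cmult/RtoC 1]_(j | j != k) (1 - rot j * z))%C.
have cV : ccont V (spt k) by apply/cdiff_ccont; apply: cdiff_cprod => j _; apply: cdiff_linear.
have V0 : V (spt k) <> RtoC 0.
  apply/Cmod_gt_0; rewrite Cmod_cprod; apply: Rprod_gt0 => j jk.
  by apply/Cmod_gt_0/slit_neq0/spt_slit.
case: (ccont_away cV V0) => d3 [lo [hi [d30 lo0 hi0 H3]]].
pose a := vt * beta - 1; pose CV := Rpower lo a + Rpower hi a.
exists (Rmin (Rmin d1 d2) (Rmin d3 1)), ((B1 + B2) * CV); split.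
  by repeat apply: Rmin_glb_lt => //; lra.
move=> z hz hd.
have [/Rmin_Rgt_l [h1 h2] /Rmin_Rgt_l [h3 h4]] := Rmin_Rgt_l _ _ _ hd.
have {}H1 := H1 z hz h1; have {}H2 := H2 z h2; have {}H3 := H3 z h3.
have w0 : 0 < Cmod (z - spt k).
  by rewrite -dist_spt; apply/Cmod_gt_0/slit_neq0/in_dom_slit.
have es : sdist z = Cmod (z - spt k) * Cmod (V z).
  by rewrite sdist_cprod (bigD1 k) //= Cmod_mult dist_spt.
rewrite es; set w := Cmod (z - spt k) in H1 H2 w0 h4 *; clearbody w.
have p0 := Rpower_gt0 w (- a).
have exps e : - a <= e -> Rpower w e <= Rpower w (- a).
  move=> he; apply: exp_mono.
  have : ln w <= 0 by rewrite -ln_1; apply: ln_le; lra.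
  nra.
have wp : w * Rpower w (- Re (alpha k)) = Rpower w (1 - Re (alpha k)).
  by rewrite /Rminus Rpower_plus Rpower_1.
have e1 : w * Rpower w (- Re (alpha k)) <= Rpower w (- a).
  rewrite wp; apply: exps; rewrite /a /alpha re_scal_l.
  have := b_le k; nra.
have e2 : w ^ L <= Rpower w (- a).
  by rewrite -Rpower_pow //; apply: exps; rewrite /a; lra.
have hR : Cmod (remainder L z) <= (B1 + B2) * Rpower w (- a).
  have -> : remainder L z = (fgf z - model L k z - \big[Cplus/RtoC 0]_(i | i != k) model L i z)%C.
    by rewrite /remainder (bigD1 k) //=; ring.
  apply: Rle_trans (Cmod_triangle _ _) _; rewrite Cmod_opp Rmult_plus_distr_r.
  apply: Rplus_le_compat; first by apply: Rle_trans H1 _; apply: Rmult_le_compat_l.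
  by apply: Rle_trans H2 _; apply: Rmult_le_compat_l.
have hV : Rpower (w * Cmod (V z)) a <= Rpower w a * CV.
  rewrite -Rpower_mult_distr //; last lra.
  apply: Rmult_le_compat_l; first exact/Rlt_le/Rpower_gt0.
  exact: Rpower_between.
have -> : (B1 + B2) * CV = (B1 + B2) * Rpower w (- a) * (Rpower w a * CV).
  by rewrite Rpower_Ropp; field; have := Rpower_gt0 w a; lra.
by apply: Rmult_le_compat => //; [apply: Cmod_ge_0 | apply/Rlt_le/Rpower_gt0].
Qed.

Lemma remainder_cdiff L z : in_dom z -> cdiff (remainder L) z.
Proof.
move=> hz; have S : cdiff (fun z => \csum_(i : I) model L i z)%C z.
  by apply: cdiff_csum => i _; apply: model_cdiff.
have [l h] := cdiff_plus (fgf_cdiff hz) (cdiff_mult (cdiff_const (- RtoC 1) z) S).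
by exists l; apply: cder_ext h => w; rewrite /remainder; ring.
Qed.

Lemma remainder_at_regular L a z0 : in_dom z0 -> exists d M, 0 < d /\
  forall z, Cmod (z - z0) < d -> Cmod (remainder L z) * Rpower (sdist z) a <= M.
Proof.
move=> hz0; case: (ccont_bounded (cdiff_ccont (remainder_cdiff L hz0))) => d1 [B [d10 B0 H1]].
pose V z := (\big[Cmult/RtoC 1]_(j : I) (1 - rot j * z))%C.
have cV : ccont V z0 by apply/cdiff_ccont; apply: cdiff_cprod => j _; apply: cdiff_linear.
have V0 : V z0 <> RtoC 0.
  apply/Cmod_gt_0; rewrite Cmod_cprod; apply: Rprod_gt0 => j _.
  by apply/Cmod_gt_0/slit_neq0/in_dom_slit.
case: (ccont_away cV V0) => d2 [lo [hi [d20 lo0 hi0 H2]]].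
exists (Rmin d1 d2), (B * (Rpower lo a + Rpower hi a)); split; first exact: Rmin_glb_lt.
move=> z hz; have h1 := H1 z (Rlt_le_trans _ _ _ hz (Rmin_l _ _)).
have h2 := H2 z (Rlt_le_trans _ _ _ hz (Rmin_r _ _)).
apply: Rmult_le_compat => //; [exact: Cmod_ge_0 | exact/Rlt_le/Rpower_gt0 |].
by rewrite sdist_cprod; apply: Rpower_between.
Qed.

Lemma pt_dist x y x0 y0 : Cmod (pt x y - pt x0 y0) <= Rabs (x - x0) + Rabs (y - y0).
Proof. exact: Cmod_le_abs. Qed.

(** Every point of the closed strip is singular, lies in the domain, or has a
    neighbourhood outside the domain. *)
Lemma remainder_local L x0 y0 : 1 - vt * beta <= INR L -> exists d M, 0 < d /\
  forall x y, Rabs (x - x0) < d -> Rabs (y - y0) < d ->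
    (forall i, off_cone c x (y - th i)) ->
    Cmod (remainder L (Cexp (pt x y))) * Rpower (sdist (Cexp (pt x y))) (vt * beta - 1) <= M.
Proof.
move=> hL.
have pull z0 d M : z0 = Cexp (pt x0 y0) -> 0 < d -> (forall z, in_dom z -> Cmod (z - z0) < d ->
    Cmod (remainder L z) * Rpower (sdist z) (vt * beta - 1) <= M) ->
  exists d M, 0 < d /\ forall x y, Rabs (x - x0) < d -> Rabs (y - y0) < d ->
    (forall i, off_cone c x (y - th i)) ->
    Cmod (remainder L (Cexp (pt x y))) * Rpower (sdist (Cexp (pt x y))) (vt * beta - 1) <= M.
  move=> -> d0 H; case: (cder_cont (cder_Cexp (pt x0 y0)) d0) => e [e0 He].
  exists (e / 2), M; split=> [|x y hx hy hc]; first lra.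
  apply: H; first by exists x, y.
  by apply: He; apply: Rle_lt_trans (pt_dist _ _ _ _) _; lra.
case: (classic (exists i, c * Rabs (sin ((y0 - th i) / 2)) < x0)) => [[i hi]|no].
  set s := Rabs _ in hi; have s0 : 0 <= s by apply: Rabs_pos.
  have x00 : 0 < x0 by have := Rmult_le_pos c s; lra.
  set d := (x0 - c * s) / (c + 2).
  have d0 : 0 < d by apply: Rdiv_lt_0_compat; lra.
  have ed : d * (c + 2) = x0 - c * s by rewrite /d; field; lra.
  exists d, 0; split=> // x y /Rabs_def2 hx hy /(_ i) hc; exfalso.
  have sl : Rabs (sin ((y - th i) / 2)) <= s + d.
    have t := sin_abs_le ((y - y0) / 4).
    set u := (y - th i) / 2; set v := (y0 - th i) / 2.
    have E : sin u = sin v + 2 * (cos ((u + v) / 2) * sin ((u - v) / 2)).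
      by have := form4 u v; lra.
    have uv : (u - v) / 2 = (y - y0) / 4 by rewrite /u /v; field.
    rewrite E uv; apply: Rle_trans (Rabs_triang _ _) _; rewrite -/s.
    rewrite (Rabs_mult 2) (Rabs_pos_eq 2); last lra.
    rewrite Rabs_mult; have : Rabs (cos ((u + v) / 2)) <= 1.
      by apply: Rabs_le; have := COS_bound ((u + v) / 2); lra.
    have : Rabs ((y - y0) / 4) <= d / 4.
      by rewrite Rabs_div ?(Rabs_pos_eq 4); lra.
    have := Rabs_pos (cos ((u + v) / 2)); have := Rabs_pos (sin ((y - y0) / 4)); nra.
  case: hc => [|[]]; first by nra.
  by move=> h _; nra.
have le i : x0 <= c * Rabs (sin ((y0 - th i) / 2)).
  by case: (Rle_lt_dec x0 (c * Rabs (sin ((y0 - th i) / 2)))) => // h; case: no; exists i.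
case: (classic (exists k, sin ((y0 - th k) / 2) = 0 /\ x0 = 0)) => [[k [sk xk]]|reg].
  have ez : spt k = Cexp (pt x0 y0).
    have q1 : (rot k * Cexp (pt x0 y0) = 1)%C.
      have := cos_half (y0 - th k); have := sin_2a ((y0 - th k) / 2).
      rewrite rot_pt xk sk (_ : 2 * ((y0 - th k) / 2) = y0 - th k); last by field.
      move=> s1 c1; rewrite /Cexp /= exp_0 s1 c1; congr pair; ring.
    by rewrite -[LHS]Cmult_1_r -q1 Cmult_assoc (Cmult_comm (spt k)) rot_spt_same Cmult_1_l.
  case: (remainder_at_sing k hL) => d [M [d0 H]].
  exact: pull ez d0 H.
have dom : in_dom (Cexp (pt x0 y0)).
  exists x0, y0; split=> // i; case: (Rlt_le_dec x0 0) => hx; first by left.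
  right; split=> // s0; apply: reg; exists i; split=> //.
  by have := le i; rewrite s0 Rabs_R0; lra.
case: (remainder_at_regular L (vt * beta - 1) dom) => d [M [d0 H]].
by apply: (pull _ d M erefl d0) => z _; apply: H.
Qed.

Lemma remainder_bound L : 1 - vt * beta <= INR L -> exists M, forall x y,
  -1 <= x <= 1 -> 0 <= y <= 2 * PI -> (forall i, off_cone c x (y - th i)) ->
  Cmod (remainder L (Cexp (pt x y))) * Rpower (sdist (Cexp (pt x y))) (vt * beta - 1) <= M.
Proof.
move=> hL; have pi0 := PI_RGT_0.
case: (@box_bounded (fun s t => forall i, off_cone c (2 * s - 1) (2 * PI * t - th i))
  (fun s t => Cmod (remainder L (Cexp (pt (2 * s - 1) (2 * PI * t)))) *
     Rpower (sdist (Cexp (pt (2 * s - 1) (2 * PI * t)))) (vt * beta - 1))) => [s t hs ht|M H].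
  case: (remainder_local (2 * s - 1) (2 * PI * t) hL) => d [M [d0 H]].
  exists (Rmin (d / 2) (d / (2 * PI))), M; split.
    by apply: Rmin_glb_lt; apply: Rdiv_lt_0_compat; lra.
  move=> s' t' hs' ht'; apply: H.
    have -> : 2 * s' - 1 - (2 * s - 1) = 2 * (s' - s) by ring.
    rewrite Rabs_mult (Rabs_pos_eq 2); last lra.
    by have := Rlt_le_trans _ _ _ hs' (Rmin_l _ _); lra.
  have -> : 2 * PI * t' - 2 * PI * t = 2 * PI * (t' - t) by ring.
  rewrite Rabs_mult (Rabs_pos_eq (2 * PI)); last lra.
  have h := Rlt_le_trans _ _ _ ht' (Rmin_r _ _).
  have -> : d = 2 * PI * (d / (2 * PI)) by field; lra.
  by apply: Rmult_lt_compat_l; lra.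
exists M => x y hx hy hc.
have ex : x = 2 * ((x + 1) / 2) - 1 by field.
have ey : y = 2 * PI * (y / (2 * PI)) by field; lra.
have := H ((x + 1) / 2) (y / (2 * PI)); rewrite -ex -ey; apply=> //; first lra.
split; first by apply: Rdiv_le_0_compat; lra.
by apply/Rle_div_l; lra.
Qed.

Lemma coef_asym_mono xi al g m a : Re al <= a -> coef_asym xi al g m ->
  exists M n0, 0 <= M /\ forall n, (n0 <= n)%N ->
    Cmod (m n - xi ^ n * Rcpow (INR n) (al - 1) * g) <= M * Rpower (INR n) (a - 2).
Proof.
move=> ha [M [n0 [M0 H]]]; exists M, n0.+1; split=> // n hn.
have N1 : 1 <= INR n by rewrite -[1]/(INR 1); apply: le_INR; apply/leP; apply: leq_trans hn.
apply: Rle_trans (H n (ltnW hn)) _; apply: Rmult_le_compat_l => //.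
apply: exp_mono; apply: Rmult_le_compat_r; last lra.
by rewrite -ln_1; apply: ln_le; lra.
Qed.

(** The models have known coefficients; the remainder grows one order less than
    the largest singular term, and [transfer] bounds its coefficients.  The error
    is relative to the largest term only. *)
Theorem singularity_analysis (i0 : I) p :
  exp_coef (fun k => \csum_(i : I) (b i * (rot i ^ k * tau k)))%C p ->
  exists D n0, forall n, (n0 <= n)%N ->
    Cmod (p n - \csum_(i : I) (rot i ^ n * Rcpow (INR n) (alpha i - 1) * (sing_amp i * rGamma (alpha i))))
      <= D * Rpower (INR n) (vt * beta - 2).
Proof.
move=> ep; case: (INR_unbounded (1 - vt * beta)) => L /Rgt_lt/Rlt_le hL.
have Tf : taylor fgf p.
  apply: taylor_exp ep.
  have T := taylor_csum (index_enum I) (fun i => taylor_scal (b i) (taylor_dilate (@rot_neq0 i) gam_taylor)).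
  apply: taylor_ext T => // -[|k].
    by rewrite big1 // => i _; rewrite /= !Cmult_0_r.
  rewrite /Cdiv [RHS]Cmult_comm csum_mull; apply: eq_bigr => i _.
  by rewrite /Cdiv; ring.
have [m mP] : exists m : I -> nat -> C, forall i, taylor (model L i) (m i) /\
    coef_asym (rot i) (alpha i) (sing_amp i * rGamma (alpha i)) (m i).
  exact: (choice (fun i m => taylor (model L i) m /\ coef_asym (rot i) (alpha i) (sing_amp i * rGamma (alpha i)) m) (model_taylor L)).
have TH : taylor (remainder L) (fun n => p n - \csum_(i : I) m i n)%C.
  have T := taylor_plus Tf (taylor_scal (- RtoC 1) (taylor_csum (index_enum I) (fun i => proj1 (mP i)))).
  by apply: taylor_ext T => [z|n]; rewrite /remainder; ring.
case: (remainder_bound hL) => M HM.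
case: (@transfer I th c (remainder L) _ (vt * beta - 1) M sep range i0 c_gt0 TH) => [x y hc|x y hx hy hc|D HD].
- by apply: remainder_cdiff; exists x, y.
- have := HM x y hx hy hc; rewrite /sdist /sing_dist.
  by under eq_bigr => i _ do rewrite rot_pt.
have al_le i : Re (alpha i) <= vt * beta.
  by rewrite /alpha re_scal_l; apply: Rmult_le_compat_l; [lra | exact: b_le].
have [D' [n1 [D0' HD']]] : exists D' n1, 0 <= D' /\ forall n, (n1 <= n)%N ->
    Cmod (\csum_(i : I) m i n - \csum_(i : I) (rot i ^ n * Rcpow (INR n) (alpha i - 1) * (sing_amp i * rGamma (alpha i))))
      <= D' * Rpower (INR n) (vt * beta - 2).
  elim: (index_enum I) => [|i s [D1 [n1 [D10 IH]]]].
    exists 0, 0%N; split=> [|n _]; first lra.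
    by rewrite !big_nil (_ : 0 - 0 = RtoC 0)%C ?Cmod_0; [lra | ring].
  case: (coef_asym_mono (al_le i) (proj2 (mP i))) => D2 [n2 [D20 H2]].
  exists (D2 + D1), (n1 + n2)%N; split=> [|n hn]; first lra.
  have {}IH := IH n (leq_trans (leq_addr _ _) hn).
  have {}H2 := H2 n (leq_trans (leq_addl _ _) hn).
  rewrite !big_cons Rmult_plus_distr_r.
  set X := m i n in H2 *; set Y := (rot i ^ n * _ * _)%C in H2 *.
  set S1 := \big[Cplus/RtoC 0]_(j <- s) m j n in IH *; set S2 := \big[Cplus/RtoC 0]_(j <- s) _ in IH *.
  rewrite (_ : X + S1 - (Y + S2) = (X - Y) + (S1 - S2))%C; last by ring.
  apply: Rle_trans (Cmod_triangle _ _) _; exact: Rplus_le_compat.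
exists (D + D'), n1.+1 => n hn.
have h1 := HD n (leq_trans (ltn0Sn _) hn); have h2 := HD' n (ltnW hn).
rewrite (_ : vt * beta - 1 - 1 = vt * beta - 2) in h1; last by ring.
rewrite Rmult_plus_distr_r; apply: Rle_trans (Cmod_triang_minus _ (\csum_(i : I) m i n) _) _.
exact: Rplus_le_compat.
Qed.

End Singularities.

(** * From the class F to the complement of a cone *)

Lemma Carg_gt w phi : 0 < phi < PI / 2 -> w <> RtoC 0 -> Re w < cos phi * Cmod w ->
  phi < Rabs (Carg w).
Proof.
move=> hphi w0 h; case: (Rlt_le_dec phi (Rabs (Carg w))) => // hle; exfalso.
have m0 : 0 < Cmod w by apply/Cmod_gt_0.
have cc : cos (Rabs (Carg w)) = Re w / Cmod w.
  by rewrite -(cos_Carg w0) /Rabs; case: Rcase_abs => _ //=; rewrite cos_neg.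
have : cos phi <= Re w / Cmod w.
  by rewrite -cc; apply: cos_decr_1; have := Rabs_pos (Carg w); lra.
by move/(proj2 (Rle_div_r _ _ _ m0)); lra.
Qed.

Lemma Re_q_sub1 x p : Re (Cexp (pt x p) - 1) = exp x * cos p - 1.
Proof. by rewrite re_plus re_opp. Qed.

Lemma Im_q_sub1 x p : Im (Cexp (pt x p) - 1) = exp x * sin p.
Proof. by rewrite im_plus im_opp /=; ring. Qed.

(** On the complement of a thin cone the real part of [q - 1] is at most a small
    multiple of the absolute value of the imaginary part. *)
Lemma off_cone_Delta0 r R0 phi : 0 < r -> r < R0 -> 0 < phi < PI / 2 ->
  exists c, 0 < c /\ forall x p, off_cone c x p -> Delta0 r R0 phi (RtoC r * Cexp (pt x p)).
Proof.
move=> r0 rR hphi; have cp : 0 < cos phi by apply: cos_gt_0; lra.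
have cp1 : cos phi <= 1 by have := COS_bound phi; lra.
have lR : 0 < ln (R0 / r).
  by rewrite -ln_1; apply: ln_increasing; [lra | apply/Rlt_div_r; lra].
set c := Rmin (cos phi / 8) (ln (R0 / r) / 2).
have c0 : 0 < c by apply: Rmin_glb_lt; lra.
have c1 : c <= cos phi / 8 by apply: Rmin_l.
have c2 : c <= ln (R0 / r) / 2 by apply: Rmin_r.
exists c; split=> // x p hc; set q := Cexp (pt x p).
have q1 : (q - 1)%C <> RtoC 0.
  move=> e; apply: (slit_neq0 (off_cone_slit hc)); rewrite -/q.
  have -> : (1 - q = - (q - 1))%C by ring.
  by rewrite e; ring.
have xc : x <= c.
  case: hc => [h|[h _]]; first lra.
  by apply: Rle_trans h _; have := Rabs_sin_le1 (p / 2); have := Rabs_pos (sin (p / 2)); nra.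
have ez : (RtoC r * q - RtoC r = RtoC r * (q - 1))%C by ring.
have rC : RtoC r <> RtoC 0 by move=> /RtoC_inj; lra.
split.
- rewrite Cmod_mult Cmod_R Rabs_pos_eq; last lra.
  rewrite Cmod_Cexp /=; have : exp x < exp (ln (R0 / r)) by apply: exp_increasing; lra.
  rewrite exp_ln; last by apply: Rdiv_lt_0_compat; lra.
  by move/(proj2 (Rlt_div_r _ _ _ r0)); lra.
- by move=> e; apply: (Cmult_neq_0 _ _ rC q1); rewrite -ez e; ring.
apply: Carg_gt => //; rewrite ez; first exact: Cmult_neq_0.
rewrite Cmod_mult Cmod_R Rabs_pos_eq; last lra.
rewrite re_scal_l -Rmult_assoc (Rmult_comm _ r) Rmult_assoc; apply: Rmult_lt_compat_l => //.
have m0 : 0 < Cmod (q - 1) by apply/Cmod_gt_0.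
case: (Rle_lt_dec (Re (q - 1)) 0) => hX.
  by have := Rmult_lt_0_compat _ _ cp m0; lra.
have hI := im_le_Cmod (q - 1).
suff : Re (q - 1) <= cos phi / 2 * Rabs (Im (q - 1)).
  by have := Rabs_pos (Im (q - 1)); nra.
rewrite Re_q_sub1 Im_q_sub1 in hX *; have ep := exp_pos x.
case: hc => [xn|[xs sn]].
  have : exp x < 1 by rewrite -exp_0; apply: exp_increasing.
  by have := COS_bound p; nra.
set S := Rabs (sin (p / 2)) in xs; have S0 : 0 < S by apply: Rabs_pos_lt.
have S2 : sin (p / 2) ^ 2 = S ^ 2 by rewrite /S pow2_abs.
rewrite cos_half S2 in hX *.
have cS : 0 < c * S by apply: Rmult_lt_0_compat.
have x0 : 0 <= x.
  case: (Rle_lt_dec 0 x) => // xn.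
  have : exp x < 1 by rewrite -exp_0; apply: exp_increasing.
  by have := pow2_ge_0 S; nra.
have e1 : 1 <= exp x by have := exp_ineq1_le x; lra.
have e2 : exp x <= 1 + 2 * x.
  apply: Rle_trans (@exp_le_inv x ltac:(lra)) _.
  by apply: (Rmult_le_reg_l (1 - x)); [lra | rewrite Rinv_r; [nra | lra]].
have Sc : S < c.
  have : 2 * S ^ 2 <= exp x * (2 * S ^ 2) by have := pow2_ge_0 S; nra.
  move=> h; have : 2 * S ^ 2 < 2 * (c * S) by lra.
  by rewrite /= Rmult_1_r => h2; apply: (Rmult_lt_reg_r S); lra.
have hs : Rabs (sin p) = 2 * (S * Rabs (cos (p / 2))).
  rewrite {1}(_ : p = 2 * (p / 2)); last by field.
  by rewrite sin_2a !Rabs_mult (Rabs_pos_eq 2) -/S; [ring | lra].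
have hcos : 1/2 <= Rabs (cos (p / 2)).
  apply: sqr_le_inv; first exact: Rabs_pos.
  rewrite pow2_abs; have := sin2_cos2 (p / 2); rewrite !Rsqr_pow2 S2.
  have : S ^ 2 <= (1/8) ^ 2 by apply: pow_incr; lra.
  lra.
rewrite Rabs_mult (Rabs_pos_eq (exp x)) ?hs; last lra.
have : S <= exp x * (2 * (S * Rabs (cos (p / 2)))).
  have : S <= 2 * (S * Rabs (cos (p / 2))) by nra.
  nra.
have : exp x * (1 - 2 * S ^ 2) - 1 <= 2 * (c * S).
  have := pow2_ge_0 S; nra.
nra.
Qed.

Lemma exp_coef_scale (a p : nat -> C) (r : C) :
  exp_coef a p -> exp_coef (fun k => r ^ k * a k)%C (fun k => r ^ k * p k)%C.
Proof.
case=> p0 H; split=> [|n]; first by rewrite p0 /=; ring.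
rewrite (_ : _ * _ = r ^ n.+1 * (RtoC (INR n.+1) * p n.+1))%C; last by ring.
rewrite H csum_mull; apply: eq_bigr => k _.
have e : (r ^ n.+1 = r ^ k.+1 * r ^ (n - k)%N)%C.
  by rewrite -Cpow_add_r plusE addSn subnKC // -ltnS.
by rewrite e; ring.
Qed.

Lemma exp_coef_ext (a a' p : nat -> C) :
  (forall k, a k.+1 = a' k.+1) -> exp_coef a p -> exp_coef a' p.
Proof.
move=> e [p0 H]; split=> // n; rewrite H.
by apply: eq_bigr => k _; rewrite e.
Qed.

(** * Ewens expectations as quotients of coefficients *)

Lemma RtoC_prod (I : Type) (s : seq I) (Q : pred I) (F : I -> R) :
  RtoC (\big[Rmult/1]_(i <- s | Q i) F i) = \big[Cmult/RtoC 1]_(i <- s | Q i) RtoC (F i).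
Proof. by apply: (big_morph _ RtoC_mult erefl). Qed.

Lemma RtoC_sum (I : Type) (s : seq I) (Q : pred I) (F : I -> R) :
  RtoC (\big[Rplus/0]_(i <- s | Q i) F i) = \big[Cplus/RtoC 0]_(i <- s | Q i) RtoC (F i).
Proof. by apply: (big_morph _ RtoC_plus erefl). Qed.

Lemma ewens_weight_cycles theta N (s : 'S_N) :
  ewens_weight theta s = \big[Rmult/1]_(c in porbits s) theta #|c|.
Proof.
rewrite /ewens_weight; transitivity
  (\big[Rmult/1]_(1 <= k < N.+1) \big[Rmult/1]_(c in porbits s | #|c| == k) theta #|c|).
  apply: eq_bigr => k _; rewrite /cycle_count.
  rewrite (eq_bigr (fun=> theta k)); last by move=> c /andP [_ /eqP ->].
  rewrite big_const.
  have -> : #|[set c in porbits s | #|c| == k]| = #|[pred c | (c \in porbits s) && (#|c| == k)]|.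
    by apply: eq_card => c; rewrite !inE.
  by elim: #|_| => //= m ->.
rewrite (exchange_big_dep (fun c => c \in porbits s)) /=; last by move=> k c _ /andP [].
apply: eq_bigr => c hc; rewrite (eq_bigl (fun k => k == #|c|)); last first.
  by move=> k; rewrite hc eq_sym.
rewrite (big_nat1_eq _ (fun=> theta #|c|)) ltnS.
case/imsetP: hc => x _ ->; rewrite lt0n card_porbit_neq0 /=.
by have := max_card (mem (porbit s x)); rewrite card_ord => ->.
Qed.

Lemma ewens_weight_sum theta N :
  RtoC (\big[Rplus/0]_(s : 'S_N) ewens_weight theta s) = cyc_sum N (fun k => RtoC (theta k)).
Proof.
by rewrite RtoC_sum; apply: eq_bigr => s _; rewrite ewens_weight_cycles RtoC_prod.
Qed.

Lemma ewens_h_gt0 theta N : (forall k : nat, (1 <= k)%N -> 0 < theta k) -> 0 < ewens_h theta N.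
Proof.
move=> th0; apply: Rmult_lt_0_compat; first by apply/Rinv_0_lt_compat/INR_factn_gt0.
have w0 (s : 'S_N) : 0 < ewens_weight theta s.
  rewrite ewens_weight_cycles; apply: Rprod_gt0 => c /imsetP [x _ ->].
  by apply: th0; rewrite lt0n card_porbit_neq0.
apply: Rlt_le_trans (w0 (@perm_one _)) _.
by apply: (Rsum_ge_term (F := fun s => ewens_weight theta s)) => s; apply/Rlt_le.
Qed.

Lemma ewens_h_coef theta N : RtoC (ewens_h theta N) =
  (RtoC (/ INR N`!) * cyc_sum N (fun k => RtoC (theta k)))%C.
Proof. by rewrite /ewens_h RtoC_mult ewens_weight_sum. Qed.

(** The Ewens weight and [W] are both products over the cycles, so numerator and
    normalisation are cycle index sums. *)
Lemma ewens_expect_ratio theta N P x1 x2 :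
  (forall k : nat, (1 <= k)%N -> 0 < theta k) ->
  ewens_expect theta (@W N P x1 x2) =
  ((RtoC (/ INR N`!) * cyc_sum N (fun k => RtoC (theta k) * beval P (x1 ^ k) (x2 ^ k)))
   / (RtoC (/ INR N`!) * cyc_sum N (fun k => RtoC (theta k))))%C.
Proof.
move=> th0; have h0 := ewens_h_gt0 N th0.
have f0 := INR_factn_gt0 N.
have hC : RtoC (ewens_h theta N) <> RtoC 0 by move=> /RtoC_inj; lra.
have fC := @RtoC_factn_neq0 N.
rewrite -ewens_h_coef /ewens_expect.
transitivity (RtoC (/ (ewens_h theta N * INR N`!)) *
   cyc_sum N (fun k => RtoC (theta k) * beval P (x1 ^ k) (x2 ^ k)))%C.
  rewrite /cyc_sum csum_mull; apply: eq_bigr => s _.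
  rewrite /ewens_prob RtoC_mult ewens_weight_cycles RtoC_prod /W -Cmult_assoc; congr (_ * _)%C.
  by rewrite /cyc_prod big_split.
rewrite !RtoC_inv; try lra; last by apply/Rgt_not_eq/Rmult_lt_0_compat.
by rewrite RtoC_mult; field.
Qed.

(** * Quotients of asymptotic expansions *)

Lemma Cmod_csum_Rpower (I : Type) (s : seq I) (F : I -> nat -> C) (e : I -> R) a :
  (forall i, e i <= a) ->
  (forall i, exists c, 0 <= c /\ forall n, (0 < n)%N -> Cmod (F i n) <= c * Rpower (INR n) (e i)) ->
  exists c, 0 <= c /\ forall n, (0 < n)%N ->
    Cmod (\big[Cplus/RtoC 0]_(i <- s) F i n) <= c * Rpower (INR n) a.
Proof.
move=> he H; elim: s => [|i s [c [c0 IH]]].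
  by exists 0; split=> [|n _]; [lra | rewrite big_nil Cmod_0; lra].
case: (H i) => d [d0 Hd]; exists (d + c); split=> [|n n0]; first lra.
rewrite big_cons Rmult_plus_distr_r; apply: Rle_trans (Cmod_triangle _ _) _.
apply: Rplus_le_compat; last exact: IH.
apply: Rle_trans (Hd n n0) _; apply: Rmult_le_compat_l => //.
have N1 : 1 <= INR n by rewrite -[1]/(INR 1); apply: le_INR; apply/leP.
apply: exp_mono; apply: Rmult_le_compat_r; last exact: he.
by rewrite -ln_1; apply: ln_le; lra.
Qed.

Lemma Rcpow_add x s t : (Rcpow x (s + t) = Rcpow x s * Rcpow x t)%C.
Proof. by rewrite /Rcpow -Cexp_add; congr Cexp; ring. Qed.

(** The error is relative to a term of largest exponent only, which is all that the
    expansion of the numerator provides. *)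
Lemma ratio_asym (I : finType) (xi b amp gm : I -> C) (vt beta : R) (L : C) (p h : nat -> C) D D' n0 n1 :
  (forall i, Cmod (xi i) = 1) -> (forall i, Re (b i) <= beta) -> 0 < vt -> L <> RtoC 0 ->
  (forall n, (n0 <= n)%N -> Cmod (p n - \csum_(i : I)
     (xi i ^ n * Rcpow (INR n) (RtoC vt * b i - 1) * (amp i * gm i))) <= D * Rpower (INR n) (vt * beta - 2)) ->
  (forall n, (n1 <= n)%N ->
     Cmod (h n - Rcpow (INR n) (RtoC vt - 1) * L) <= D' * Rpower (INR n) (vt - 2)) ->
  exists M n2, forall n, (n2 <= n)%N ->
    Cmod (p n / h n - \csum_(i : I)
      (amp i / L * Rcpow (INR n) (RtoC vt * (b i - 1)) * xi i ^ n * gm i))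
      <= M * Rpower (INR n) (vt * (beta - 1) - 1).
Proof.
move=> x1 hb vt0 L0 Hp Hh.
have G0 : 0 < Cmod L by apply/Cmod_gt_0.
set G := Cmod L in G0.
pose S n := (\csum_(i : I) (xi i ^ n * Rcpow (INR n) (RtoC vt * b i - 1) * (amp i * gm i)))%C.
have [CS [CS0 HS]] : exists c, 0 <= c /\ forall n, (0 < n)%N -> Cmod (S n) <= c * Rpower (INR n) (vt * beta - 1).
  apply: (@Cmod_csum_Rpower I (index_enum I) (fun i n => xi i ^ n * Rcpow (INR n) (RtoC vt * b i - 1) * (amp i * gm i))%C
    (fun i => vt * Re (b i) - 1)) => i.
    by have := hb i; nra.
  exists (Cmod (amp i * gm i)); split=> [|n _]; first exact: Cmod_ge_0.
  rewrite !(Cmod_mult (_ * _)) Cmod_mult Cmod_pow x1 pow1 Rmult_1_l Cmod_Rcpow_sub1 re_scal_l.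
  by apply: Req_le; ring.
case: (INR_unbounded (2 * (Rabs D' / G) + 1)) => n3 hn3.
exists (2 * Rabs D / G + 2 * CS * Rabs D' / G ^ 2), (n0 + n1 + n3.+1)%N => n hn.
have hn0 : (n0 <= n)%N by apply: leq_trans hn; rewrite -addnA leq_addr.
have hn1 : (n1 <= n)%N by apply: leq_trans hn; rewrite addnAC; apply: leq_addl.
have hn3' : (n3 < n)%N by apply: leq_trans hn; apply: leq_addl.
have n_gt0 : (0 < n)%N by apply: leq_ltn_trans hn3'.
have {}Hp := Hp n hn0; have {}Hh := Hh n hn1; have {}HS := HS n n_gt0.
rewrite -/(S n) in Hp; set N := INR n in Hp Hh HS *.
have N3 : INR n3 <= N by apply: le_INR; apply/leP; apply: ltnW.
have q0 : 0 <= Rabs D' / G by apply: Rdiv_le_0_compat => //; apply: Rabs_pos.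
have N1 : 1 <= N by lra.
set T := Rcpow N (RtoC vt - 1); have T0 : T <> RtoC 0 by apply: Rcpow_neq0.
have mT : Cmod T = Rpower N (vt - 1) by rewrite /T Cmod_Rcpow_sub1.
set t := Rpower N (vt - 1) in mT; have t0 : 0 < t by apply: Rpower_gt0.
have e2 : Rpower N (vt - 2) = t * / N by apply: Rpower_sub2.
have h0n : (T * L)%C <> RtoC 0 by apply: Cmult_neq_0.
have m0 : Cmod (T * L) = t * G by rewrite Cmod_mult mT.
have hd : Cmod (h n - T * L) <= Rabs D' * (t * / N).
  apply: Rle_trans Hh _; rewrite e2; apply: Rmult_le_compat_r; last exact: Rle_abs.
  by apply: Rmult_le_pos; [lra | apply/Rlt_le/Rinv_0_lt_compat; lra].
have hG : Rabs D' * (t * / N) <= t * G / 2.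
  have : Rabs D' * / N <= G / 2.
    apply/Rle_div_l; first lra.
    have : Rabs D' = Rabs D' / G * G by field; lra.
    nra.
  nra.
have hlow : t * G / 2 <= Cmod (h n).
  have := Cmod_ge_sub (T * L) (h n); rewrite Cmod_sub_rev m0; lra.
have tG : 0 < t * G by apply: Rmult_lt_0_compat.
have hn_0 : h n <> RtoC 0 by apply/Cmod_gt_0; lra.
have eS : (\csum_(i : I) (amp i / L * Rcpow N (RtoC vt * (b i - 1)) * xi i ^ n * gm i) = S n / (T * L))%C.
  rewrite [RHS]/Cdiv [RHS]Cmult_comm /S -/N csum_mull; apply: eq_bigr => i _.
  rewrite (_ : RtoC vt * b i - 1 = RtoC vt * (b i - 1) + (RtoC vt - 1))%C; last by ring.
  by rewrite Rcpow_add -/T; field; split.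
rewrite eS (_ : _ - _ = (p n - S n) / h n + S n * (- (h n - T * L)) / (h n * (T * L)))%C; last first.
  by field; split; [|split].
apply: Rle_trans (Cmod_triangle _ _) _.
have hn2 : (h n * (T * L))%C <> RtoC 0 by apply: Cmult_neq_0.
rewrite !Cmod_div // (Cmod_mult (S n)) (Cmod_mult (h n)) Cmod_opp m0.
set P1 := Rpower N (vt * (beta - 1) - 1).
have P10 : 0 < P1 by apply: Rpower_gt0.
have eP1 : Rpower N (vt * beta - 2) = P1 * t.
  by rewrite /P1 /t -Rpower_plus; congr Rpower; ring.
have eP2 : Rpower N (vt * beta - 1) = P1 * t * N.
  rewrite /P1 /t -Rpower_plus -{3}(Rpower_1 N); last lra.
  by rewrite -Rpower_plus; congr Rpower; ring.
rewrite Rmult_plus_distr_r; apply: Rplus_le_compat.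
  apply/Rle_div_l; first lra.
  apply: (@Rle_trans _ (Rabs D * (P1 * t))).
    apply: Rle_trans Hp _; rewrite eP1; apply: Rmult_le_compat_r; last exact: Rle_abs.
    exact/Rlt_le/Rmult_lt_0_compat.
  have D0 := Rabs_pos D.
  have -> : Rabs D * (P1 * t) = 2 * Rabs D / G * P1 * (t * G / 2) by field; lra.
  apply: Rmult_le_compat_l => //; apply: Rmult_le_pos; last lra.
  by apply: Rdiv_le_0_compat; lra.
apply/Rle_div_l; first by apply: Rmult_lt_0_compat; lra.
apply: (@Rle_trans _ (CS * (P1 * t * N) * (Rabs D' * (t * / N)))).
  by apply: Rmult_le_compat; try exact: Cmod_ge_0; rewrite -?eP2.
have D0 := Rabs_pos D'.
have -> : CS * (P1 * t * N) * (Rabs D' * (t * / N)) =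
  2 * CS * Rabs D' / G ^ 2 * P1 * (t * G / 2 * (t * G)) by field; lra.
apply: Rmult_le_compat_l.
  apply: Rmult_le_pos; last lra.
  by apply: Rdiv_le_0_compat; [repeat apply: Rmult_le_pos; lra | apply: pow_lt].
by apply: Rmult_le_compat_r; lra.
Qed.

Lemma Czpow_sub (x : C) (m k : nat) : x <> RtoC 0 ->
  Czpow x (Z.of_nat m - Z.of_nat k) = (x ^ m / x ^ k)%C.
Proof.
move=> x0; have xk := Cpow_nz x k x0.
case: (Nat.le_gt_cases k m) => h.
  have -> : (Z.of_nat m - Z.of_nat k = Z.of_nat (m - k)%coq_nat)%Z by lia.
  have -> : (x ^ m = x ^ (m - k)%coq_nat * x ^ k)%C by rewrite -Cpow_add_r; congr Cpow; lia.
  rewrite (_ : x ^ (m - k)%coq_nat * x ^ k / x ^ k = x ^ (m - k)%coq_nat)%C; last by field.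
  rewrite minusE; case: (m - k)%N => //= j.
  by rewrite SuccNat2Pos.id_succ.
have -> : (Z.of_nat m - Z.of_nat k = - Z.of_nat (k - m)%coq_nat)%Z by lia.
have -> : (x ^ k = x ^ (k - m)%coq_nat * x ^ m)%C by rewrite -Cpow_add_r; congr Cpow; lia.
have xm := Cpow_nz x m x0; have xkm := Cpow_nz x (k - m)%coq_nat x0.
rewrite (_ : x ^ m / (x ^ (k - m)%coq_nat * x ^ m) = / x ^ (k - m)%coq_nat)%C; last by field.
have : (k - m)%coq_nat <> 0%N by lia.
rewrite minusE; case: (k - m)%N => //= j _.
by rewrite SuccNat2Pos.id_succ.
Qed.

Lemma rGamma_pos_neq0 (vt : R) : 0 < vt -> rGamma (RtoC vt) <> RtoC 0.
Proof.
move=> v0; case: (rGamma_limit (RtoC vt)) => c _ [_]; apply=> n.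
apply: Cmult_neq_0; last first.
  have d0 : (RtoC (INR (n.+1)`!) * Rcpow (INR n.+1) (RtoC vt))%C <> RtoC 0.
    by apply: Cmult_neq_0; [apply: RtoC_factn_neq0 | apply: Rcpow_neq0].
  by apply/Cmod_gt_0; rewrite Cmod_inv //; apply/Rinv_0_lt_compat/Cmod_gt_0.
apply/Cmod_gt_0; rewrite Cmod_cprod; apply: Rprod_gt0 => j _.
rewrite -RtoC_plus Cmod_R; apply: Rabs_pos_lt.
by have := pos_INR j; lra.
Qed.

Lemma finite_argmax (I : finType) (f : I -> R) : I -> exists i, forall j, f j <= f i.
Proof.
move=> i0; suff [i hi] : exists i, forall j, j \in enum I -> f j <= f i.
  by exists i => j; apply: hi; rewrite mem_enum.
elim: (enum I) => [|k s [i hi]]; first by exists i0.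
case: (Rle_lt_dec (f k) (f i)) => h; [exists i | exists k] => j; rewrite inE => /orP [/eqP ->|/hi] //; lra.
Qed.

(** * The normalisation constant *)

(** Dividing by [r] moves the singular point to [1], and passing to logarithmic
    coordinates trades [Delta0] for the complement of a cone. *)
Lemma normalise (theta : nat -> R) (r vtheta : R) (K : C) (g : C -> C) :
  0 < r -> continues (g_coef theta) g -> class_F r vtheta K g ->
  let gam q := g (RtoC r * q)%C in
  exists c Mg dg, [/\ 0 < c, 0 < dg, 0 <= Mg,
    forall x p, off_cone c x p -> cdiff gam (Cexp (pt x p)) &
    (forall x p, off_cone c x p -> Cmod (1 - Cexp (pt x p)) < dg ->
       Cmod (gam (Cexp (pt x p)) - (RtoC vtheta * llog (Cexp (pt x p)) + K)) <= Mg * Cmod (1 - Cexp (pt x p)))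
    /\ taylor gam (fun k => if k is 0%N then RtoC 0 else RtoC r ^ k * RtoC (theta k) / RtoC (INR k))%C].
Proof.
move=> r0 [rho rho0 gs] [R0 [phi [rR hphi hol [M [d [d0 sing]]]]]] gam.
have rC : RtoC r <> RtoC 0 by move=> /RtoC_inj; lra.
case: (off_cone_Delta0 r0 rR hphi) => c [c0 Hc].
have dist q : Cmod (RtoC r * q - RtoC r) = r * Cmod (1 - q).
  rewrite (_ : RtoC r * q - RtoC r = RtoC r * (q - 1))%C; last by ring.
  by rewrite Cmod_mult Cmod_R Rabs_pos_eq ?(Cmod_sub_rev q); lra.
exists c, (Rabs M * r), (d / r); split=> //.
- exact: Rdiv_lt_0_compat.
- by apply: Rmult_le_pos; [apply: Rabs_pos | lra].
- move=> x p /Hc /hol /cder_ex_derive [l hl].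
  by eexists; apply: cder_comp hl; apply: cder_scal; apply: cder_id.
split.
  move=> x p hc; set q := Cexp (pt x p) => hq.
  have := sing _ (Hc x p hc); rewrite -/q dist => /(_ _) h.
  have {}h := h ltac:(rewrite Rmult_comm; apply/Rlt_div_r => //).
  have e : (1 / (1 - RtoC r * q / RtoC r) = 1 / (1 - q))%C.
    by congr (_ / (_ - _))%C; field.
  rewrite e in h; apply: Rle_trans h _; rewrite -Rmult_assoc.
  apply: Rmult_le_compat_r; first exact: Cmod_ge_0.
  by apply: Rmult_le_compat_r; [lra | apply: Rle_abs].
have T := taylor_dilate rC (taylor_of_pseries rho0 gs).
apply: taylor_ext T => // -[|k]; first by rewrite /= Cmult_0_r.
rewrite /g_coef RtoC_div; last exact: not_0_INR.
by rewrite /Cdiv Cmult_assoc.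
Qed.

Lemma Cexp_Carg z : Cmod z = 1 -> Cexp (pt 0 (Carg z)) = z.
Proof.
move=> z1; have z0 : z <> RtoC 0 by apply/Cmod_gt_0; lra.
by rewrite -[RHS](Cexp_Clog z0) /Clog z1 ln_1.
Qed.

Lemma sin_half_eq0 p : sin (p / 2) = 0 -> Cexp (pt 0 p) = RtoC 1.
Proof.
move=> s0; rewrite /Cexp /= exp_0 cos_half s0.
rewrite {1}(_ : p = 2 * (p / 2)); last by field.
by rewrite sin_2a s0 /RtoC; congr pair; ring.
Qed.

(** The case of the single singular point [1] with exponent [b = 1]. *)
Lemma ewens_h_asym (theta : nat -> R) (r vtheta : R) (K : C) (g : C -> C) :
  0 < r -> 0 < vtheta -> continues (g_coef theta) g -> class_F r vtheta K g ->
  exists D n0, forall n, (n0 <= n)%N ->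
    Cmod (RtoC r ^ n * (RtoC (/ INR n`!) * cyc_sum n (fun k => RtoC (theta k)))
          - Rcpow (INR n) (RtoC vtheta - 1) * (Cexp K * rGamma (RtoC vtheta)))
      <= D * Rpower (INR n) (vtheta - 2).
Proof.
move=> r0 v0 gc gF.
case: (normalise r0 gc gF) => c [Mg [dg [c0 dg0 Mg0 hol [sing T]]]].
have sep (i j : 'I_1) : i != j -> sin ((0 - 0) / 2) <> 0 by rewrite !ord1.
have pi0 := PI_RGT_0.
have range (i : 'I_1) : - PI <= 0 <= PI by lra.
have ble (i : 'I_1) : Re (RtoC 1) <= 1 by apply: Rle_refl.
have rot1 : Cexp (pt 0 (- 0)) = RtoC 1 by rewrite Ropp_0 -[pt 0 0]/(RtoC 0) Cexp_0.
have ep := exp_coef_scale (RtoC r) (cycle_index_exp_coef (fun k => RtoC (theta k))).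
have {}ep : exp_coef (fun k => \csum_(i : 'I_1) (RtoC 1 * (rot (fun=> 0) i ^ k * (RtoC r ^ k * RtoC (theta k)))))%C
    (fun n => RtoC r ^ n * (RtoC (/ INR n`!) * cyc_sum n (fun k => RtoC (theta k))))%C.
  apply: exp_coef_ext ep => k.
  by rewrite big_ord_recl big_ord0 /rot rot1 Cpow_1_l !Cmult_1_l Cplus_0_r.
case: (singularity_analysis c0 dg0 Mg0 v0 hol sing T sep range ble ord0 ep) => D [n0 H].
exists D, n0 => n /H; rewrite big_ord_recl big_ord0 /rot rot1 Cpow_1_l /alpha /sing_amp.
rewrite big_pred0 => [|j]; last by rewrite ord1.
by rewrite Cexp_0 !Cmult_1_l !Cmult_1_r Cplus_0_r Rmult_1_r.
Qed.

Lemma csum_box (n : nat) (Q : nat -> nat -> bool) (F : nat -> nat -> C) :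
  (\csum_(k1 < n) \csum_(k2 < n | Q k1 k2) F k1 k2)%C =
  \big[Cplus/RtoC 0]_(kk in [set kk : 'I_n * 'I_n | Q kk.1 kk.2]) F kk.1 kk.2.
Proof.
rewrite pair_big_dep /=; apply: eq_bigl => kk; by rewrite inE.
Qed.

(** * The expectation *)

Lemma csum_support (T : finType) (A : {set T}) (Q : pred T) (F : T -> C) :
  (forall x, x \notin A -> F x = RtoC 0) ->
  \big[Cplus/RtoC 0]_(x | Q x) F x = \big[Cplus/RtoC 0]_(x in A | Q x) F x.
Proof.
move=> H; rewrite (bigID (fun x => x \in A)) /= [X in (_ + X)%C]big1; last first.
  by move=> x /andP [_ /H].
by rewrite Cplus_0_r; apply: eq_bigl => x; rewrite andbC.
Qed.

Theorem theorem3p9 (theta : nat -> R) (P : bipoly) (x1 x2 : C)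
    (r vtheta : R) (K : C) (g : C -> C)
    (theta_gt0 : forall k : nat, (1 <= k)%N -> 0 < theta k)
    (x1_norm : Cmod x1 = 1) (x2_norm : Cmod x2 = 1)
    (x_indep : forall k1 k2 : Z,
       (k1, k2) <> (0%Z, 0%Z) -> (Czpow x1 k1 * Czpow x2 k2)%C <> RtoC 1)
    (r_gt0 : 0 < r) (vtheta_gt0 : 0 < vtheta)
    (g_cont : continues (g_coef theta) g)
    (g_F : class_F r vtheta K g) :
  exists2 err : nat -> nat -> nat -> C,
    forall k1 k2 : nat, bigO_invN (err k1 k2) &
    eventually (fun N : nat =>
      ewens_expect theta (@W N P x1 x2) =
      (\csum_(k1 < bsize P)
       \csum_(k2 < bsize P | ~~ Ceq_dec (bcoef P k1 k2) (RtoC 0))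
         (E2 g r K P x1 x2 k1 k2
          * Rcpow (INR N) (RtoC vtheta * (bcoef P k1 k2 - 1))
          * x1 ^ (N * k1) * x2 ^ (N * k2)
          * (CGamma (RtoC vtheta) * rGamma (RtoC vtheta * bcoef P k1 k2)
             + err k1 k2 N)))%C).
Proof.
have x1n0 : x1 <> RtoC 0 by apply/Cmod_gt_0; rewrite x1_norm; lra.
have x2n0 : x2 <> RtoC 0 by apply/Cmod_gt_0; rewrite x2_norm; lra.
pose n := bsize P.
pose bk (kk : 'I_n * 'I_n) := bcoef P kk.1 kk.2.
(* each monomial that occurs contributes a singular point *)
pose A := [set kk : 'I_n * 'I_n | ~~ Ceq_dec (bcoef P kk.1 kk.2) (RtoC 0)].
have notA kk : kk \notin A -> bk kk = RtoC 0.
  by rewrite inE negbK /bk; case: Ceq_dec.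
have inA kk : kk \in A -> bk kk <> RtoC 0.
  by rewrite inE /bk; case: Ceq_dec.
pose pN N := (RtoC (/ INR N`!) * cyc_sum N (fun k => RtoC (theta k) * beval P (x1 ^ k) (x2 ^ k)))%C.
pose hN N := (RtoC (/ INR N`!) * cyc_sum N (fun k => RtoC (theta k)))%C.
have expect N : ewens_expect theta (@W N P x1 x2) = (pN N / hN N)%C.
  exact: ewens_expect_ratio.
have ep : exp_coef (fun k => RtoC (theta k) * beval P (x1 ^ k) (x2 ^ k))%C pN.
  exact: cycle_index_exp_coef.
pose xk (kk : 'I_n * 'I_n) := (x1 ^ kk.1 * x2 ^ kk.2)%C.
have bevalE k : beval P (x1 ^ k) (x2 ^ k) = \big[Cplus/RtoC 0]_(kk in A) (bk kk * xk kk ^ k)%C.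
  rewrite /beval (csum_box _ (fun _ _ => true) (fun k1 k2 => bcoef P k1 k2 * (x1 ^ k) ^ k1 * (x2 ^ k) ^ k2)%C).
  transitivity (\big[Cplus/RtoC 0]_(kk : 'I_n * 'I_n) (bk kk * xk kk ^ k)%C).
    apply: eq_big => [kk|kk _]; first by rewrite inE.
    rewrite /xk Cpow_mult_l -!Cpow_mult_r (Nat.mul_comm kk.1) (Nat.mul_comm kk.2).
    by rewrite /bk Cmult_assoc.
  rewrite [LHS](csum_support (A := A)) => [|kk /notA ->]; last by ring.
  by apply: eq_bigl => kk; rewrite andbT.
have boxed (t : nat -> nat -> C) :
    (\csum_(k1 < n) \csum_(k2 < n | ~~ Ceq_dec (bcoef P k1 k2) (RtoC 0)) t k1 k2)%C =
    \big[Cplus/RtoC 0]_(kk in A) t kk.1 kk.2.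
  rewrite (csum_box _ (fun k1 k2 => ~~ Ceq_dec (bcoef P k1 k2) (RtoC 0)) t).
  by apply: eq_bigl => kk; rewrite inE.
(* for the zero polynomial the expectation vanishes as soon as [N > 0] *)
case: (set_0Vmem A) => [A0|[kk0 hkk0]].
  exists (fun _ _ _ => RtoC 0).
    by move=> _ _; exists 0, 0%N => N _; rewrite Cmod_0 /Rdiv Rmult_0_l; apply: Rle_refl.
  exists 1%N => -[|N] hN1; first by lia.
  rewrite expect (boxed (fun k1 k2 => E2 g r K P x1 x2 k1 k2
    * Rcpow (INR N.+1) (RtoC vtheta * (bcoef P k1 k2 - 1)) * x1 ^ (N.+1 * k1) * x2 ^ (N.+1 * k2)
    * (CGamma (RtoC vtheta) * rGamma (RtoC vtheta * bcoef P k1 k2) + RtoC 0))%C) A0 big_set0.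
  have [_ rec] := ep; have := rec N; rewrite big1 => [e|k _]; last first.
    by rewrite bevalE A0 big_set0; ring.
  have i0 := @RtoC_INRS_neq0 N.
  have -> : pN N.+1 = (RtoC (INR N.+1) * pN N.+1 / RtoC (INR N.+1))%C by field.
  by rewrite e /Cdiv !Cmult_0_l.
pose ev : 'I_#|A| -> 'I_n * 'I_n := enum_val.
have evA i : ev i \in A by apply: enum_valP.
have ev_inj : injective ev by apply: enum_val_inj.
pose b i := bk (ev i); pose xi i := xk (ev i).
have xi1 i : Cmod (xi i) = 1.
  by rewrite /xi /xk Cmod_mult !Cmod_pow x1_norm x2_norm !pow1; lra.
have xin0 i : xi i <> RtoC 0 by apply/Cmod_gt_0; rewrite xi1; lra.
(* the independence of [x1] and [x2] separates the singular points *)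
have xi_inj i j : xi i = xi j -> i = j.
  move=> e; apply: ev_inj; apply: NNPP => ne.
  apply: (x_indep (Z.of_nat (ev i).1 - Z.of_nat (ev j).1)%Z (Z.of_nat (ev i).2 - Z.of_nat (ev j).2)%Z).
    case=> e1 e2; apply: ne.
    have f1 : (ev i).1 = (ev j).1 by apply: val_inj => /=; lia.
    have f2 : (ev i).2 = (ev j).2 by apply: val_inj => /=; lia.
    by rewrite [LHS]surjective_pairing [RHS]surjective_pairing f1 f2.
  rewrite !Czpow_sub //; have := xin0 j; move: e; rewrite /xi /xk => e jn0.
  have y1 := Cpow_nz x1 (ev j).1 x1n0; have y2 := Cpow_nz x2 (ev j).2 x2n0.
  transitivity (x1 ^ (ev i).1 * x2 ^ (ev i).2 / (x1 ^ (ev j).1 * x2 ^ (ev j).2))%C; first by field.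
  by rewrite e; field.
pose th i := - Carg (xi i).
have rotE i : rot th i = xi i by rewrite /rot /th Ropp_involutive Cexp_Carg.
have pi0 := PI_RGT_0.
have rC : RtoC r <> RtoC 0 by move=> /RtoC_inj; lra.
have range i : - PI <= th i <= PI by have := Carg_range (xin0 i); rewrite /th; lra.
have sep i j : i != j -> sin ((th i - th j) / 2) <> 0.
  move=> /eqP ij /sin_half_eq0 e; apply: ij; apply: xi_inj.
  have := rot_spt th i j; rewrite e -inv_rot !rotE => h.
  by rewrite -[RHS]Cmult_1_r -(Cinv_l (xi i) (xin0 i)) Cmult_assoc h Cmult_1_l.
have i0 : 'I_#|A| by exists (index kk0 (enum A)); rewrite cardE index_mem mem_enum.
case: (finite_argmax (fun i => Re (b i)) i0) => im him.
pose beta := Re (b im).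
case: (normalise r_gt0 g_cont g_F) => c [Mg [dg [c0 dg0 Mg0 hol [sing T]]]].
pose tau k := (RtoC r ^ k * RtoC (theta k))%C.
have ep2 : exp_coef (fun k => \csum_(i < #|A|) (b i * (rot th i ^ k * tau k)))%C
    (fun N => RtoC r ^ N * pN N)%C.
  apply: exp_coef_ext (exp_coef_scale (RtoC r) ep) => k.
  rewrite bevalE big_enum_val !csum_mull; apply: eq_bigr => i _.
  rewrite rotE /tau /b /xi /ev; move: (_ ^ k.+1)%C (_ ^ k.+1)%C => u v; ring.
case: (singularity_analysis (b := b) (beta := beta) c0 dg0 Mg0 vtheta_gt0 hol sing T sep range him i0 ep2) => D [n0 HD].
case: (ewens_h_asym r_gt0 vtheta_gt0 g_cont g_F) => D' [n1 HD'].
pose amp i := sing_amp (fun q => g (RtoC r * q)%C) K th b i.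
pose L := (Cexp K * rGamma (RtoC vtheta))%C.
have g0 := rGamma_pos_neq0 vtheta_gt0.
have eK0 := @Cexp_neq0 K.
have L0 : L <> RtoC 0 by apply: Cmult_neq_0.
case: (@ratio_asym _ xi b amp (fun i => rGamma (RtoC vtheta * b i)) vtheta beta L
   (fun N => RtoC r ^ N * pN N)%C (fun N => RtoC r ^ N * hN N)%C D D' n0 n1 xi1 him vtheta_gt0 L0) => [N hN'|N hN'|M [n2 HM]].
- have := HD N hN'; rewrite /alpha; under eq_bigr => i _ do rewrite rotE.
  by [].
- exact: HD'.
pose co i N := (E2 g r K P x1 x2 (ev i).1 (ev i).2 * Rcpow (INR N) (RtoC vtheta * (b i - 1))
   * x1 ^ (N * (ev i).1)%N * x2 ^ (N * (ev i).2)%N)%C.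
have E2E i : E2 g r K P x1 x2 (ev i).1 (ev i).2 = (amp i / Cexp K)%C.
  rewrite /amp /sing_amp /E2.
  have eS : \big[Cplus/RtoC 0]_(j | j != i) (b j * g (RtoC r * Cexp (pt 0 (th i - th j))))%C =
    (\csum_(m1 < n) \csum_(m2 < n | (m1 != (ev i).1 :> nat) || (m2 != (ev i).2 :> nat))
      (bcoef P m1 m2 * g (RtoC r * Czpow x1 (Z.of_nat m1 - Z.of_nat (ev i).1)
                                 * Czpow x2 (Z.of_nat m2 - Z.of_nat (ev i).2))))%C.
    rewrite (csum_box _ (fun m1 m2 => (m1 != (ev i).1 :> nat) || (m2 != (ev i).2 :> nat))
      (fun m1 m2 => bcoef P m1 m2 * g (RtoC r * Czpow x1 (Z.of_nat m1 - Z.of_nat (ev i).1)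
                                 * Czpow x2 (Z.of_nat m2 - Z.of_nat (ev i).2)))%C).
    rewrite [RHS](csum_support (A := A)); last by move=> kk /notA; rewrite /bk => ->; ring.
    transitivity (\big[Cplus/RtoC 0]_(kk in A | kk != ev i) (bk kk * g (RtoC r * (xk kk / xi i)))%C).
      rewrite big_enum_val_cond; apply: eq_big => [j|j _]; first by rewrite (inj_eq ev_inj).
      congr (_ * g (_ * _))%C; have := rot_spt th i j; rewrite -inv_rot !rotE => <-.
      by [].
    apply: eq_big => [kk|kk _].
      rewrite inE; congr (_ && _); case: (ev i) kk => a1 a2 [m1 m2] /=.
      by rewrite xpair_eqE negb_and.
    rewrite !Czpow_sub //; congr (_ * g _)%C; rewrite /xi /xk.
    have y1 := Cpow_nz x1 (ev i).1 x1n0; have y2 := Cpow_nz x2 (ev i).2 x2n0.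
    move: y1 y2 (x1 ^ kk.1)%C (x2 ^ kk.2)%C.
    by move: (x1 ^ (ev i).1)%C (x2 ^ (ev i).2)%C => u v y1 y2 u' v'; field.
  rewrite eS Cexp_sum.
  have -> : (K * (bcoef P (ev i).1 (ev i).2 - 1) = b i * K + - K)%C by rewrite /b /bk; ring.
  rewrite Cexp_add Cexp_inv /Cdiv -!Cmult_assoc (Cmult_comm (/ Cexp K)%C); congr (_ * (_ * _))%C.
  by apply: eq_bigr => m1 _; rewrite Cexp_sum.
have coE i N : co i N = (amp i / Cexp K * Rcpow (INR N) (RtoC vtheta * (b i - 1)) * xi i ^ N)%C.
  rewrite /co E2E /xi /xk Cpow_mult_l -!Cpow_mult_r !multE (mulnC N) (mulnC N); ring.
have amp0 i : amp i <> RtoC 0 by apply: Cmult_neq_0; apply: Cexp_neq0.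
have co0 i N : co i N <> RtoC 0.
  rewrite coE; apply: Cmult_neq_0; last exact: Cpow_nz.
  apply: Cmult_neq_0; last exact: Rcpow_neq0.
  by apply/Cmod_gt_0; rewrite Cmod_div //; apply: Rdiv_lt_0_compat; apply/Cmod_gt_0.
pose main i := (CGamma (RtoC vtheta) * rGamma (RtoC vtheta * b i))%C.
pose rest N := (pN N / hN N - \csum_(i < #|A|) (co i N * main i))%C.
(* The total error is [O (1 / N)] relative to the term of index [im], the largest
   one, so it can be charged to that index alone. *)
pose err k1 k2 N := if (k1 == (ev im).1 :> nat) && (k2 == (ev im).2 :> nat)
   then (rest N / co im N)%C else RtoC 0.
have err_im N : err (ev im).1 (ev im).2 N = (rest N / co im N)%C by rewrite /err !eqxx.
have err_other i N : i != im -> err (ev i).1 (ev i).2 N = RtoC 0.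
  move=> ne; rewrite /err; case: ifP => // /andP [/eqP e1 /eqP e2].
  case/eqP: ne; apply: ev_inj.
  rewrite [LHS]surjective_pairing [RHS]surjective_pairing.
  by rewrite (val_inj e1) (val_inj e2).
exists err.
  move=> k1 k2; rewrite /err; case: (_ && _); last first.
    by exists 0, 0%N => N _; rewrite Cmod_0 /Rdiv Rmult_0_l; apply: Rle_refl.
  exists (M / Cmod (amp im / Cexp K)), n2.+1 => -[|N]; first by lia.
  move=> /leP hN2; have N0 := INRS_gt0 N.
  have a0 : 0 < Cmod (amp im / Cexp K).
    by rewrite Cmod_div //; apply: Rdiv_lt_0_compat; apply/Cmod_gt_0.
  have q0 := Rpower_gt0 (INR N.+1) (vtheta * (beta - 1)).
  have mco : Cmod (co im N.+1) = Cmod (amp im / Cexp K) * Rpower (INR N.+1) (vtheta * (beta - 1)).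
    rewrite coE Cmod_mult Cmod_pow xi1 pow1 Rmult_1_r Cmod_mult Cmod_Rcpow /beta.
    by congr (_ * Rpower _ _); rewrite /Re /=; ring.
  rewrite Cmod_div // mco; apply/Rle_div_l; first exact: Rmult_lt_0_compat.
  have -> : M / Cmod (amp im / Cexp K) / INR N.+1 *
     (Cmod (amp im / Cexp K) * Rpower (INR N.+1) (vtheta * (beta - 1)))
     = M * Rpower (INR N.+1) (vtheta * (beta - 1) - 1).
    rewrite /Rminus Rpower_plus Rpower_Ropp Rpower_1 //; field; lra.
  apply: Rle_trans (HM N.+1 (ltnW hN2)); apply: Req_le; congr (Cmod (_ - _)).
    have rN := Cpow_nz (RtoC r) N.+1 rC.
    by field; split=> //; rewrite /hN -ewens_h_coef => /RtoC_inj; have := ewens_h_gt0 N.+1 theta_gt0; lra.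
  apply: eq_bigr => i _; rewrite coE /main /L /CGamma; field; by split.
exists 0%N => N _; rewrite expect.
rewrite (boxed (fun k1 k2 => E2 g r K P x1 x2 k1 k2
  * Rcpow (INR N) (RtoC vtheta * (bcoef P k1 k2 - 1)) * x1 ^ (N * k1) * x2 ^ (N * k2)
  * (CGamma (RtoC vtheta) * rGamma (RtoC vtheta * bcoef P k1 k2) + err k1 k2 N))%C) big_enum_val.
transitivity (\csum_(i < #|A|) (co i N * main i) + \csum_(i < #|A|) (co i N * err (ev i).1 (ev i).2 N))%C.
  rewrite (bigD1 im (P := xpredT) (F := fun i => co i N * err (ev i).1 (ev i).2 N)%C) //=.
  rewrite [X in (_ + (_ + X))%C]big1 => [|i /err_other ->]; last by rewrite Cmult_0_r.
  have fill (s u v : C) : u <> RtoC 0 -> v = (s + (u * ((v - s) / u) + RtoC 0))%C by move=> ?; field.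
  by rewrite err_im; apply: fill; apply: co0.
rewrite -csum_split; apply: eq_bigr => i _; rewrite -Cmult_plus_distr_l //.
Qed.
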